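(* Let $n\ge 1$, let $u(x,t)$ be a wave on $\mathbb R^n$, let $a<b$ be real numbers, and put $s=b-a$. Then for every $m\in\mathbb Z$, $$u_{a+m(b-a)}=u_b*\Psi_{m,s}-u_a*\Psi_{m-1,s},$$ where, for each $m\in\mathbb Z$, $\Psi_{m,s}\in\mathscr E'(\mathbb R^n)$ is the compactly supported distribution whose Fourier transform is $$\widetilde\Psi_{m,s}(\xi)=\frac{\sin(ms|\xi|)}{\sin(s|\xi|)}=U_{m-1}(\cos(s|\xi|)),\qquad \xi\in\mathbb R^n.$$ In particular, the snapshots $u_{a+m(b-a)}$, $m\in\mathbb Z$, are determined by $u_a$ and $u_b$.
   Context: A wave on $\mathbb R^n$ is a function $u\in C^\infty(\mathbb R^n\times\mathbb R)$ satisfying $\Delta u=\partial^2u/\partial t^2$, where $\Delta=\sum_{j=1}^n\partial^2/\partial x_j^2$; its snapshot at time $t$ is $u_t(x)=u(x,t)$. $\mathscr E'(\mathbb R^n)$ is the space of compactly supported distributions on $\mathbb R^n$; for $T\in\mathscr E'(\mathbb R^n)$ the Fourier transform is $\widetilde T(\xi)=\int e^{-i\xi\cdot x}\,dT(x)$, and for $f\in C^\infty(\mathbb R^n)$, $(f*T)(x)=\int f(x-y)\,dT(y)$. $U_k$ is the Chebyshev polynomial of the second kind of degree $k$ for $k\ge 0$, and for negative indices one uses the convention $U_{-m-1}=-U_{m-1}$ for integers $m\ge 0$ (in particular $U_{-1}=0$). Quotients of sines are understood as extended by continuity. *)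

(* Defs.v *)
From mathcomp Require Import all_boot all_order all_algebra.
From mathcomp Require Import complex.
From mathcomp Require Import all_classical all_reals all_analysis.

Set Implicit Arguments.
Unset Strict Implicit.
Unset Printing Implicit Defensive.

Import Order.TTheory GRing.Theory Num.Theory.
Import numFieldNormedType.Exports.

Local Open Scope classical_set_scope.
Local Open Scope ring_scope.
Local Open Scope complex_scope.

(* Iterated directional derivatives.  On a finite-dimensional space, C^infinity
   (all partial derivatives of all orders exist and are continuous) is the same
   as the existence and continuity of all iterated directional derivatives;
   [smooth] is only used for V = R^n and V = R^n x R.  Complex-valued functions
   are differentiated through their real and imaginary parts, as [R[i]] is not
   a normed R-module in the library. *)
Section Smooth.
Variables (R : realType) (V : normedModType R).

Definition Dir (v : V) (f : V -> R[i]) : V -> R[i] :=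
  fun x => 'D_v (fun y => complex.Re (f y)) x +i*
           'D_v (fun y => complex.Im (f y)) x.

Definition Dirs (vs : seq V) (f : V -> R[i]) : V -> R[i] := foldr Dir f vs.

Definition smooth (f : V -> R[i]) : Prop :=
  forall vs : seq V,
    let g := fun x => complex.Re (Dirs vs f x) in
    let h := fun x => complex.Im (Dirs vs f x) in
    [/\ continuous g, continuous h,
        forall x v, derivable g x v & forall x v, derivable h x v].

End Smooth.

Section Waves.
Variables (R : realType) (n : nat).

Definition basis_vec (i : 'I_n) : 'rV[R]_n := delta_mx 0 i.

Definition space_dir (i : 'I_n) : 'rV[R]_n * R := (basis_vec i, 0).

Definition time_dir : 'rV[R]_n * R := (0, 1).

Definition wave (u : 'rV[R]_n * R -> R[i]) : Prop :=
  smooth u /\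
  forall p, \sum_(i < n) Dirs [:: space_dir i; space_dir i] u p
            = Dirs [:: time_dir; time_dir] u p.

Definition snapshot (u : 'rV[R]_n * R -> R[i]) (t : R) : 'rV[R]_n -> R[i] :=
  fun x => u (x, t).

End Waves.

(* E'(R^n) is taken to be the topological dual of the Frechet space
   C^infinity(R^n), in the usual identification of a compactly supported
   distribution with its extension to C^infinity(R^n).  An element is a
   functional on all functions R^n -> C of which only the values on smooth
   functions matter; in particular two elements are equal when they agree
   there. *)
Section CompactlySupportedDistributions.
Variables (R : realType) (n : nat).

Definition functional : Type := ('rV[R]_n -> R[i]) -> R[i].

(* Maximum over K of the moduli of all partial derivatives of order <= N. *)
Definition seminorm (K : set 'rV[R]_n) (N : nat) (phi : 'rV[R]_n -> R[i]) : R :=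
  sup [set r | exists (w : seq 'I_n) (x : 'rV[R]_n),
    [/\ (size w <= N)%N, K x &
        r = ComplexField.Normc.normc (Dirs [seq basis_vec R i | i <- w] phi x)]].

Definition compactly_supported_distribution (T : functional) : Prop :=
  (forall (c : R[i]) (phi psi : 'rV[R]_n -> R[i]), smooth phi -> smooth psi ->
     T (fun x => c * phi x + psi x) = c * T phi + T psi) /\
  (exists (K : set 'rV[R]_n) (N : nat) (C : R), compact K /\
     forall phi : 'rV[R]_n -> R[i], smooth phi ->
       ComplexField.Normc.normc (T phi) <= C * seminorm K N phi).

Definition dot (x y : 'rV[R]_n) : R := \sum_(i < n) x 0 i * y 0 i.

(* Euclidean norm; the library's norm on ['rV[R]_n] is the sup norm. *)
Definition eucl_norm (x : 'rV[R]_n) : R := Num.sqrt (dot x x).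

Definition expi (theta : R) : R[i] := cos theta +i* sin theta.

Definition fourier (T : functional) (xi : 'rV[R]_n) : R[i] :=
  T (fun x => expi (- dot xi x)).

Definition convolution (f : 'rV[R]_n -> R[i]) (T : functional) :
    'rV[R]_n -> R[i] :=
  fun x => T (fun y => f (x - y)).

Definition sine_quotient (m : int) (s : R) (xi : 'rV[R]_n) : R :=
  sin (m%:~R * s * eucl_norm xi) / sin (s * eucl_norm xi).

End CompactlySupportedDistributions.

Section Chebyshev.
Variable R : realType.

Fixpoint chebyshevU_nat (k : nat) : {poly R} :=
  match k with
  | 0 => 1
  | k1.+1 => match k1 with
             | 0 => 2%:R *: 'X
             | k2.+1 => 2%:R *: 'X * chebyshevU_nat k1 - chebyshevU_nat k2
             end
  end.

(* [Negz j] is - j - 1, so U_(-m-1) = - U_(m-1) reads U_(-1) = 0 for m = 0 and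
   U_(Negz k.+1) = - U_k for m = k.+1. *)
Definition chebyshevU (k : int) : {poly R} :=
  match k with
  | Posz k => chebyshevU_nat k
  | Negz 0 => 0
  | Negz k.+1 => - chebyshevU_nat k
  end.

End Chebyshev.

(* Main.v *)
Require Import Defs.
From HB Require Import structures.
From mathcomp Require Import all_boot all_order all_algebra.
From mathcomp Require Import complex.
From mathcomp Require Import all_classical all_reals all_analysis.
From mathcomp Require Import ring lra zify.
Set Implicit Arguments.
Unset Strict Implicit.
Unset Printing Implicit Defensive.
Import Order.TTheory GRing.Theory Num.Theory.
Import numFieldNormedType.Exports.
Local Open Scope classical_set_scope.
Local Open Scope ring_scope.

(* The wave equation alone controls a wave by its data at time 0: if v is a wave
   that is even in time, |v (0, t)| is at most a constant times the maximum, over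
   a cube, of the space derivatives of order at most n of v (., 0).  On a lattice
   with space step h = sqrt n * tau, the leapfrog scheme reads
   v (j + 1) + v (j - 1) = 2 A v (j) + O(tau^3), where A averages the 2 n
   neighbours; A is a symmetric contraction, so a Chebyshev energy is conserved
   exactly and the l^2 norm stays controlled.  Differencing in space and a
   discrete Sobolev inequality turn this into a pointwise bound, and tau -> 0.

   Trigonometric polynomials are dense in C^infinity (one coordinate at a time,
   by Bernstein operators), and each of them extends to an even wave.  Hence
   f |-> v (0, t), where v is the even wave with v (., 0) = f, extends to a
   compactly supported distribution C_t with Fourier transform cos (t |xi|), and
   2 C_t * u_r = u_(r + t) + u_(r - t) for every wave u.

   As sin (m th) / sin th is the sum of the cos ((m - 1 - 2 i) th), i < m, one
   takes Psi_m to be the sum of the C_((m - 1 - 2 i) s); both convolutions are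
   then sums of snapshots which cancel except for one.  Density also shows that
   the Fourier transform determines the distribution. *)

(** A wave carries no growth condition in x, so its snapshots need not have Fourier transforms and
    C_t must act on them directly. The a priori estimate makes this possible because it holds for
    every even wave, not only for superpositions of plane waves: it extends f |-> v (0, t) from
    trigonometric polynomials by density, and it also identifies the extension on the data of an
    arbitrary even wave.

    Evenness in time encodes zero initial velocity, so that the data reduce to a single function.
    The estimate may lose derivatives, since a compactly supported distribution may have any finite
    order; one derivative per coordinate in the Sobolev step is therefore harmless. A remainder
    tau^3 per step is small enough because the errors are summed twice over k = t / tau steps, which
    leaves a total of order tau.

    For a general wave u, the function y |-> u_r (x - y) is the slice at time 0 of the average of u
    (x - y, r + .) and u (x - y, r - .), which is an even wave. So Cauchy problems are solved
    explicitly for cosines only. *)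

(* Locked because failed unifications would otherwise unfold the limit. *)
HB.lock Definition pd (R : realType) (V : normedModType R) (v : V) (f : V -> R) :
  V -> R := fun x => 'D_v f x.

Arguments pd {R V} v f x.

Lemma pdE (R : realType) (V : normedModType R) (v : V) (f : V -> R) x :
  pd v f x = 'D_v f x.
Proof. by rewrite pd.unlock. Qed.

(** * Smooth functions *)

Section SmoothCalculus.
Variables (R : realType) (V : normedModType R).
Implicit Types (f g : V -> R) (u v w x : V).

Definition dirs (vs : seq V) f : V -> R := foldr pd f vs.

Definition rsmooth f : Prop :=
  forall vs, continuous (dirs vs f) /\ forall x v, derivable (dirs vs f) x v.

Lemma dirs_cat vs ws f : dirs (vs ++ ws) f = dirs vs (dirs ws f).
Proof. exact: foldr_cat. Qed.

Lemma rsmooth_continuous f : rsmooth f -> continuous f.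
Proof. by move=> /(_ [::]) []. Qed.

Lemma rsmooth_derivable f x v : rsmooth f -> derivable f x v.
Proof. by move=> /(_ [::]) [_]; apply. Qed.

Lemma rsmooth_dirs vs f : rsmooth f -> rsmooth (dirs vs f).
Proof. by move=> sf ws; rewrite -dirs_cat; exact: sf. Qed.

Lemma rsmooth_derive v f : rsmooth f -> rsmooth (pd v f).
Proof. exact: (@rsmooth_dirs [:: v]). Qed.

(** Smooth functions form the largest class of continuous, directionally differentiable functions
    stable under every [pd v]; exhibiting any such class [P] that contains f therefore proves f
    smooth. *)
Lemma rsmooth_coind (P : (V -> R) -> Prop) :
  (forall f, P f -> [/\ continuous f, forall x v, derivable f x v &
                        forall v, P (pd v f)]) ->
  forall f, P f -> rsmooth f.
Proof.
move=> HP f Pf vs.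
suff /HP[] : P (dirs vs f) by [].
by elim: vs => //= v vs /HP[_ _]; apply.
Qed.

(* Unlike the products of smooth functions, this class is visibly stable under
   differentiation, as [rsmooth_coind] requires. *)
Inductive smooth_expr : (V -> R) -> Prop :=
| smooth_expr_base f : rsmooth f -> smooth_expr f
| smooth_expr_add f g : smooth_expr f -> smooth_expr g -> smooth_expr (f + g)
| smooth_expr_mul f g : smooth_expr f -> smooth_expr g -> smooth_expr (f * g).

Lemma smooth_exprP f : smooth_expr f -> rsmooth f.
Proof.
apply: rsmooth_coind => {}f; elim=> {f} [f sf|f g|f g].
- split=> [|x v|v]; first exact: rsmooth_continuous.
    exact: rsmooth_derivable.
  exact/smooth_expr_base/rsmooth_derive.
- move=> ef [cf df sf] eg [cg dg sg]; split=> [x|x v|v].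
  + exact: (continuousD (cf x) (cg x)).
  + exact: derivableD.
  + have -> : pd v (f + g) = pd v f + pd v g by apply/funext => x; rewrite !fctE !pdE deriveD.
    exact: smooth_expr_add.
- move=> ef [cf df sf] eg [cg dg sg]; split=> [x|x v|v].
  + exact: (continuousM (cf x) (cg x)).
  + exact: derivableM.
  + have -> : pd v (f * g) = f * pd v g + g * pd v f.
      by apply/funext => x; rewrite !fctE !pdE deriveM.
    by apply: smooth_expr_add; apply: smooth_expr_mul.
Qed.

Lemma rsmoothD f g : rsmooth f -> rsmooth g -> rsmooth (fun x => f x + g x).
Proof.
by move=> sf sg; apply: smooth_exprP; apply: smooth_expr_add;
  apply: smooth_expr_base.
Qed.

Lemma rsmoothM f g : rsmooth f -> rsmooth g -> rsmooth (fun x => f x * g x).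
Proof.
by move=> sf sg; apply: smooth_exprP; apply: smooth_expr_mul;
  apply: smooth_expr_base.
Qed.

Lemma rsmooth_cst (c : R) : rsmooth (fun=> c).
Proof.
apply: (rsmooth_coind (P := fun f => exists c, f = cst c)); last by exists c.
move=> _ [d ->]; split=> [x|x v|v]; first exact: cst_continuous.
  exact: derivable_cst.
by exists 0; apply/funext => x; rewrite pdE derive_cst.
Qed.

Lemma rsmoothZ c f : rsmooth f -> rsmooth (fun x => c * f x).
Proof. by move=> sf; apply: rsmoothM => //; exact: rsmooth_cst. Qed.

Lemma rsmoothB f g : rsmooth f -> rsmooth g -> rsmooth (fun x => f x - g x).
Proof.
move=> sf sg; have -> : (fun x => f x - g x) = (fun x => f x + -1 * g x).
  by apply/funext => x; rewrite mulN1r.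
exact/rsmoothD/rsmoothZ.
Qed.

Lemma rsmooth_sum (I : Type) (r : seq I) (F : I -> V -> R) :
  (forall i, rsmooth (F i)) -> rsmooth (fun x => \sum_(i <- r) F i x).
Proof.
move=> sF; elim: r => [|i r ih].
  under eq_fun do rewrite big_nil; exact: rsmooth_cst.
under eq_fun do rewrite big_cons; exact: rsmoothD.
Qed.

Lemma dirsD vs f g : rsmooth f -> rsmooth g ->
  dirs vs (fun x => f x + g x) = fun x => dirs vs f x + dirs vs g x.
Proof.
move=> sf sg; elim: vs => //= v vs ->; apply/funext => x.
by rewrite !pdE; apply: deriveD; apply: rsmooth_derivable; exact: rsmooth_dirs.
Qed.

Lemma dirsZ vs c f : rsmooth f ->
  dirs vs (fun x => c * f x) = fun x => c * dirs vs f x.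
Proof.
move=> sf; elim: vs => //= v vs ->; apply/funext => x.
by rewrite !pdE; apply: (deriveZ c); apply: rsmooth_derivable; exact: rsmooth_dirs.
Qed.

Lemma dirsB vs f g : rsmooth f -> rsmooth g ->
  dirs vs (fun x => f x - g x) = fun x => dirs vs f x - dirs vs g x.
Proof.
move=> sf sg; elim: vs => //= v vs ->; apply/funext => x.
by rewrite !pdE; apply: deriveB; apply: rsmooth_derivable; exact: rsmooth_dirs.
Qed.

Lemma deriveM_fun f g v : rsmooth f -> rsmooth g ->
  pd v (fun x => f x * g x) = fun x => f x * pd v g x + g x * pd v f x.
Proof.
by move=> sf sg; apply/funext => x; rewrite !pdE; apply: deriveM; exact: rsmooth_derivable.
Qed.

End SmoothCalculus.

(** * Affine changes of variables *)

Section AffineChange.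
Variables (R : realType) (U V : normedModType R).
Variables (A L : U -> V).
Hypothesis affA : forall (h : R) u x, A (h *: u + x) = h *: L u + A x.
Implicit Types (f : V -> R).

(** By [affA] the difference quotients of [f \o A] along u and of f along [L u] are the same
    function of h, so both sides are the same limit, whether or not it exists. *)
Lemma derive_affine f u x : pd u (f \o A) x = pd (L u) f (A x).
Proof.
rewrite !pdE /derive; set F := (X in lim (X @ _)); set G := (X in _ = lim (X @ _)).
suff -> : F = G by [].
by apply/funext => h; rewrite /G /F /= affA.
Qed.

Lemma derivable_affine f u x :
  derivable f (A x) (L u) -> derivable (f \o A) x u.
Proof.
rewrite /derivable; set F := (X in cvg (X @ _)).
set G := (X in _ -> cvg (X @ _)).
suff -> : G = F by [].
by apply/funext => h; rewrite /G /F /= affA.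
Qed.

Lemma dirs_affine us f : dirs us (f \o A) = dirs (map L us) f \o A.
Proof. by elim: us => //= u us ->; apply/funext => x; exact: derive_affine. Qed.

Lemma rsmooth_affine f : continuous A -> rsmooth f -> rsmooth (f \o A).
Proof.
move=> cA sf us; rewrite dirs_affine; have [cf df] := sf (map L us); split.
  by move=> x; apply: continuous_comp; [exact: cA | exact: cf].
by move=> x u; exact: derivable_affine.
Qed.

End AffineChange.

(** * The mean value theorem and the symmetry of second derivatives *)

Section MeanValue.
Variables (R : realType) (V : normedModType R).
Implicit Types (f : V -> R) (v w x : V).

Lemma is_derive_line f v x (s : R) : rsmooth f ->
  is_derive s 1 (fun s : R => f (s *: v + x)) (pd v f (s *: v + x)).
Proof.
move=> sf; pose A (s : R) := s *: v + x; pose L (s : R) := s *: v.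
have affA (h : R) u y : A (h *: u + y) = h *: L u + A y.
  by rewrite /A /L scalerDl scalerA addrA.
have e1 : L 1 = v by rewrite /L scale1r.
apply: DeriveDef.
  by apply: (derivable_affine affA (f := f)); exact: rsmooth_derivable.
by rewrite -pdE (derive_affine affA) e1.
Qed.

Lemma mean_value f v x (h : R) : rsmooth f -> 0 <= h ->
  exists2 c, 0 <= c <= h & f (h *: v + x) - f x = pd v f (c *: v + x) * h.
Proof.
move=> sf h0.
have df (s : R) := is_derive_line v x s sf.
have [|c ch e] := @MVT_segment R _ _ 0 h h0 (fun s _ => df s).
  apply/continuous_subspaceT => s.
  exact/differentiable_continuous/derivable1_diffP.
by exists c; [move: ch; rewrite in_itv | move: e; rewrite scale0r add0r subr0].
Qed.

Lemma near_point (g : V -> R) v w x (e : R) : continuous g -> 0 < e ->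
  exists2 d : R, 0 < d & forall a b : R, 0 <= a <= d -> 0 <= b <= d ->
    `|g (a *: v + (b *: w + x)) - g x| < e.
Proof.
move=> cg e0; have /cvgrPdist_lt/(_ _ e0) := cg x.
move=> /nbhs_ballP[r /= r0 Hr].
have N0 : 0 < `|v| + `|w| + 1 by rewrite ltr_wpDl // addr_ge0.
exists (r / (2 * (`|v| + `|w| + 1))).
  by rewrite divr_gt0 // mulr_gt0.
move=> a b /andP[a0 ad] /andP[b0 bd]; rewrite distrC; apply: Hr.
rewrite -ball_normE /= opprD addrA addrC opprD addrA subrK.
rewrite -opprD normrN (le_lt_trans (ler_normD _ _)) // !normrZ !ger0_norm //.
set d := r / _ in ad bd.
have dE : d * (`|v| + `|w| + 1) = r / 2.
  by rewrite /d; field; rewrite gt_eqF.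
have Ha := ler_wpM2r (normr_ge0 v) ad; have Hb := ler_wpM2r (normr_ge0 w) bd.
have d0 : 0 < d by rewrite /d divr_gt0 // mulr_gt0.
apply: (le_lt_trans (y := d * (`|v| + `|w| + 1))).
  rewrite [leLHS]addrC !mulrDr mulr1 -addrA; apply: lerD => //.
  by apply: (le_trans Hb); rewrite lerDl ltW.
by rewrite dE gtr_pMr // invf_lt1 // ltr1n.
Qed.

Lemma eq_of_close_values (F G : V -> R) v w x : continuous F -> continuous G ->
  (forall h : R, 0 < h -> exists a b c d : R,
     [/\ 0 <= a <= h, 0 <= b <= h, 0 <= c <= h, 0 <= d <= h &
         F (a *: v + (b *: w + x)) = G (c *: w + (d *: v + x))]) ->
  F x = G x.
Proof.
move=> cF cG H; apply/eqP; rewrite -subr_eq0 -normr_eq0; apply/eqP/le_anti.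
rewrite normr_ge0 andbT; apply/ler_addgt0Pl => e e0; rewrite addr0.
have e20 : 0 < e / 2 by rewrite divr_gt0.
have [d1 d10 H1] := near_point v w x cF e20.
have [d2 d20 H2] := near_point w v x cG e20.
have [|a [b [c [d [/andP[a0 ah] /andP[b0 bh] /andP[c0 ch] /andP[d0 dh] E]]]]] :=
  H (Num.min d1 d2); first by rewrite lt_min d10.
move: ah bh ch dh; rewrite !le_min.
move=> /andP[a1 _] /andP[b1 _] /andP[_ c2] /andP[_ d2'].
have := H1 a b; have := H2 c d; rewrite a0 b0 c0 d0 a1 b1 c2 d2'.
move=> /(_ isT isT) + /(_ isT isT); rewrite E.
move: (G (_ + _)) (F x) (G x) => y p q; clear.
by move: (ler_distD y p q); rewrite (distrC p y); lra.
Qed.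

(** The mean value theorem in direction v, applied to the increment y |-> f (h w + y) - f y, and
    then in direction w. *)
Lemma mixed_difference f v w x (h : R) : rsmooth f -> 0 <= h ->
  exists c d : R, [/\ 0 <= c <= h, 0 <= d <= h &
    f (h *: v + (h *: w + x)) - f (h *: v + x) - (f (h *: w + x) - f x)
    = pd w (pd v f) (d *: w + (c *: v + x)) * h * h].
Proof.
move=> sf h0; pose A (y : V) := h *: w + y; pose L (y : V) := y.
have affA (k : R) u y : A (k *: u + y) = k *: L u + A y by rewrite /A addrCA.
have cA : continuous A by move=> y; apply: cvgD; [exact: cvg_cst | exact: cvg_id].
have sfA : rsmooth (f \o A) := rsmooth_affine affA cA sf.
have sg : rsmooth (fun y => (f \o A) y - f y) by exact: rsmoothB.
have [c ch] := mean_value v x sg h0.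
have -> : pd v (fun y => (f \o A) y - f y) (c *: v + x) =
          pd v f (A (c *: v + x)) - pd v f (c *: v + x).
  rewrite -(derive_affine affA f v).
  by rewrite !pdE; apply: deriveB; exact: rsmooth_derivable.
have [d dh e1] := mean_value w (c *: v + x) (rsmooth_derive v sf) h0.
rewrite /A {}e1 /= (addrCA (h *: w) (h *: v) x) => e2.
by exists c, d.
Qed.

(** The second difference over the parallelogram spanned by h v and h w is symmetric in v and w, and
    each mixed derivative, at some point of that parallelogram, equals it up to the factor h^2.
    Continuity concludes as h -> 0. *)
Lemma schwarz f v w : rsmooth f -> pd v (pd w f) = pd w (pd v f).
Proof.
move=> sf; apply/funext => x; apply: (@eq_of_close_values (pd v (pd w f)) (pd w (pd v f)) v w x).
- exact: (rsmooth_continuous (rsmooth_derive v (rsmooth_derive w sf))).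
- exact: (rsmooth_continuous (rsmooth_derive w (rsmooth_derive v sf))).
move=> h h0; have [c [d [ch dh E1]]] := mixed_difference w v x sf (ltW h0).
have [c' [d' [ch' dh' E2]]] := mixed_difference v w x sf (ltW h0).
exists d, c, d', c'; split; [exact: dh | exact: ch | exact: dh' | exact: ch' | ].
apply: (mulIf (lt0r_neq0 h0)); apply: (mulIf (lt0r_neq0 h0)).
apply: etrans (esym E1) (etrans _ E2); rewrite (addrCA (h *: v) (h *: w) x).
move: (f (h *: w + _)) (f (h *: v + x)) (f (h *: w + x)) (f x) => p q r s.
clear; ring.
Qed.

(** [dirs] applies the head of a word last. Moving it to the front lets an induction on words
    replace f by one of its derivatives. *)
Lemma dirs_derive vs v f : rsmooth f -> dirs vs (pd v f) = pd v (dirs vs f).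
Proof.
move=> sf; elim: vs => [//|w vs ih].
by rewrite /= ih; exact: schwarz (rsmooth_dirs vs sf).
Qed.

Lemma increment_bound f v x (h M : R) : rsmooth f -> 0 <= h ->
  (forall c, 0 <= c <= h -> `|pd v f (c *: v + x)| <= M) ->
  `|f (h *: v + x) - f x| <= h * M.
Proof.
move=> sf h0 HM; have [c ch ->] := mean_value v x sf h0.
by rewrite normrM (ger0_norm h0) mulrC ler_wpM2l ?HM.
Qed.

End MeanValue.

(** * The leapfrog scheme on a torus *)

Section ForcedLeapfrog.
Variables (R : realType) (T : finType) (A : (T -> R) -> (T -> R)).

Definition ip (f g : T -> R) : R := \sum_z f z * g z.

Hypothesis AB : forall f g z, A (fun y => f y - g y) z = A f z - A g z.
Hypothesis Aext : forall f g, f =1 g -> A f =1 A g.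
Hypothesis Asym : forall f g, ip (A f) g = ip f (A g).
Hypothesis Acontr : forall f, ip (A f) (A f) <= ip f f.

Lemma ipC f g : ip f g = ip g f.
Proof. by apply: eq_bigr => z _; rewrite mulrC. Qed.

Lemma ipDl f g h : ip (fun z => f z + g z) h = ip f h + ip g h.
Proof. by rewrite -big_split /=; apply: eq_bigr => z _; rewrite mulrDl. Qed.

Lemma ipNl f g : ip (fun z => - f z) g = - ip f g.
Proof. by rewrite -sumrN; apply: eq_bigr => z _; rewrite mulNr. Qed.

Lemma ipDr f g h : ip h (fun z => f z + g z) = ip h f + ip h g.
Proof. by rewrite ipC ipDl !(ipC h). Qed.

Lemma ipNr f g : ip f (fun z => - g z) = - ip f g.
Proof. by rewrite ipC ipNl ipC. Qed.

(* [energy X Y] is preserved by (X, Y) -> (A X - (1 - A^2) Y, X + A Y); this is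
   T_k^2 + (1 - x^2) U_(k-1)^2 = 1 for the Chebyshev polynomials of [A]. *)
Definition energy (X Y : T -> R) : R := ip X X + (ip Y Y - ip (A Y) (A Y)).

Definition rotX (X Y : T -> R) z := A X z - (Y z - A (A Y) z).
Definition rotY (X Y : T -> R) z := X z + A Y z.

Lemma A0 z : A (fun=> 0) z = 0.
Proof.
apply: etrans (_ : A (fun=> 0) z - A (fun=> 0) z = 0); last exact: subrr.
by rewrite -AB; apply: Aext => u; rewrite subrr.
Qed.

Lemma AD f g z : A (fun y => f y + g y) z = A f z + A g z.
Proof.
have AN y : A (fun u => - g u) y = - A g y.
  rewrite -[RHS]sub0r -(A0 y) -AB.
  by apply: Aext => u; rewrite sub0r.
rewrite -[A g z]opprK -AN -AB.
by apply: Aext => u; rewrite opprK.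
Qed.

(** With B = 1 - A^2 and A symmetric, the energy is <X, X> + <Y, B Y>. The cross terms 2 <X, A B Y>
    of the two rotated summands have opposite signs, and A^2 + B = 1 recombines the others. *)
Lemma energy_rot X Y : energy (rotX X Y) (rotY X Y) = energy X Y.
Proof.
rewrite /energy.
have -> : ip (A (rotY X Y)) (A (rotY X Y)) =
          ip (fun z => A X z + A (A Y) z) (fun z => A X z + A (A Y) z).
  by apply: eq_bigr => z _; rewrite /rotY AD.
rewrite /rotX /rotY !(ipDl, ipDr, ipNl, ipNr).
have e1 := Asym X Y; have e2 := Asym Y (A Y).
have e3 := ipC Y (A X); have e4 := ipC (A (A Y)) (A X).
have e5 := ipC (A (A Y)) Y; have e6 := ipC (A Y) X.
lra.
Qed.

Lemma energy_defect_ge0 Y : 0 <= ip Y Y - ip (A Y) (A Y).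
Proof. by rewrite subr_ge0. Qed.

(** The triangle inequality in squared form; e is the part of the energy that adding g to f leaves
    unchanged. The Young weights q / p and p / q are those for which (1 + q / p) p^2 + (1 + p / q)
    q^2 = (p + q)^2. *)
Lemma ip_add_le f g p q N : 0 < p -> 0 < q -> 0 <= N ->
  forall e, 0 <= e -> ip f f + e <= N * p ^+ 2 -> ip g g <= N * q ^+ 2 ->
  ip (fun z => f z + g z) (fun z => f z + g z) + e <= N * (p + q) ^+ 2.
Proof.
move=> p0 q0 N0 e e0 Hf Hg.
have young : ip (fun z => f z + g z) (fun z => f z + g z) <=
             (1 + q / p) * ip f f + (1 + p / q) * ip g g.
  rewrite /ip !mulr_sumr -big_split /=; apply: ler_sum => z _.
  rewrite -subr_ge0.
  have -> : (1 + q / p) * (f z * f z) + (1 + p / q) * (g z * g z)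
      - (f z + g z) * (f z + g z) = (q * f z - p * g z) ^+ 2 / (p * q).
    by field; rewrite !gt_eqF.
  by rewrite divr_ge0 ?sqr_ge0 // mulr_ge0 // ltW.
apply: (le_trans (y := (1 + q / p) * (ip f f + e) + (1 + p / q) * ip g g)).
  rewrite mulrDr addrAC lerD // mulrDl mul1r lerDl.
  by rewrite mulr_ge0 // divr_ge0 // ltW.
have -> : N * (p + q) ^+ 2 =
    (1 + q / p) * (N * p ^+ 2) + (1 + p / q) * (N * q ^+ 2).
  by field; rewrite !gt_eqF.
by apply: lerD; rewrite ler_wpM2l // addr_ge0 // divr_ge0 // ltW.
Qed.

(* [X] solves the forced leapfrog recurrence; [W] accumulates the forcing so
   that each step is a rotation followed by a perturbation of [X] alone. *)
Fixpoint leapfrog (f : T -> R) (r : nat -> T -> R) (k : nat) :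
    (T -> R) * (T -> R) * (T -> R) :=
  if k is k'.+1 then
    let: (X, Y, W) := leapfrog f r k' in
    (fun z => rotX X Y z + W z, rotY X Y, fun z => r k z + A W z)
  else (f, fun=> 0, fun z => r 0 z / 2).

Definition lfX f r k := (leapfrog f r k).1.1.

Lemma lfX1 f r z : lfX f r 1 z = A f z + r 0 z / 2.
Proof.
rewrite /lfX /= /rotX sub0r (_ : A (A (fun=> 0)) z = 0) ?subr0 ?oppr0 ?addr0//.
by rewrite -[RHS](A0 z); apply: Aext => u; rewrite A0.
Qed.

(** One [A (lfX f r k.+1)] comes from the rotation; the second one is assembled from A^2 X - (1 -
    A^2) A Y and from A W, which is why W is propagated by A. *)
Lemma lfXSS f r k z :
  lfX f r k.+2 z = 2 * A (lfX f r k.+1) z - lfX f r k z + r k.+1 z.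
Proof.
rewrite /lfX /=; case: (leapfrog f r k) => [[X Y] W] /=.
rewrite {1}/rotX.
have -> : A (A (rotY X Y)) z = A (A X) z + A (A (A Y)) z.
  by rewrite -AD; apply: Aext => u; rewrite -AD.
have e u : A (fun z => rotX X Y z + W z) u = A (A X) u - (A Y u - A (A (A Y)) u) + A W u.
  by rewrite AD /rotX AB AB.
rewrite e /rotY; ring.
Qed.

(** In root mean square W never exceeds K d, being a sum of at most K forcing terms transported by a
    contraction. Each step preserves the energy and then adds W to X, so the square root of the
    energy, normalised by N, grows by at most K d per step. *)
Lemma leapfrog_bound f r (b d N : R) (K : nat) : 0 < b -> 0 < d -> 0 <= N ->
  ip f f <= N * b ^+ 2 ->
  (forall k, (k < K)%N -> ip (r k) (r k) <= N * d ^+ 2) ->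
  forall k, (k <= K)%N -> ip (lfX f r k) (lfX f r k) <= N * (b + k%:R * (K%:R * d)) ^+ 2.
Proof.
move=> b0 d0 N0 Hf Hr.
have K0 k : (k < K)%N -> 0 < K%:R :> R by move=> h; rewrite ltr0n; case: K h {Hr}.
have HS k : (k < K)%N ->
    let W := (leapfrog f r k).2 in ip W W <= N * (k.+1%:R * d) ^+ 2.
  elim: k => [|k ih] kK /=.
    have -> : ip (fun z => r 0 z / 2) (fun z => r 0 z / 2) = ip (r 0) (r 0) / 4.
      by rewrite /ip mulr_suml; apply: eq_bigr => z _; field.
    rewrite mul1r ler_pdivrMr //; apply: (le_trans (Hr 0 kK)).
    have : 0 <= N * d ^+ 2 by rewrite mulr_ge0 ?sqr_ge0.
    by lra.
  have := ih (ltnW kK); case: (leapfrog f r k) => [[X Y] W] /= HS.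
  have := @ip_add_le (r k.+1) (A W) d (k.+1%:R * d) N d0 _ N0 0 (lexx 0).
  rewrite !addr0 -[X in X + k.+1%:R * d]mul1r -mulrDl -(natrD _ 1 k.+1) add1n.
  apply; [by rewrite mulr_gt0 | exact: Hr | exact: le_trans (Acontr _) HS].
suff H k : (k <= K)%N -> let: (X, Y, W) := leapfrog f r k in
    energy X Y <= N * (b + k%:R * (K%:R * d)) ^+ 2.
  move=> k /H; rewrite /lfX; case: (leapfrog f r k) => [[X Y] W] /=.
  by apply: le_trans; rewrite /energy lerDl energy_defect_ge0.
elim: k => [|k ih] kK /=.
  rewrite /energy mul0r addr0.
  have -> : ip (A (fun=> 0)) (A (fun=> 0)) = 0.
    by rewrite /ip big1 // => z _; rewrite A0 mul0r.
  have -> : ip (fun=> 0) (fun=> 0) = 0 by rewrite /ip big1 // => z _; rewrite mul0r.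
  by rewrite subr0 addr0.
have := ih (ltnW kK); have := HS k kK.
case: (leapfrog f r k) => [[X Y] W] /= hS hE.
have kd : 0 <= k%:R * (K%:R * d) by rewrite !mulr_ge0 // ltW.
have Kd : 0 < K%:R * d by rewrite mulr_gt0 // (K0 k).
rewrite -natr1 mulrDl mul1r addrA /energy.
apply: ip_add_le => //; first by rewrite ltr_wpDr.
- exact: energy_defect_ge0.
- by have := energy_rot X Y; rewrite /energy => ->.
apply: le_trans hS _; apply: ler_wpM2l => //; apply: lerXn2r.
- by rewrite nnegrE ltW // mulr_gt0.
- by rewrite nnegrE ltW.
- by rewrite ler_pM2r // ler_nat.
Qed.

(** Cauchy-Schwarz, through |a| <= a^2 / (2 B) + B / 2 at each point. *)
Lemma l1_bound f (B N : R) : 0 < B -> ip f f <= N * B ^+ 2 -> #|T|%:R = N ->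
  \sum_z `|f z| <= N * B.
Proof.
move=> B0 Hf eN.
apply: (le_trans (y := \sum_z (f z * f z / (2 * B) + B / 2))).
  apply: ler_sum => z _; rewrite -subr_ge0.
  have -> : f z * f z / (2 * B) + B / 2 - `|f z| = (`|f z| - B) ^+ 2 / (2 * B).
    have -> : f z * f z = `|f z| ^+ 2 by rewrite real_normK ?num_real // expr2.
    by field; rewrite gt_eqF.
  by rewrite divr_ge0 ?sqr_ge0 // mulr_ge0 // ltW.
rewrite big_split /= sumr_const -mulr_suml -[(B / 2) *+ _]mulr_natl eN -/(ip f f).
have -> : N * B = N * B ^+ 2 / (2 * B) + N * (B / 2) by field; rewrite gt_eqF.
by rewrite lerD2r ler_pM2r // invr_gt0 mulr_gt0.
Qed.

End ForcedLeapfrog.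

(** * The neighbour average on a torus, and its comparison with the lattice in space *)

Section TorusLattice.
Variables (R : realType) (n M : nat).
Hypothesis n_gt0 : (0 < n)%N.

Local Notation torus := 'rV['I_M.+1]_n.

Definition tstep (j : 'I_n) : torus := \row_i (if i == j then inZp 1 else 0).

Definition torus_avg (g : torus -> R) (z : torus) : R :=
  (2 * n%:R)^-1 * \sum_j (g (z + tstep j) + g (z - tstep j)).

Lemma torus_avgB f g z :
  torus_avg (fun y => f y - g y) z = torus_avg f z - torus_avg g z.
Proof.
rewrite /torus_avg -mulrBr -sumrB; congr (_ * _).
by apply: eq_bigr => j _; rewrite opprD addrACA.
Qed.

Lemma torus_avg_ext f g : f =1 g -> torus_avg f =1 torus_avg g.
Proof.
by move=> e z; rewrite /torus_avg; congr (_ * _); apply: eq_bigr => j _; rewrite !e.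
Qed.

Lemma ip_shift (f g : torus -> R) (w : torus) :
  ip (fun z => f (z + w)) g = ip f (fun z => g (z - w)).
Proof.
rewrite /ip (reindex_inj (addIr (- w))) /=.
by apply: eq_bigr => z _; rewrite subrK.
Qed.

Lemma ipZl (T : finType) (a : R) (f g : T -> R) :
  ip (fun z => a * f z) g = a * ip f g.
Proof. by rewrite /ip mulr_sumr; apply: eq_bigr => z _; rewrite mulrA. Qed.

Lemma ip_suml (T : finType) (I : finType) (f : I -> T -> R) (g : T -> R) :
  ip (fun z => \sum_j f j z) g = \sum_j ip (f j) g.
Proof. by rewrite /ip exchange_big; apply: eq_bigr => z _; rewrite mulr_suml. Qed.

Lemma ip_torus_avg (f g : torus -> R) : ip (torus_avg f) g = (2 * n%:R)^-1 *
  \sum_j (ip (fun z => f (z + tstep j)) g + ip (fun z => f (z - tstep j)) g).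
Proof.
by rewrite /torus_avg ipZl ip_suml; under eq_bigr do rewrite ipDl.
Qed.

Lemma torus_avg_sym (f g : torus -> R) : ip (torus_avg f) g = ip f (torus_avg g).
Proof.
rewrite [RHS]ipC !ip_torus_avg; congr (_ * _); apply: eq_bigr => j _.
by rewrite addrC; congr (_ + _); rewrite ip_shift ipC // opprK.
Qed.

Lemma ip_le_half (T : finType) (f g : T -> R) :
  ip f g <= (ip f f + ip g g) / 2.
Proof.
rewrite /ip -big_split mulr_suml; apply: ler_sum => z _ /=.
by rewrite ler_pdivlMr //; have := sqr_ge0 (f z - g z); rewrite sqrrB; lra.
Qed.

(** Translations preserve the norm, so <A f, g> <= (<f, f> + <g, g>) / 2 for every g; then take g =
    A f. *)
Lemma torus_avg_contr (f : torus -> R) :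
  ip (torus_avg f) (torus_avg f) <= ip f f.
Proof.
have shift_norm w : ip (fun z => f (z + w)) (fun z => f (z + w)) = ip f f.
  by rewrite ip_shift; apply: eq_bigr => z _; rewrite subrK.
suff H g : ip (torus_avg f) g <= (ip f f + ip g g) / 2.
  by have := H (torus_avg f); lra.
rewrite ip_torus_avg; set b := (_ / 2).
have n0 : n%:R != 0 :> R by rewrite pnatr_eq0 -lt0n.
have -> : b = (2 * n%:R)^-1 * \sum_(j < n) (b + b).
  by rewrite sumr_const card_ord -mulr_natr; field.
rewrite ler_wpM2l ?invr_ge0 ?mulr_ge0 //; apply: ler_sum => j _.
by apply: lerD; apply: le_trans (ip_le_half _ _) _; rewrite shift_norm.
Qed.

Lemma torus_addE (z : torus) (j i : 'I_n) : (forall k, z ord0 k < M)%N ->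
  ((z + tstep j)%R ord0 i = z ord0 i + (i == j) :> nat)%N.
Proof.
move=> zM; rewrite !mxE /=. case: eqP => _ /=; rewrite ?addn0.
  by rewrite modnDmr modn_small // addn1 ltnS.
by rewrite modn_small // ltn_ord.
Qed.

Lemma torus_subE (z : torus) (j i : 'I_n) : (forall k, 0 < z ord0 k)%N ->
  ((z - tstep j)%R ord0 i + (i == j) = z ord0 i :> nat)%N.
Proof.
move=> z0; rewrite !mxE /=; case: eqP => _ /=; rewrite ?addn0 ?subr0 //.
  have M0 : (0 < M)%N.
    by rewrite -ltnS; apply: leq_trans (ltn_ord (z ord0 i)); rewrite ltnS.
  rewrite !modnDmr (modn_small (m := 1)) ?ltnS // subSS subn0.
  have := z0 i; case: (z ord0 i) => [[|m] /= mM] // _.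
  by rewrite addSnnS modnDr modn_small ?addn1 // ltnW.
by rewrite subn0 modnn addn0 modn_small // ltn_ord.
Qed.

Variables (h : R) (c : nat).
Implicit Types (z : torus) (i j : 'I_n).

Definition lattice_pos (z : torus) : 'rV[R]_n :=
  \row_i (h * ((z ord0 i)%:R - c%:R)).

Definition lattice_avg (g : 'rV[R]_n -> R) (x : 'rV[R]_n) : R :=
  (2 * n%:R)^-1 *
  \sum_j (g (h *: basis_vec R j + x) + g ((- h) *: basis_vec R j + x)).

(** Distance at least k from the seam of the torus: k steps of the scheme at such a point meet no
    wrap-around. *)
Definition inner (k : nat) (z : torus) : bool :=
  [forall i, (k <= z ord0 i)%N && (z ord0 i + k <= M)%N].

Lemma innerP k z :
  reflect (forall i, (k <= z ord0 i)%N /\ (z ord0 i + k <= M)%N) (inner k z).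
Proof.
apply: (iffP forallP) => H i; first by move/andP: (H i).
by apply/andP; exact: H.
Qed.

Lemma inner_add k z j : inner k.+1 z -> inner k (z + tstep j).
Proof.
move=> /innerP H; apply/innerP => i.
rewrite torus_addE; last by move=> l; have [] := H l; lia.
by have := H i; case: (i == j); lia.
Qed.

Lemma inner_sub k z j : inner k.+1 z -> inner k (z - tstep j).
Proof.
move=> /innerP H; apply/innerP => i.
have := @torus_subE z j i; have := H i.
case: (i == j) => /= Hi /(_ _)-/(_ (fun l => leq_trans (ltn0Sn k) (H l).1)); lia.
Qed.

Lemma lattice_pos_add k z j : inner k.+1 z ->
  lattice_pos (z + tstep j) = h *: basis_vec R j + lattice_pos z.
Proof.
move=> /innerP H; apply/rowP => i; rewrite mxE torus_addE.
  by rewrite !mxE natrD eqxx /= eq_sym; case: (j == i) => /=; ring.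
by move=> l; have [] := H l; lia.
Qed.

Lemma lattice_pos_sub k z j : inner k.+1 z ->
  lattice_pos (z - tstep j) = (- h) *: basis_vec R j + lattice_pos z.
Proof.
move=> /innerP H; apply/rowP => i.
have := @torus_subE z j i (fun l => leq_trans (ltn0Sn k) (H l).1).
move: (z - tstep j) => y yz; rewrite !mxE -yz natrD eqxx /= eq_sym.
by case: (i == j) => /=; ring.
Qed.

Lemma torus_avg_local k (F : torus -> R) (g : 'rV[R]_n -> R) z : inner k.+1 z ->
  (forall y, inner k y -> F y = g (lattice_pos y)) ->
  torus_avg F z = lattice_avg g (lattice_pos z).
Proof.
move=> Iz HF; rewrite /torus_avg /lattice_avg; congr (_ * _).
apply: eq_bigr => j _; rewrite !HF ?(inner_add, inner_sub) //.
by rewrite (lattice_pos_add _ Iz) (lattice_pos_sub _ Iz).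
Qed.

Lemma inner_leq k l z : (k <= l)%N -> inner l z -> inner k z.
Proof. by move=> kl /innerP H; apply/innerP => i; have [] := H i; lia. Qed.

(** Finite speed of propagation: the value after k steps reads the torus only within distance k,
    where it coincides with the lattice in space. The recurrence has order two, so the induction
    carries two consecutive levels. *)
Lemma leapfrog_local (v r : nat -> 'rV[R]_n -> R) :
  (forall x, v 1 x = lattice_avg (v 0) x + r 0 x / 2) ->
  (forall l x, v l.+2 x = 2 * lattice_avg (v l.+1) x - v l x + r l.+1 x) ->
  forall k z, inner k z ->
    lfX torus_avg (v 0 \o lattice_pos) (fun l => r l \o lattice_pos) k z
    = v k (lattice_pos z).
Proof.
move=> v1 vSS; set X := lfX _ _ _.
suff H k : (forall z, inner k z -> X k z = v k (lattice_pos z)) /\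
           (forall z, inner k.+1 z -> X k.+1 z = v k.+1 (lattice_pos z)).
  by move=> k; have [] := H k.
elim: k => [|k [ih1 ih2]]; split=> // z Iz.
  rewrite /X (lfX1 torus_avgB torus_avg_ext).
  by rewrite (torus_avg_local (g := v 0) Iz) // v1.
rewrite /X (lfXSS torus_avgB torus_avg_ext).
rewrite vSS -/X (torus_avg_local (g := v k.+1) Iz) // ih1 //.
by apply: inner_leq Iz; lia.
Qed.

Lemma lattice_estimate (v r : nat -> 'rV[R]_n -> R) (K : nat) (b d : R) :
  0 < b -> 0 < d ->
  (forall x, v 1 x = lattice_avg (v 0) x + r 0 x / 2) ->
  (forall l x, v l.+2 x = 2 * lattice_avg (v l.+1) x - v l x + r l.+1 x) ->
  (forall z, `|v 0 (lattice_pos z)| <= b) ->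
  (forall (l : nat) z, (l < K)%N -> `|r l (lattice_pos z)| <= d) ->
  \sum_(z | inner K z) `|v K (lattice_pos z)| <=
    (M.+1 ^ n)%:R * (b + K%:R * (K%:R * d)).
Proof.
move=> b0 d0 v1 vSS Hb Hd.
have ip_bound (f : torus -> R) e : 0 < e -> (forall z, `|f z| <= e) ->
    ip f f <= (M.+1 ^ n)%:R * e ^+ 2.
  move=> e0 Hf; rewrite /ip.
  have -> : (M.+1 ^ n)%:R * e ^+ 2 = \sum_(z : torus) e ^+ 2.
    rewrite sumr_const card_mx card_ord mul1n.
    by rewrite mulr_natl.
  apply: ler_sum => z _.
  rewrite -expr2 -(real_normK (num_real (f z))).
  by apply: lerXn2r; rewrite ?nnegrE // ltW.
set X := lfX torus_avg (v 0 \o lattice_pos) (fun l => r l \o lattice_pos).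
apply: (le_trans (y := \sum_z `|X K z|)).
  rewrite [leRHS](bigID (inner K)) /= ler_wpDr ?sumr_ge0 //.
  by apply: ler_sum => z Iz; rewrite /X leapfrog_local.
apply: l1_bound.
- by rewrite ltr_wpDr // !mulr_ge0 // ltW.
- apply: (leapfrog_bound torus_avgB torus_avg_ext torus_avg_sym torus_avg_contr) => //.
  + by apply: ip_bound => // z; exact: Hb.
  + by move=> k kK; apply: ip_bound => // z; exact: Hd.
- by rewrite card_mx card_ord mul1n.
Qed.

End TorusLattice.

(** * A discrete Sobolev inequality *)

Section DiscreteSobolev.
Variables (R : realType) (n M c m : nat) (h : R).
Hypothesis m_gt0 : (0 < m)%N.
Hypothesis cmM : (c + m <= M.+1)%N.

Local Notation torus := 'rV['I_M.+1]_n.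
Local Notation pos := (@lattice_pos R n M h c).
Implicit Types (z y : torus) (F : 'rV[R]_n -> R).

(** The one-dimensional Sobolev inequality: |g 0| is at most |g i| plus the total variation, and
    this is summed over the m values of i. *)
Lemma sum_increments_bound (g : nat -> R) :
  m%:R * `|g 0| <= \sum_(0 <= i < m) (`|g i| + m%:R * `|g i.+1 - g i|).
Proof.
set S := \sum_(0 <= l < m) `|g l.+1 - g l|.
have tele i : (i <= m)%N -> `|g 0| <= `|g i| + S.
  move=> im; have -> : g 0 = g i - \sum_(0 <= l < i) (g l.+1 - g l).
    by rewrite telescope_sumr // subKr.
  apply: (le_trans (ler_normB _ _)); rewrite lerD2l.
  apply: (le_trans (ler_norm_sum _ _ _)).
  by rewrite /S (big_cat_nat (n := i) (p := m)) //= lerDl sumr_ge0.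
rewrite big_split /= -mulr_sumr -/S.
have -> : m%:R * `|g 0| = \sum_(0 <= i < m) `|g 0|.
  by rewrite sumr_const_nat subn0 mulr_natl.
have -> : m%:R * S = \sum_(0 <= i < m) S.
  by rewrite sumr_const_nat subn0 mulr_natl.
rewrite -big_split /= !big_mkord; apply: ler_sum => i _.
by apply: tele; apply: ltnW.
Qed.

Definition setc z (j : 'I_n) (i : 'I_M.+1) : torus :=
  \row_l (if l == j then i else z ord0 l).

(** Interpolates between the single point with all coordinates c, for j = 0, and a cube of m^n
    points, for j = n. *)
Definition box (j : nat) z : bool :=
  [forall l : 'I_n, if (l < j)%N then (c <= z ord0 l)%N && (z ord0 l < c + m)%N
                    else z ord0 l == c :> nat].

Lemma boxP j z : reflect
  (forall l : 'I_n, if (l < j)%N then (c <= z ord0 l)%N && (z ord0 l < c + m)%N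
                    else z ord0 l == c :> nat) (box j z).
Proof. exact: forallP. Qed.

(** With the factor m this is m h times a difference quotient; in the application m h is a fixed
    length, so these differences stay bounded as h -> 0. *)
Definition diffq (j : 'I_n) F : 'rV[R]_n -> R :=
  fun x => m%:R * (F (h *: basis_vec R j + x) - F x).

Lemma lattice_pos_setc (j : 'I_n) z (i : 'I_M.+1) : z ord0 j = c :> nat -> (c <= i)%N ->
  pos (setc z j i) = ((i - c)%:R * h) *: basis_vec R j + pos z.
Proof.
move=> zj ci; apply/rowP => l; rewrite !mxE eqxx /=.
case: eqP => [->|_] /=; last by rewrite mulr0 add0r.
by rewrite zj natrB //; ring.
Qed.

Lemma c_lt : (c < M.+1)%N.
Proof. by apply: leq_trans cmM; rewrite -addn1 leq_add2l. Qed.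

Lemma sum_box_succ (j : 'I_n) (phi : torus -> R) :
  \sum_(z | box j.+1 z) phi z =
  \sum_(z | box j z) \sum_(i < M.+1 | (c <= i)%N && (i < c + m)%N) phi (setc z j i).
Proof.
rewrite (partition_big (fun y => setc y j (Ordinal c_lt)) (box j)) /=; last first.
  move=> y /boxP By; apply/boxP => l; have := By l; rewrite mxE.
  case: (l =P j) => [->|lj]; first by rewrite ltnn /=.
  rewrite (ltnS l j) (leq_eqVlt l j); case: eqP => [e|_ //].
  by case: lj; apply/val_inj.
apply: eq_bigr => z /boxP Bz.
rewrite (reindex_onto (fun i => setc z j i) (fun y => y ord0 j)); last first.
  move=> y /andP[By /eqP <-]; apply/rowP => l; rewrite !mxE.
  by case: eqP => // ->.
apply: eq_bigl => i; rewrite mxE eqxx eqxx andbT.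
have e : setc (setc z j i) j (Ordinal c_lt) == z.
  apply/eqP/rowP => l; rewrite !mxE; case: eqP => // ->.
  by apply/val_inj => /=; have := Bz j; rewrite ltnn => /eqP.
rewrite e andbT; apply/boxP/idP => [/(_ j)|ci l].
  by rewrite ltnSn mxE eqxx.
rewrite mxE; case: (l =P j) => [->|lj]; first by rewrite ltnSn.
have := Bz l; rewrite (ltnS l j) (leq_eqVlt l j); case: (val l =P val j) => [|_ //].
by move=> e'; case: lj; apply/val_inj.
Qed.

Lemma sobolev_step (j : 'I_n) F :
  m%:R * \sum_(z | box j z) `|F (pos z)| <=
  \sum_(z | box j.+1 z) `|F (pos z)| + \sum_(z | box j.+1 z) `|diffq j F (pos z)|.
Proof.
rewrite -big_split sum_box_succ mulr_sumr; apply: ler_sum => z /boxP Bz /=.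
have zj : z ord0 j = c :> nat by have := Bz j; rewrite ltnn => /eqP.
pose g (i : nat) := F ((i%:R * h) *: basis_vec R j + pos z).
have := sum_increments_bound g; rewrite {1}/g mul0r scale0r add0r.
move=> /le_trans; apply.
pose G i := `|g i| + m%:R * `|g i.+1 - g i|.
have -> : \sum_(i < M.+1 | (c <= i)%N && (i < c + m)%N)
    (`|F (pos (setc z j i))| + `|diffq j F (pos (setc z j i))|) =
    \sum_(i < M.+1 | (c <= i)%N && (i < c + m)%N)
    G (i - c)%N.
  apply: eq_bigr => i /andP[ci _]; rewrite lattice_pos_setc //; congr (_ + _).
  rewrite /diffq normrM ger0_norm // /g addrA -scalerDl -natr1.
  by congr (_ * `|F (_ *: _ + _) - _|); ring.
rewrite -(big_ord_widen_cond M.+1 (fun i => (c <= i)%N) (fun i => G (i - c)%N)) //.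
rewrite -(big_geq_mkord c (c + m) xpredT (fun i => G (i - c)%N)).
rewrite -{1}[c]add0n big_addn addKn.
by under [leRHS]eq_bigr do rewrite addnK.
Qed.

(** Each use of [sobolev_step] frees one pinned coordinate at the price of one difference in that
    direction and doubles the number of terms, whence 2^n. [Phi j] stands for the functions that can
    occur once j coordinates are free. *)
Lemma discrete_sobolev (Phi : nat -> ('rV[R]_n -> R) -> Prop) (B : R) :
  (forall (j : 'I_n) F, Phi j F -> Phi j.+1 F /\ Phi j.+1 (diffq j F)) ->
  (forall F, Phi n F -> \sum_(z | box n z) `|F (pos z)| <= m%:R ^+ n * B) ->
  forall F, Phi 0%N F -> `|F 0| <= 2 ^+ n * B.
Proof.
move=> Hstep Hn F F0.
have m0 : 0 < m%:R :> R by rewrite ltr0n.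
have H k : (k <= n)%N -> forall F, Phi (n - k)%N F ->
    \sum_(z | box (n - k) z) `|F (pos z)| <= 2 ^+ k * (m%:R ^+ (n - k) * B).
  elim: k => [|k ih] kn G; first by rewrite subn0 expr0 mul1r; exact: Hn.
  have jn : (n - k.+1 < n)%N by rewrite ltn_subrL (leq_ltn_trans _ kn).
  have e : (n - k = (n - k.+1).+1)%N by rewrite subnSK.
  move=> /(Hstep (Ordinal jn)) /= [G1 G2].
  have := sobolev_step (Ordinal jn) G; rewrite /= -e.
  move: ih; rewrite e => ih.
  have := ih (ltnW kn) _ G1; have := ih (ltnW kn) _ G2 => b1 b2 b3.
  rewrite -(ler_pM2l m0); apply: (le_trans b3); apply: (le_trans (lerD b2 b1)).
  by rewrite le_eqVlt; apply/orP; left; apply/eqP; rewrite !exprS; ring.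
have := H n (leqnn n) F; rewrite subnn expr0 mul1r => /(_ F0).
pose z0 : torus := const_mx (Ordinal c_lt).
rewrite (big_pred1 z0) => [|z].
  have -> // : pos z0 = 0.
  by apply/rowP => l; rewrite !mxE subrr mulr0.
apply/boxP/eqP => [H0|-> l]; last by rewrite mxE /= eqxx.
by apply/rowP => l; apply/val_inj; rewrite /z0 mxE /=; exact: (eqP (H0 l)).
Qed.

End DiscreteSobolev.

(** * Taylor remainders and bounds on compact sets *)

Section Taylor.
Variables (R : realType) (V : normedModType R).
Implicit Types (f : V -> R) (p v w : V).

Lemma deriveNdir f v p : rsmooth f -> pd (- v) f p = - pd v f p.
Proof.
move=> sf.
have d1 := is_derive_line (- v) p 0 sf; rewrite scale0r add0r in d1.
have d2 : is_derive (- (0 : R)) 1 (fun s : R => f (s *: v + p)) (pd v f p).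
  by have := is_derive_line v p (- 0) sf; rewrite oppr0 scale0r add0r.
have d3 := is_derive1_comp d2 (is_deriveNid (0 : R) 1).
have e : (fun s : R => f (s *: v + p)) \o -%R = fun s : R => f (s *: (- v) + p).
  by apply/funext => s /=; rewrite scaleNr scalerN.
move: d3; rewrite e => d3.
by rewrite -(@derive_val _ _ _ _ _ _ _ d1) (@derive_val _ _ _ _ _ _ _ d3) mulrN1.
Qed.

Lemma deriveNdir_fun f v : rsmooth f -> pd (- v) f = fun p => -1 * pd v f p.
Proof. by move=> sf; apply/funext => p; rewrite deriveNdir // mulN1r. Qed.

Lemma deriveNdir2 f v : rsmooth f -> pd (- v) (pd (- v) f) = pd v (pd v f).
Proof.
move=> sf; apply/funext => p.
rewrite deriveNdir; last exact: rsmooth_derive.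
rewrite deriveNdir_fun //.
have -> : pd v (fun p => -1 * pd v f p) p = -1 * pd v (pd v f) p.
  by rewrite !pdE; apply: (deriveZ (-1)); apply: rsmooth_derivable; exact: rsmooth_derive.
by rewrite mulN1r opprK.
Qed.

Lemma mean_value_sub f w p (q dq : R -> R) (h : R) : rsmooth f -> 0 <= h ->
  (forall s : R, is_derive s 1 q (dq s)) ->
  exists2 c, 0 <= c <= h &
    f (h *: w + p) - q h - (f p - q 0) = (pd w f (c *: w + p) - dq c) * h.
Proof.
move=> sf h0 Hq.
have df (s : R) : is_derive s 1 (fun s : R => f (s *: w + p) - q s)
    (pd w f (s *: w + p) - dq s).
  exact: (is_deriveB (is_derive_line w p s sf) (Hq s)).
have [|c ch e] := @MVT_segment R _ _ 0 h h0 (fun s _ => df s).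
  apply/continuous_subspaceT => s.
  apply/differentiable_continuous/derivable1_diffP.
  exact: (@ex_derive _ _ _ _ _ _ _ (df s)).
by exists c; [move: ch; rewrite in_itv | move: e; rewrite scale0r add0r subr0].
Qed.

(** The mean value theorem is applied in turn to the second derivative, to the first derivative
    minus its linear part, and to f minus its quadratic part. Each use gains one power of h; the
    constant is 1 instead of 1/6. *)
Lemma taylor2 f w p (h B : R) : rsmooth f -> 0 <= h ->
  (forall c, 0 <= c <= h -> `|pd w (pd w (pd w f)) (c *: w + p)| <= B) ->
  `|f (h *: w + p) - f p - h * pd w f p - h ^+ 2 / 2 * pd w (pd w f) p|
    <= h ^+ 3 * B.
Proof.
move=> sf h0 HB.
set a1 := pd w f p; set a2 := pd w (pd w f) p.
have B0 : 0 <= B by apply: le_trans (HB 0 _); rewrite ?lexx.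
have step2 s : 0 <= s <= h -> `|pd w (pd w f) (s *: w + p) - a2| <= s * B.
  move=> /andP[s0 sh].
  have sf2 := rsmooth_derive w (rsmooth_derive w sf).
  have H := @increment_bound _ _ (pd w (pd w f)) w p s B sf2 s0.
  by apply: H => c /andP[c0 cs]; apply: HB; rewrite c0 (le_trans cs).
have step1 s : 0 <= s <= h -> `|pd w f (s *: w + p) - a1 - s * a2| <= s ^+ 2 * B.
  move=> /andP[s0 sh].
  have dq (x : R) : is_derive x 1 (fun x : R => x * a2) a2.
    have H := is_deriveM (is_derive_id x 1) (is_derive_cst a2 x 1).
    by apply: (is_derive_eq H); rewrite scaler0 add0r [_ *: _]mulr1.
  have [c /andP[c0 cs]] := mean_value_sub w p (rsmooth_derive w sf) s0 dq.
  rewrite mul0r subr0 addrAC => ->; rewrite normrM (ger0_norm s0).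
  have := step2 c; rewrite c0 (le_trans cs sh) => /(_ isT) H.
  rewrite expr2 -mulrA [leRHS]mulrC ler_wpM2r //.
  by apply: (le_trans H); rewrite ler_wpM2r.
have dq (x : R) : is_derive x 1 (fun x : R => x * a1 + x ^+ 2 / 2 * a2) (a1 + x * a2).
  have i1 := is_deriveM (is_derive_id x 1) (is_derive_cst a1 x 1).
  have i2 := is_deriveM (is_deriveX 2 (is_derive_id x 1)) (is_derive_cst (2^-1 * a2) x 1).
  have H := is_deriveD i1 i2.
  rewrite (_ : (fun _ => _) = id * cst a1 + id ^+ 2 * cst (2^-1 * a2)); last first.
    by apply/funext => y; rewrite -mulrA.
  by apply: (is_derive_eq H); rewrite !scaler0 !add0r /= expr1 /GRing.scale /=; field.
have [c /andP[c0 ch]] := mean_value_sub w p sf h0 dq.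
rewrite mul0r expr0n /= mul0r mul0r addr0 subr0 => e.
have -> : f (h *: w + p) - f p - h * a1 - h ^+ 2 / 2 * a2 =
          f (h *: w + p) - (h * a1 + h ^+ 2 / 2 * a2) - f p by ring.
rewrite {}e normrM (ger0_norm h0) opprD addrA.
have := step1 c; rewrite c0 ch => /(_ isT) H.
rewrite [h ^+ 3]exprS -mulrA [leRHS]mulrC ler_wpM2r //; apply: (le_trans H).
by rewrite ler_wpM2r // lerXn2r.
Qed.

(** The odd terms of the expansions along w and -w cancel. The order h^3, weaker than the optimal
    h^4, suffices because the remainders are later multiplied by k^2 with h of order 1 / k. *)
Lemma second_difference_bound f w p (h B : R) : rsmooth f -> 0 <= h ->
  (forall c, - h <= c <= h -> `|pd w (pd w (pd w f)) (c *: w + p)| <= B) ->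
  `|f (h *: w + p) + f ((- h) *: w + p) - 2 * f p - h ^+ 2 * pd w (pd w f) p|
    <= 2 * (h ^+ 3 * B).
Proof.
move=> sf h0 HB.
have sf2 := rsmooth_derive w (rsmooth_derive w sf).
have H1 : `|f (h *: w + p) - f p - h * pd w f p - h ^+ 2 / 2 * pd w (pd w f) p|
    <= h ^+ 3 * B.
  apply: (taylor2 sf h0) => c /andP[c0 ch]; apply: HB.
  by rewrite ch (le_trans _ c0) // oppr_le0.
have H2 : `|f ((- h) *: w + p) - f p - h * - pd w f p - h ^+ 2 / 2 * pd w (pd w f) p|
    <= h ^+ 3 * B.
  have := @taylor2 f (- w) p h B sf h0.
  rewrite (deriveNdir2 w sf) (deriveNdir w p sf) scalerN -scaleNr; apply.
  move=> c /andP[c0 ch].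
  rewrite (deriveNdir w (c *: - w + p) sf2) normrN scalerN -scaleNr; apply: HB.
  by rewrite lerN2 ch (le_trans _ h0) // oppr_le0.
move: (f (h *: w + p)) (f (- h *: w + p)) (f p) (pd w f p) (pd w (pd w f) p) H1 H2.
clear => x y z a b H1 H2.
have -> : x + y - 2 * z - h ^+ 2 * b =
  (x - z - h * a - h ^+ 2 / 2 * b) + (y - z - h * - a - h ^+ 2 / 2 * b) by field.
by apply: (le_trans (ler_normD _ _)); lra.
Qed.

Lemma compact_bound f (K : set V) : continuous f -> compact K ->
  exists2 B, 0 <= B & forall x, K x -> `|f x| <= B.
Proof.
move=> cf cK.
have /compact_bounded[B [_ HB]] : compact (f @` K).
  by apply: continuous_compact => //; exact: continuous_subspaceT.
exists (`|B| + 1); first by rewrite addr_ge0.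
move=> x Kx; apply: (HB (`|B| + 1)); last by exists x.
by rewrite (le_lt_trans (ler_norm B)) // ltrDl.
Qed.

Lemma words_bounded (I : finType) (e : I -> V) (K : set V) (N : nat) f :
  compact K -> rsmooth f -> exists2 B, 0 <= B &
    forall s : seq I, (size s <= N)%N -> forall x, K x ->
      `|dirs (map e s) f x| <= B.
Proof.
move=> cK; elim: N f => [|N ih] f sf.
  have [B B0 HB] := compact_bound (rsmooth_continuous sf) cK.
  by exists B => // -[|//] _ x Kx; exact: HB.
have [B0 B00 HB0] := compact_bound (rsmooth_continuous sf) cK.
have /fin_all_exists[B HB] : forall i, exists B, 0 <= B /\
    forall s : seq I, (size s <= N)%N -> forall x, K x ->
      `|dirs (map e s) (pd (e i) f) x| <= B.
  by move=> i; have [B B1 B2] := ih _ (rsmooth_derive (e i) sf); exists B.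
exists (B0 + \sum_i B i).
  by rewrite addr_ge0 // sumr_ge0 // => i _; have [] := HB i.
move=> [|i s] ss x Kx.
  rewrite (le_trans (HB0 x Kx)) // lerDl sumr_ge0 // => i _.
  by have [] := HB i.
rewrite /= -(dirs_derive _ _ sf); have [_ H] := HB i.
rewrite (le_trans (H s ss x Kx)) // (bigD1 i) //= addrCA lerDl addr_ge0 //.
by rewrite sumr_ge0 // => j _; have [] := HB j.
Qed.

End Taylor.

Section Translations.
Variables (R : realType) (V : normedModType R).
Implicit Types (f : V -> R) (u w p : V).

Lemma translate_affine w (h : R) u p : w + (h *: u + p) = h *: id u + (w + p).
Proof. by rewrite addrCA. Qed.

Lemma rsmooth_translate f w : rsmooth f -> rsmooth (fun p => f (w + p)).
Proof.
move=> sf; apply: (rsmooth_affine (translate_affine w)) => // p.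
by apply: cvgD; [exact: cvg_cst | exact: cvg_id].
Qed.

Lemma pd_translate f w u : pd u (fun p => f (w + p)) = fun p => pd u f (w + p).
Proof. by apply/funext => p; exact: (derive_affine (translate_affine w)). Qed.

End Translations.

(** * The a priori estimate *)

Section EvenWaves.
Variables (R : realType) (n : nat).
Local Notation V := ('rV[R]_n * R)%type.
Implicit Types (F v : V -> R) (x : 'rV[R]_n) (s t : R).

Definition wave_eq v : Prop := forall p,
  \sum_(i < n) pd (space_dir R i) (pd (space_dir R i) v) p =
  pd (time_dir R n) (pd (time_dir R n) v) p.

Definition even_wave v : Prop :=
  [/\ rsmooth v, wave_eq v & forall x t, v (x, - t) = v (x, t)].

Definition cube (rho : R) : set 'rV[R]_n := [set x | forall i, `|x 0 i| <= rho].

Lemma space_shift (h : R) j x s :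
  h *: space_dir R j + (x, s) = (h *: basis_vec R j + x, s).
Proof. by congr pair; rewrite /= scaler0 add0r. Qed.

Lemma time_shift (h : R) x s : h *: time_dir R n + (x, s) = (x, h + s).
Proof. by congr pair; rewrite /= ?scaler0 ?add0r // [_ *: _]mulr1. Qed.

Lemma cube_shift (rho h : R) (j : 'I_n) x : cube rho x ->
  cube (rho + `|h|) (h *: basis_vec R j + x).
Proof.
move=> cx i; rewrite !mxE eqxx /= addrC.
apply: (le_trans (ler_normD _ _)); rewrite lerD //.
by rewrite normrM; case: eqP => _ /=; rewrite ?normr1 ?normr0 ?mulr1 ?mulr0.
Qed.

Lemma cube_le (rho rho' : R) : rho <= rho' -> cube rho `<=` cube rho'.
Proof. by move=> le x cx i; apply: le_trans (cx i) le. Qed.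

Lemma cube_compact (rho : R) : compact (cube rho).
Proof.
have -> : cube rho = [set x | forall i, `[- rho, rho]%classic (x ord0 i)].
  by apply/seteqP; split=> x cx i; have := cx i; rewrite /= in_itv /= -ler_norml.
exact: (rV_compact (A := fun=> `[- rho, rho]%classic)
  (fun=> @segment_compact R (- rho) rho)).
Qed.

Definition dq (k : nat) (h : R) (j : 'I_n) F : V -> R :=
  fun p => k%:R * (F (h *: space_dir R j + p) - F p).

Definition dqs k h (js : seq 'I_n) F : V -> R := foldr (dq k h) F js.

Lemma rsmooth_dq k h j F : rsmooth F -> rsmooth (dq k h j F).
Proof.
by move=> sF; exact: (rsmoothZ k%:R (rsmoothB (rsmooth_translate _ sF) sF)).
Qed.

Lemma pd_dq k h j F u : rsmooth F -> pd u (dq k h j F) = dq k h j (pd u F).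
Proof.
move=> sF; have sT := rsmooth_translate (h *: space_dir R j) sF.
have := @dirsZ _ _ [:: u] k%:R _ (rsmoothB sT sF).
rewrite (@dirsB _ _ [:: u] _ _ sT sF) /= => ->.
by rewrite pd_translate.
Qed.

Lemma rsmooth_dqs k h js F : rsmooth F -> rsmooth (dqs k h js F).
Proof. by move=> sF; elim: js => [//|j js ih]; exact: rsmooth_dq. Qed.

Lemma pd_dqs k h js F u : rsmooth F -> pd u (dqs k h js F) = dqs k h js (pd u F).
Proof.
move=> sF; elim: js => [//|j js ih] /=; rewrite -ih.
exact: pd_dq (rsmooth_dqs k h js sF).
Qed.

(** The wave equation has constant coefficients, so spatial differences of an even wave are even
    waves again and obey the same lattice estimate. *)
Lemma even_wave_dq k h j F : even_wave F -> even_wave (dq k h j F).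
Proof.
move=> [sF wF eF]; split; first exact: rsmooth_dq.
  have E u p : pd u (pd u (dq k h j F)) p =
      k%:R * (pd u (pd u F) (h *: space_dir R j + p) - pd u (pd u F) p).
    by rewrite (pd_dq k h j u sF) (pd_dq k h j u (rsmooth_derive u sF)).
  move=> p; rewrite E (eq_bigr _ (fun i _ => E (space_dir R i) p)).
  by rewrite -mulr_sumr sumrB; congr (_ * (_ - _)); exact: wF.
by move=> x t; rewrite /dq !space_shift !eF.
Qed.

Lemma even_wave_dqs k h js F : even_wave F -> even_wave (dqs k h js F).
Proof. by move=> eF; elim: js => [//|j js ih]; exact: even_wave_dq. Qed.

(** By the mean value theorem each difference costs a factor k h <= l and is governed by a
    derivative at a point shifted by at most h <= l; hence the power of l and the enlarged cube. [S]
    is the set of times considered, {0} for the data and [-t, t] for the remainders. *)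
Lemma dqs_bound k (h l B rho : R) (S : set R) js F : rsmooth F ->
  0 <= h <= l -> k%:R * h <= l ->
  (forall x s, cube (rho + (size js)%:R * l) x -> S s ->
     `|dirs (map (@space_dir R n) js) F (x, s)| <= B) ->
  forall x s, cube rho x -> S s -> `|dqs k h js F (x, s)| <= l ^+ size js * B.
Proof.
move=> + /andP[h0 hl] khl.
elim: js F rho => [|j js ih] F rho sF HB x s cx Ss /=.
  by rewrite expr0 mul1r; apply: HB => //; rewrite mul0r addr0.
have l0 : 0 <= l by rewrite (le_trans h0).
have key c : 0 <= c <= h ->
    `|pd (space_dir R j) (dqs k h js F) (c *: space_dir R j + (x, s))| <=
      l ^+ size js * B.
  move=> /andP[c0 ch]; rewrite pd_dqs // space_shift.
  apply: (ih (pd (space_dir R j) F) (rho + l) (rsmooth_derive _ sF)) => //.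
    move=> y s' cy Ss'; rewrite dirs_derive //; apply: HB => //=.
    by apply: cube_le cy; rewrite -[(size js).+1%:R]natr1 mulrDl mul1r addrA addrAC.
  apply: cube_le (cube_shift c j cx); rewrite lerD2l ger0_norm //.
  exact: le_trans ch hl.
rewrite /dq normrM ger0_norm // exprS -mulrA.
have := increment_bound (rsmooth_dqs k h js sF) h0 key.
move=> /(ler_wpM2l (ler0n _ k)) /le_trans; apply; rewrite [leLHS]mulrA.
apply: ler_wpM2r => //; apply: le_trans (key 0 _); first exact: normr_ge0.
by rewrite lexx.
Qed.

End EvenWaves.

(** * The lattice estimate for one even wave *)

Section Apriori.
Variables (R : realType) (n : nat).
Hypothesis n_gt0 : (0 < n)%N.
Local Notation V := ('rV[R]_n * R)%type.
Implicit Types (F v : V -> R) (x : 'rV[R]_n).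

Variables (t : R) (k : nat).
Hypotheses (t_gt0 : 0 < t) (k_gt0 : (0 < k)%N).

Let tau : R := t / k%:R.
(* With h^2 = n tau^2 the second differences in space and time cancel to leading
   order. *)
Let h : R := Num.sqrt n%:R * tau.
Let l : R := Num.sqrt n%:R * t.

Lemma k_neq0 : k%:R != 0 :> R. Proof. by rewrite pnatr_eq0 -lt0n. Qed.
Lemma tau_gt0 : 0 < tau. Proof. by rewrite divr_gt0 // ltr0n. Qed.
Lemma k_tau : k%:R * tau = t. Proof. by rewrite mulrC divfK // k_neq0. Qed.
Lemma sqrtn_ge1 : 1 <= Num.sqrt n%:R :> R.
Proof. by rewrite -[leLHS]sqrtr1 ler_wsqrtr // ler1n. Qed.
Lemma h_gt0 : 0 < h.
Proof. by rewrite mulr_gt0 ?tau_gt0 // (lt_le_trans ltr01) // sqrtn_ge1. Qed.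
Lemma k_h : k%:R * h = l. Proof. by rewrite mulrCA k_tau. Qed.
Lemma h_le_l : h <= l.
Proof. by rewrite -k_h; apply: ler_peMl; [exact: ltW h_gt0 | rewrite ler1n]. Qed.
Lemma h_sq : h ^+ 2 = n%:R * tau ^+ 2.
Proof. by rewrite exprMn sqr_sqrtr. Qed.

Definition sample F (j : nat) : 'rV[R]_n -> R := fun x => F (x, j%:R * tau).

Definition truncation F (j : nat) : 'rV[R]_n -> R := fun x =>
  F (x, tau + j%:R * tau) + F (x, - tau + j%:R * tau)
  - 2 * lattice_avg h (sample F j) x.

(** The radius 2 l is that of the whole lattice, which extends 2 k steps of length h from the
    origin; neighbours lie one step h <= l further, hence 3 l. *)
Lemma truncation_bound F (B : R) (j : nat) x : even_wave F ->
  (j < k)%N -> cube (2 * l) x ->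
  (forall y s, cube (3 * l) y -> `|s| <= t ->
     `|pd (time_dir R n) (pd (time_dir R n) (pd (time_dir R n) F)) (y, s)| <= B) ->
  (forall i y s, cube (3 * l) y -> `|s| <= t ->
     `|pd (space_dir R i) (pd (space_dir R i) (pd (space_dir R i) F)) (y, s)| <= B) ->
  `|truncation F j x| <= 2 * (tau ^+ 3 * B) + 2 * (h ^+ 3 * B).
Proof.
move=> [sF wF _] jk cx HBt HBx; set s := j%:R * tau; set p := (x, s).
have tau0 := ltW tau_gt0; have h0 := ltW h_gt0.
have s0 : 0 <= s by rewrite mulr_ge0.
have st : s + tau <= t.
  by rewrite -k_tau /s -[X in _ + X]mul1r -mulrDl ler_wpM2r // natr1 ler_nat.
have l0 : 0 <= l by rewrite (le_trans h0) // h_le_l.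
have cx3 : cube (3 * l) x by apply: cube_le cx; rewrite ler_wpM2r // ler_nat.
pose D2 w := pd w (pd w F) p.
have Ht : `|F (x, tau + s) + F (x, - tau + s) - 2 * F p - tau ^+ 2 * D2 (time_dir R n)|
    <= 2 * (tau ^+ 3 * B).
  have := @second_difference_bound _ _ F (time_dir R n) p tau B sF tau0.
  rewrite !time_shift; apply=> c /andP[c1 c2]; rewrite time_shift.
  by apply: HBt => //; rewrite ler_norml; apply/andP; split; lra.
have Hx i : `|F (h *: basis_vec R i + x, s) + F (- h *: basis_vec R i + x, s) - 2 * F p
      - h ^+ 2 * D2 (space_dir R i)| <= 2 * (h ^+ 3 * B).
  have := @second_difference_bound _ _ F (space_dir R i) p h B sF h0.
  rewrite !space_shift; apply=> c /andP[c1 c2]; rewrite space_shift.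
  apply: HBx; last by rewrite ger0_norm //; lra.
  apply: cube_le (cube_shift c i cx).
  have : `|c| <= h by rewrite ler_norml c1.
  by have := h_le_l; lra.
have n0 : n%:R != 0 :> R by rewrite pnatr_eq0 -lt0n.
(* The terms tau^2 D2 in time and h^2 D2 in space, the latter averaged over the n directions, cancel
   by the wave equation and h^2 = n tau^2. What is left is one remainder in time and the mean of n
   remainders in space. *)
have -> : truncation F j x =
   (F (x, tau + s) + F (x, - tau + s) - 2 * F p - tau ^+ 2 * D2 (time_dir R n)) -
   n%:R^-1 * \sum_i (F (h *: basis_vec R i + x, s) + F (- h *: basis_vec R i + x, s)
      - 2 * F p - h ^+ 2 * D2 (space_dir R i)).
  have E : \sum_i h ^+ 2 * D2 (space_dir R i) = h ^+ 2 * D2 (time_dir R n).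
    by rewrite -mulr_sumr; congr (_ * _); exact: wF.
  rewrite !sumrB E sumr_const card_ord h_sq.
  rewrite /truncation /lattice_avg /sample -/s -(mulr_natr (2 * F p) n).
  by move: (\sum_j _) => S; field.
apply: (le_trans (ler_normB _ _)); apply: lerD => //.
rewrite normrM ger0_norm ?invr_ge0 // ler_pdivrMl ?ltr0n //.
apply: (le_trans (ler_norm_sum _ _ _)).
by apply: (le_trans (ler_sum _ (fun i _ => Hx i))); rewrite sumr_const card_ord (mulr_natl _ n).
Qed.

(** The torus has 4 k + 1 points per coordinate and the origin at index 2 k. The box occupies the
    indices from 2 k to 3 k - 1 and so stays at distance k from the seam, as k time steps
    require. *)
Lemma box_sum_bound F (b B : R) : even_wave F -> 0 < b -> 0 < B ->
  (forall x, cube (2 * l) x -> `|F (x, 0)| <= b) ->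
  (forall y s, cube (3 * l) y -> `|s| <= t ->
     `|pd (time_dir R n) (pd (time_dir R n) (pd (time_dir R n) F)) (y, s)| <= B) ->
  (forall i y s, cube (3 * l) y -> `|s| <= t ->
     `|pd (space_dir R i) (pd (space_dir R i) (pd (space_dir R i) F)) (y, s)| <= B) ->
  \sum_(z : 'rV['I_(4 * k).+1]_n | box (2 * k) k n z)
     `|F (lattice_pos h (2 * k) z, t)|
  <= k%:R ^+ n * (5 ^+ n * (b + 2 * (t ^+ 3 + l ^+ 3) * B / k%:R)).
Proof.
move=> eF b0 B0 Hb HBt HBx; have [_ _ ev] := eF.
have tau0 := tau_gt0; have h0 := h_gt0.
have cpos (z : 'rV['I_(4 * k).+1]_n) : cube (2 * l) (lattice_pos h (2 * k) z).
  move=> i; rewrite mxE normrM (gtr0_norm h0).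
  have -> : 2 * l = h * (2 * k%:R) by rewrite -k_h; ring.
  rewrite ler_pM2l //.
  have := ltn_ord (z ord0 i); rewrite ltnS => zi.
  rewrite ler_norml; apply/andP; split.
    by rewrite natrM; have := ler0n R (z ord0 i); lra.
  by move: zi; rewrite -(ler_nat R) !natrM; lra.
pose d := 2 * (tau ^+ 3 * B) + 2 * (h ^+ 3 * B).
have d0 : 0 < d.
  have p0 a : 0 < a -> 0 < 2 * (a ^+ 3 * B).
    by move=> a0; apply: mulr_gt0 => //; apply: mulr_gt0 => //; exact: exprn_gt0.
  by apply: addr_gt0; exact: p0.
have H : \sum_(z : 'rV['I_(4 * k).+1]_n | inner k z)
      `|sample F k (lattice_pos h (2 * k) z)| <=
    ((4 * k).+1 ^ n)%:R * (b + k%:R * (k%:R * d)).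
  apply: (lattice_estimate n_gt0 (r := truncation F)) => //.
  (* Evenness gives F (x, - tau) = F (x, tau), so the two-sided scheme at time 0 yields the first
     step, with half of the forcing. *)
  - move=> x; rewrite /truncation /sample /= mul1r mul0r !addr0 ev.
    by field.
  - move=> j x; rewrite /truncation /sample.
    have -> : j.+2%:R * tau = tau + j.+1%:R * tau by rewrite -(natr1 j.+1); ring.
    have -> : j%:R * tau = - tau + j.+1%:R * tau by rewrite -(natr1 j); ring.
    by ring.
  - by move=> z; rewrite /sample mul0r; apply: Hb; exact: cpos.
  - by move=> j z jk; apply: truncation_bound => //; exact: cpos.
apply: (le_trans (y := \sum_(z : 'rV['I_(4 * k).+1]_n | inner k z)
   `|sample F k (lattice_pos h (2 * k) z)|)).
  rewrite /sample k_tau [leRHS](bigID (@box n (4 * k) (2 * k) k n)) /=.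
  rewrite ler_wpDr ?sumr_ge0 // le_eqVlt; apply/orP; left; apply/eqP.
  apply: eq_bigl => z; rewrite andbC; apply/esym/andb_idr => /boxP Bz.
  apply/innerP => i; have := Bz i; rewrite ltn_ord; lia.
apply: (le_trans H).
have -> : b + k%:R * (k%:R * d) = b + 2 * (t ^+ 3 + l ^+ 3) * B / k%:R.
  congr (_ + _).
  have gen (a c kk : R) : kk != 0 -> kk * (kk * (2 * (a ^+ 3 * B) + 2 * (c ^+ 3 * B))) =
      2 * ((kk * a) ^+ 3 + (kk * c) ^+ 3) * B / kk by move=> kk0; field.
  by rewrite /d (gen _ _ _ k_neq0) k_tau k_h.
have l0 : 0 < l := lt_le_trans h0 h_le_l.
have tl : 0 <= t ^+ 3 + l ^+ 3.
  by apply: addr_ge0; apply: exprn_ge0; apply: ltW.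
rewrite mulrA -exprMn; apply: ler_wpM2r.
  apply: addr_ge0; first exact: ltW.
  by apply: divr_ge0 => //; apply: mulr_ge0 (ltW B0); apply: mulr_ge0.
(* Since k > 0, one has 4 k + 1 <= 5 k; this is the origin of 5^n. *)
rewrite natrX; apply: lerXn2r; rewrite ?nnegrE ?mulr_ge0 //.
by rewrite -[5]/(5%:R) -natrM ler_nat; lia.
Qed.

(** The box estimate, applied to all iterated differences of v of order at most n, feeds the Sobolev
    inequality. The constant 10^n is 5^n, from the number of lattice points, times 2^n. As l1
    dominates 1 and l, the power l1^n covers l^i for every number i <= n of differences. *)
Lemma pointwise_bound v (l1 M B : R) : even_wave v -> 0 < M -> 0 < B ->
  1 <= l1 -> l <= l1 ->
  (forall w : seq 'I_n, (size w <= n)%N -> forall x, cube (2 * l + n%:R * l) x ->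
     `|dirs (map (@space_dir R n) w) v (x, 0)| <= M) ->
  (forall w : seq 'I_n, (size w <= n)%N ->
     forall x s, cube (3 * l + n%:R * l) x -> `|s| <= t ->
     `|dirs (map (@space_dir R n) w)
         (pd (time_dir R n) (pd (time_dir R n) (pd (time_dir R n) v))) (x, s)| <= B) ->
  (forall i (w : seq 'I_n), (size w <= n)%N ->
     forall x s, cube (3 * l + n%:R * l) x -> `|s| <= t ->
     `|dirs (map (@space_dir R n) w)
         (pd (space_dir R i) (pd (space_dir R i) (pd (space_dir R i) v))) (x, s)| <= B) ->
  `|v (0, t)| <= 10 ^+ n * (l1 ^+ n * M + 2 * (t ^+ 3 + l ^+ 3) * (l1 ^+ n * B) / k%:R).
Proof.
move=> eV M0 B0 l11 ll1 HM HBt HBx; have [sv _ _] := eV.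
have h0 := h_gt0; have hl := h_le_l; have l0 := lt_le_trans h0 hl.
have S1 u := rsmooth_derive u sv; have S2 u := rsmooth_derive u (S1 u).
have S3 u := rsmooth_derive u (S2 u).
have E3 js u : pd u (pd u (pd u (dqs k h js v))) = dqs k h js (pd u (pd u (pd u v))).
  by rewrite (pd_dqs k h js u sv) (pd_dqs k h js u (S1 u)) (pd_dqs k h js u (S2 u)).
pose Phi (j : nat) (G : 'rV[R]_n -> R) := exists2 js : seq 'I_n,
  (size js <= j)%N & G = fun x => dqs k h js v (x, t).
have -> : 10 ^+ n = 2 ^+ n * 5 ^+ n :> R by rewrite -exprMn -natrM.
rewrite -mulrA.
apply: (discrete_sobolev (m := k) (M := 4 * k) (c := 2 * k) (h := h) k_gt0 _ (Phi := Phi)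
   _ _ (F := fun x => v (x, t))).
- lia.
- move=> j _ [js sj ->]; split; first by exists js => //; exact: leqW.
  exists (j :: js) => //=; apply/funext => x.
  by rewrite /diffq /dq space_shift.
- move=> _ [js sj ->].
  have lpow (C : R) : 0 < C -> l ^+ size js * C <= l1 ^+ n * C.
    move=> C0; rewrite ler_pM2r //.
    apply: (le_trans (y := l1 ^+ size js)); last by rewrite ler_weXn2l.
    by rewrite lerXn2r // nnegrE ltW // (lt_le_trans l0).
  have sl : (size js)%:R * l <= n%:R * l by rewrite ler_pM2r // ler_nat.
  have hh : 0 <= h <= l by rewrite ltW.
  have kh : k%:R * h <= l by rewrite k_h.
  have l1p : 0 < l1 ^+ n by rewrite exprn_gt0 // (lt_le_trans l0).
  apply: box_sum_bound; first exact: even_wave_dqs.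
  + by rewrite mulr_gt0.
  + by rewrite mulr_gt0.
  + move=> x cx; apply: le_trans (lpow M M0).
    apply: (@dqs_bound _ _ _ _ _ _ (2 * l) [set 0]) => // y s cy -> /=.
    by apply: HM => //; apply: cube_le cy; rewrite lerD2l.
  + move=> x s cx ss; apply: le_trans (lpow B B0); rewrite E3.
    apply: (@dqs_bound _ _ _ _ _ _ (3 * l) [set s | `|s| <= t] _ _ (S3 _)) => //.
    move=> y s' cy /= ss'; apply: HBt => //; apply: cube_le cy.
    by rewrite lerD2l.
  + move=> i x s cx ss; apply: le_trans (lpow B B0); rewrite E3.
    apply: (@dqs_bound _ _ _ _ _ _ (3 * l) [set s | `|s| <= t] _ _ (S3 _)) => //.
    move=> y s' cy /= ss'; apply: HBx => //; apply: cube_le cy.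
    by rewrite lerD2l.
- by exists [::].
Qed.

End Apriori.

(** * The limit of vanishing lattice step *)

Section AprioriEstimate.
Variables (R : realType) (n : nat).
Local Notation V := ('rV[R]_n * R)%type.

Definition bnd (L : R) (N : nat) (f : 'rV[R]_n -> R) (B : R) : Prop :=
  forall w : seq 'I_n, (size w <= N)%N -> forall x, cube L x ->
    `|dirs (map (@basis_vec R n) w) f x| <= B.

Lemma slice_affine (s h : R) (u x : 'rV[R]_n) :
  (h *: u + x, s) = h *: ((u, 0) : V) + (x, s).
Proof. by congr pair; rewrite /= scaler0 add0r. Qed.

Lemma slice_continuous (s : R) : continuous (fun x : 'rV[R]_n => (x, s) : V).
Proof.
move=> x.
have := @cvg_pair _ _ _ (nbhs x) (nbhs x) (nbhs s) _ _ _ (fun x => x) (fun=> s).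
by apply; [exact: cvg_id | exact: cvg_cst].
Qed.

Lemma rsmooth_slice (v : V -> R) s : rsmooth v -> rsmooth (fun x => v (x, s)).
Proof.
exact: (rsmooth_affine (A := fun x => (x, s)) (L := fun u => (u, 0))
          (f := v) (slice_affine s) (@slice_continuous s)).
Qed.

Lemma dirs_slice (v : V -> R) s (w : seq 'I_n) x :
  dirs (map (@basis_vec R n) w) (fun x => v (x, s)) x =
  dirs (map (@space_dir R n) w) v (x, s).
Proof.
have := dirs_affine (A := fun x => (x, s)) (slice_affine s)
  (map (@basis_vec R n) w) v.
by rewrite -map_comp => /(congr1 (fun f => f x)).
Qed.

(** [C] and [L] are fixed by n and t before v is given. The third derivatives of v enter
    [pointwise_bound] only through B, which is divided by k, and k may be chosen after v. *)
Lemma a_priori_pos (n_gt0 : (0 < n)%N) (t : R) : 0 < t ->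
  exists C L : R, [/\ 0 <= C, 0 <= L & forall v : V -> R, even_wave v ->
    forall M, 0 <= M -> bnd L n (fun x => v (x, 0)) M -> `|v (0, t)| <= C * M].
Proof.
move=> t0; pose l := Num.sqrt n%:R * t; pose l1 := 1 + l.
have l0 : 0 <= l by rewrite mulr_ge0 // ltW.
have l11 : 1 <= l1 by rewrite /l1 lerDl.
have ll1 : l <= l1 by rewrite /l1 lerDr.
have l1n : 0 < l1 ^+ n by rewrite exprn_gt0 // (lt_le_trans ltr01).
pose C := 10 ^+ n * l1 ^+ n.
have C0 : 0 < C by rewrite mulr_gt0 // exprn_gt0.
exists C, (2 * l + n%:R * l); split.
- exact: ltW.
- by rewrite addr_ge0 // mulr_ge0.
move=> v ev M M0 HM; have [sv _ _] := ev.
pose K : set V := cube (3 * l + n%:R * l) `*` `[- t, t]%classic.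
have cK : compact K.
  by apply: compact_setX; [exact: cube_compact | exact: segment_compact].
have D3 u : rsmooth (pd u (pd u (pd u v))).
  by do 3 apply: rsmooth_derive.
have [Bt Bt0 HBt] := @words_bounded _ _ _ (@space_dir R n) K n _ cK (D3 (time_dir R n)).
have /fin_all_exists[Bx HBx] : forall i : 'I_n, exists B, 0 <= B /\
    forall w : seq 'I_n, (size w <= n)%N -> forall p, K p ->
      `|dirs (map (@space_dir R n) w)
          (pd (space_dir R i) (pd (space_dir R i) (pd (space_dir R i) v))) p| <= B.
  move=> i; have [B B0 HB] :=
    @words_bounded _ _ _ (@space_dir R n) K n _ cK (D3 (space_dir R i)).
  by exists B.
pose B := 1 + Bt + \sum_i Bx i.
have sBx : 0 <= \sum_i Bx i by rewrite sumr_ge0 // => i _; have [] := HBx i.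
have B0 : 0 < B by rewrite /B -addrA ltr_wpDr // addr_ge0.
have inK x s : cube (3 * l + n%:R * l) x -> `|s| <= t -> K (x, s).
  by move=> cx ss; split=> //=; rewrite in_itv /= -ler_norml.
apply/ler_addgt0Pl => e e0; rewrite addrC.
(* One d makes [M + d] positive, as [pointwise_bound] asks, and a second d absorbs the truncation
   error; together they cost e. *)
pose d := e / (2 * C).
have d0 : 0 < d by rewrite divr_gt0 // mulr_gt0.
pose Z := 2 * (t ^+ 3 + l ^+ 3) * B.
have Z0 : 0 <= Z.
  by rewrite !mulr_ge0 // ?(ltW B0) // addr_ge0 // exprn_ge0 // ltW.
have Zd : 0 <= Z / d by rewrite divr_ge0 // ltW.
pose k := Num.bound (Z / d).
have kZ : Z / d < k%:R by have := archi_boundP Zd.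
have k0 : (0 < k)%N by rewrite -(ltr0n R) (le_lt_trans Zd).
have := @pointwise_bound R n n_gt0 t k t0 k0 v l1 (M + d) B ev.
have Md : 0 < M + d by rewrite ltr_wpDl.
move=> /(_ Md B0 l11 ll1) H.
apply: (le_trans (H _ _ _)).
- move=> w sw x cx; rewrite -dirs_slice; apply: le_trans (HM w sw x cx) _.
  by rewrite lerDl ltW.
- move=> w sw x s cx ss; apply: le_trans (HBt w sw _ (inK _ _ cx ss)) _.
  by rewrite /B addrAC lerDr addr_ge0.
- move=> i w sw x s cx ss; have [_ Hi] := HBx i.
  apply: le_trans (Hi w sw _ (inK _ _ cx ss)) _.
  rewrite /B (bigD1 i) //= addrCA lerDl !addr_ge0 // sumr_ge0 // => j _.
  by have [] := HBx j.
have Zk : Z / k%:R <= d.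
  rewrite ler_pdivrMr ?ltr0n // mulrC -ler_pdivrMr //; exact: ltW.
rewrite -/l; have -> : 10 ^+ n * (l1 ^+ n * (M + d) +
    2 * (t ^+ 3 + l ^+ 3) * (l1 ^+ n * B) / k%:R) = C * (M + d + Z / k%:R).
  by rewrite /C /Z; ring.
apply: (le_trans (y := C * (M + d + d))).
  by rewrite ler_pM2l // lerD2l.
have -> : C * (M + d + d) = C * M + C * (2 * d) by ring.
rewrite lerD2l le_eqVlt; apply/orP; left; apply/eqP.
by rewrite /d; field; rewrite gt_eqF.
Qed.

Lemma a_priori (n_gt0 : (0 < n)%N) (t : R) :
  exists C L : R, [/\ 0 <= C, 0 <= L & forall v : V -> R, even_wave v ->
    forall M, 0 <= M -> bnd L n (fun x => v (x, 0)) M -> `|v (0, t)| <= C * M].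
Proof.
have [t0|t0|->] := ltgtP t 0; last first.
- exists 1, 0; split=> // v _ M _ /(_ [::] isT 0) /=; rewrite mul1r; apply.
  by move=> i; rewrite mxE normr0.
- exact: a_priori_pos.
have [|C [L [C0 L0 H]]] := @a_priori_pos n_gt0 (- t); first by rewrite oppr_gt0.
exists C, L; split=> // v ev M M0 HM; have [_ _ e] := ev.
by rewrite -e; exact: H.
Qed.

End AprioriEstimate.

(** * Density of trigonometric polynomials *)

Section RidgeCosine.
Variables (R : realType) (V : normedModType R) (l : V -> R).
Hypothesis l_lin : forall (h : R) u x, l (h *: u + x) = h * l u + l x.
Hypothesis l_cont : continuous l.

Lemma derive_dir_real (f : R -> R) (c y : R) : derivable f y 1 ->
  derivable f y c /\ 'D_c f y = c * 'D_1 f y.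
Proof.
move=> /derivable1_diffP df; split; first exact: diff_derivable.
by rewrite !deriveE // -{1}[c]mulr1 -[c * 1]/(c *: 1) linearZ.
Qed.

Lemma ridge_affine th (h : R) u x : l (h *: u + x) + th = h *: l u + (l x + th).
Proof. by rewrite l_lin addrA. Qed.

Lemma ridge_cont th : continuous (fun x => l x + th).
Proof. by move=> x; apply: cvgD; [exact: l_cont | exact: cvg_cst]. Qed.

(** Writing the derivative as a phase shift by pi / 2 keeps the functions c cos (l x + th) stable
    under differentiation, which is what [rsmooth_coind] uses. *)
Lemma pd_ridge_cos v th : pd v (fun x => cos (l x + th)) =
  fun x => l v * cos (l x + (th + pi / 2)).
Proof.
apply/funext => x.
rewrite (derive_affine (ridge_affine th) (@cos R) v x) pdE.
have dc := is_derive_cos (l x + th).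
have [_ ->] := @derive_dir_real cos (l v) (l x + th) (@ex_derive _ _ _ _ _ _ _ dc).
by rewrite derive_val addrA cosDpihalf.
Qed.

Lemma rsmooth_ridge_cos th : rsmooth (fun x => cos (l x + th)).
Proof.
apply: (rsmooth_coind (P := fun f => exists c th, f = fun x => c * cos (l x + th)));
  last by exists 1, th; apply/funext => x; rewrite mul1r.
move=> _ [c [a ->]].
have dv x v : derivable (fun x => cos (l x + a)) x v.
  apply: (derivable_affine (ridge_affine a) (f := @cos R)).
  have dc := is_derive_cos (l x + a).
  by have [] := @derive_dir_real cos (l v) (l x + a) (@ex_derive _ _ _ _ _ _ _ dc).
split=> [x|x v|v].
- apply: cvgM; first exact: cvg_cst.
  have := @continuous_comp _ _ _ (fun x => l x + a) (@cos R) x.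
  by apply; [exact: ridge_cont | exact: continuous_cos].
- exact: (@derivableZ _ _ _ _ c).
- exists (c * l v), (a + pi / 2); apply/funext => x.
  have -> : pd v (fun x => c * cos (l x + a)) x = c * pd v (fun x => cos (l x + a)) x.
    by rewrite !pdE; exact: (deriveZ c).
  by rewrite pd_ridge_cos mulrA.
Qed.

Lemma dirs_ridge_cos vs th : dirs vs (fun x => cos (l x + th)) =
  fun x => (\prod_(v <- vs) l v) * cos (l x + (th + (size vs)%:R * (pi / 2))).
Proof.
elim: vs => [|v vs ih].
  by apply/funext => x; rewrite big_nil mul1r mul0r addr0.
rewrite /= ih; apply/funext => x.
have sm := rsmooth_ridge_cos (th + (size vs)%:R * (pi / 2)).
have := @dirsZ _ _ [:: v] (\prod_(v <- vs) l v) _ sm.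
move=> /= ->; rewrite pd_ridge_cos big_cons mulrA (mulrC (l v)).
by congr (_ * cos (_ + _)); rewrite -[(size vs).+1%:R]natr1; ring.
Qed.

End RidgeCosine.

Lemma continuous_sumr (R : realType) (T : topologicalType) (I : Type) (r : seq I)
    (F : I -> T -> R) : (forall i, continuous (F i)) ->
  continuous (fun x => \sum_(i <- r) F i x).
Proof.
move=> cF; elim: r => [|i r ih].
  rewrite (_ : (fun _ => _) = fun=> 0); first exact: cst_continuous.
  by apply/funext => x; rewrite big_nil.
rewrite (_ : (fun _ => _) = fun x => F i x + \sum_(j <- r) F j x); last first.
  by apply/funext => x; rewrite big_cons.
by move=> x; apply: cvgD; [exact: cF | exact: ih].
Qed.

(** * Trigonometric polynomials and their closure *)

Section Approximation.
Variables (R : realType) (n : nat).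
Local Notation X := 'rV[R]_n.
Implicit Types (f g : X -> R) (x : X) (L A B : R) (N : nat).

Lemma bnd_le L N f A B : A <= B -> bnd L N f A -> bnd L N f B.
Proof. by move=> AB H w sw x cx; apply: le_trans (H w sw x cx) AB. Qed.

Lemma bndD L N f g A B : rsmooth f -> rsmooth g ->
  bnd L N f A -> bnd L N g B -> bnd L N (fun x => f x + g x) (A + B).
Proof.
move=> sf sg Hf Hg w sw x cx; rewrite dirsD //.
by apply: (le_trans (ler_normD _ _)); apply: lerD; [exact: Hf | exact: Hg].
Qed.

Lemma bndZ L N f c A : rsmooth f -> bnd L N f A ->
  bnd L N (fun x => c * f x) (`|c| * A).
Proof.
by move=> sf Hf w sw x cx; rewrite dirsZ // normrM ler_wpM2l //; exact: Hf.
Qed.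

Lemma bnd_pd L N f A i : rsmooth f -> bnd L N.+1 f A ->
  bnd L N (pd (basis_vec R i) f) A.
Proof.
move=> sf Hf w sw x cx; rewrite dirs_derive //.
exact: (Hf (i :: w)).
Qed.

Lemma bnd_leN L N N' f A : (N' <= N)%N -> bnd L N f A -> bnd L N' f A.
Proof. by move=> le Hf w sw; apply: Hf; apply: leq_trans sw le. Qed.

(** Leibniz: every derivative doubles the number of products, whence 2^N. *)
Lemma bndM L N f g A B : rsmooth f -> rsmooth g -> 0 <= L ->
  bnd L N f A -> bnd L N g B -> bnd L N (fun x => f x * g x) (2 ^+ N * (A * B)).
Proof.
move=> sf sg L0.
have nonneg (F : X -> R) C : bnd L N F C -> 0 <= C.
  move=> /(_ [::] (leq0n _) 0) H; apply: le_trans (H _) => // i.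
  by rewrite mxE normr0.
move=> Hf Hg; have A0 := nonneg _ _ Hf; have B0 := nonneg _ _ Hg.
elim: N f g {nonneg} sf sg Hf Hg => [|N ih] f g sf sg Hf Hg.
  move=> [|//] _ x cx /=; rewrite expr0 mul1r normrM.
  by apply: ler_pM => //; [exact: (Hf [::]) | exact: (Hg [::])].
move=> [|i w] sw x cx.
  rewrite /= normrM; apply: (le_trans (y := A * B)).
    by apply: ler_pM => //; [exact: (Hf [::]) | exact: (Hg [::])].
  by rewrite ler_peMl ?mulr_ge0 // exprn_ege1 // ler1n.
have sdf := rsmooth_derive (basis_vec R i) sf.
have sdg := rsmooth_derive (basis_vec R i) sg.
have -> : dirs (map (@basis_vec R n) (i :: w)) (fun x => f x * g x) =
    dirs (map (@basis_vec R n) w)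
      (fun x => f x * pd (basis_vec R i) g x + g x * pd (basis_vec R i) f x).
  by rewrite -(deriveM_fun _ sf sg) (dirs_derive _ _ (rsmoothM sf sg)).
rewrite dirsD; [|exact: rsmoothM|exact: rsmoothM].
have H1 := ih f _ sf sdg (bnd_leN (leqnSn N) Hf) (bnd_pd i sg Hg).
have := ih _ g sdf sg (bnd_pd i sf Hf) (bnd_leN (leqnSn N) Hg) w sw x cx.
rewrite (_ : (fun x => pd _ f x * g x) = fun x => g x * pd (basis_vec R i) f x);
  last by apply/funext => y; rewrite mulrC.
move=> H2; apply: (le_trans (ler_normD _ _)).
rewrite exprS -mulrA mulrDl mul1r; apply: lerD => //; exact: H1.
Qed.

Lemma bnd_exists L N f : rsmooth f -> exists2 B, 0 <= B & bnd L N f B.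
Proof. by move=> sf; apply: words_bounded => //; exact: cube_compact. Qed.

Lemma dot_lin (xi : X) (h : R) u x : dot xi (h *: u + x) = h * dot xi u + dot xi x.
Proof.
rewrite /dot mulr_sumr -big_split /=; apply: eq_bigr => i _.
by rewrite !mxE; ring.
Qed.

Lemma dot_continuous (xi : X) : continuous (dot xi).
Proof.
have ci i : continuous (fun x : X => xi 0 i * x 0 i).
  move=> x.
  have c2 : {for x, continuous (fun x : X => x 0 i : R)} := @coord_continuous R 1 n 0 i x.
  have := @cvgM R _ (nbhs x) _ (fun=> xi 0 i) (fun x : X => x 0 i : R) _ _ (cvg_cst _).
  by apply; exact: c2.
exact: (continuous_sumr (r := index_enum 'I_n) ci).
Qed.

Lemma dotDl (xi eta : X) x : dot (xi + eta) x = dot xi x + dot eta x.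
Proof. by rewrite /dot -big_split; apply: eq_bigr => i _; rewrite mxE mulrDl. Qed.

Lemma dotNl (xi : X) x : dot (- xi) x = - dot xi x.
Proof. by rewrite /dot -sumrN; apply: eq_bigr => i _; rewrite mxE mulNr. Qed.

Lemma dot0l x : dot 0 x = 0.
Proof. by rewrite /dot big1 // => i _; rewrite mxE mul0r. Qed.

(** A triple is an amplitude, a frequency and a phase. Phases provide the sines, and frequencies are
    arbitrary real vectors, so periodicity is not imposed. *)
Definition tpoly (p : seq (R * X * R)) (x : X) : R :=
  \sum_(q <- p) q.1.1 * cos (dot q.1.2 x + q.2).

Lemma rsmooth_tpoly p : rsmooth (tpoly p).
Proof.
apply: rsmooth_sum => q; apply: rsmoothZ.
exact: (rsmooth_ridge_cos (dot_lin q.1.2) (@dot_continuous q.1.2)).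
Qed.

Lemma tpoly_cat p q : tpoly (p ++ q) = fun x => tpoly p x + tpoly q x.
Proof. by apply/funext => x; rewrite /tpoly big_cat. Qed.

Lemma tpoly_scale c p :
  tpoly [seq (c * q.1.1, q.1.2, q.2) | q <- p] = fun x => c * tpoly p x.
Proof.
apply/funext => x; rewrite /tpoly big_map mulr_sumr.
by apply: eq_bigr => q _ /=; rewrite mulrA.
Qed.

Lemma tpoly_mul p q : exists r, tpoly r = fun x => tpoly p x * tpoly q x.
Proof.
elim: p => [|[[c xi] th] p [r hr]].
  by exists [::]; apply/funext => x; rewrite /tpoly big_nil mul0r.
exists ([seq (c * y.1.1 / 2, xi + y.1.2, th + y.2) | y <- q] ++
        [seq (c * y.1.1 / 2, xi - y.1.2, th - y.2) | y <- q] ++ r).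
rewrite !tpoly_cat hr; apply/funext => x.
have -> : tpoly ((c, xi, th) :: p) x = c * cos (dot xi x + th) + tpoly p x.
  by rewrite /tpoly big_cons.
rewrite mulrDl addrA; congr (_ + _).
rewrite /tpoly !big_map -big_split mulr_sumr; apply: eq_bigr => y _ /=.
rewrite !dotDl dotNl.
have -> : dot xi x + dot y.1.2 x + (th + y.2) = (dot xi x + th) + (dot y.1.2 x + y.2).
  by ring.
have -> : dot xi x - dot y.1.2 x + (th - y.2) = (dot xi x + th) - (dot y.1.2 x + y.2).
  by ring.
by rewrite cosD cosB; field.
Qed.

Definition approx L f : Prop := forall N (e : R), 0 < e ->
  exists p, bnd L N (fun x => f x - tpoly p x) e.

Lemma approx_tpoly L p : approx L (tpoly p).
Proof.
move=> N e e0; exists p => w sw x cx.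
rewrite (dirsB _ (rsmooth_tpoly p) (rsmooth_tpoly p)) subrr normr0.
exact: ltW.
Qed.

Lemma approx_cst L c : approx L (fun=> c).
Proof.
have -> : (fun=> c) = tpoly [:: (c, 0, 0)].
  by apply/funext => x; rewrite /tpoly big_seq1 /= dot0l addr0 cos0 mulr1.
exact: approx_tpoly.
Qed.

Lemma approxD L f g : rsmooth f -> rsmooth g -> approx L f -> approx L g ->
  approx L (fun x => f x + g x).
Proof.
move=> sf sg Hf Hg N e e0; have e2 : 0 < e / 2 by rewrite divr_gt0.
have [p Hp] := Hf N _ e2; have [q Hq] := Hg N _ e2.
exists (p ++ q); rewrite tpoly_cat.
have := bndD (rsmoothB sf (rsmooth_tpoly p)) (rsmoothB sg (rsmooth_tpoly q)) Hp Hq.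
rewrite -splitr; congr (bnd _ _ _ _); apply/funext => x; ring.
Qed.

Lemma approxM L f g : 0 <= L -> rsmooth f -> rsmooth g ->
  approx L f -> approx L g -> approx L (fun x => f x * g x).
Proof.
move=> L0 sf sg Hf Hg N e e0.
have [G G0 HG] := bnd_exists L N sg; have [F F0 HF] := bnd_exists L N sf.
(* From f g - p q = (f - p) g + p (g - q) the error is at most 2^N d (G + F + d), and d <= 1
   replaces the last d by 1. *)
pose d := Num.min 1 (e / (2 ^+ N * (G + F + 1))).
have S0 : 0 < 2 ^+ N * (G + F + 1) by rewrite mulr_gt0 ?exprn_gt0 // ltr_wpDl // addr_ge0.
have d0 : 0 < d by rewrite lt_min ltr01 divr_gt0.
have d1 : d <= 1 by rewrite ge_min lexx.
have dS : d * (2 ^+ N * (G + F + 1)) <= e.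
  by rewrite -ler_pdivlMr // ge_min lexx orbT.
have [p Hp] := Hf N d d0; have [q Hq] := Hg N d d0; have [r hr] := tpoly_mul p q.
have sp := rsmooth_tpoly p; have sq := rsmooth_tpoly q.
have sfp := rsmoothB sf sp; have sgq := rsmoothB sg sq.
exists r; rewrite hr.
have HP : bnd L N (tpoly p) (F + d).
  have := bndD sf (rsmoothZ (-1) sfp) HF (bndZ (-1) sfp Hp).
  rewrite normrN normr1 mul1r; congr (bnd _ _ _ _); apply/funext => x; ring.
have H := bndD (rsmoothM sfp sg) (rsmoothM sp sgq)
  (bndM sfp sg L0 Hp HG) (bndM sp sgq L0 HP Hq).
move: H; rewrite (_ : (fun x => _ + _) = fun x => f x * g x - tpoly p x * tpoly q x);
  last by apply/funext => x; ring.
apply: bnd_le; apply: le_trans dS.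
have -> : 2 ^+ N * (d * G) + 2 ^+ N * ((F + d) * d) = d * (2 ^+ N * (G + F + d)) by ring.
rewrite ler_pM2l // ler_pM2l ?exprn_gt0 //; lra.
Qed.

Lemma approx_lim L f : rsmooth f ->
  (forall N (e : R), 0 < e -> exists g, [/\ rsmooth g, approx L g &
     bnd L N (fun x => f x - g x) e]) -> approx L f.
Proof.
move=> sf H N e e0; have e2 : 0 < e / 2 by rewrite divr_gt0.
have [g [sg ag Hg]] := H N _ e2; have [p Hp] := ag N _ e2.
exists p; have := bndD (rsmoothB sf sg) (rsmoothB sg (rsmooth_tpoly p)) Hg Hp.
rewrite -splitr; congr (bnd _ _ _ _); apply/funext => x; ring.
Qed.

End Approximation.

(** * Coordinates as limits of trigonometric polynomials *)

Section LinearForms.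
Variables (R : realType) (V : normedModType R) (l : V -> R).
Hypothesis l_lin : forall (h : R) u x, l (h *: u + x) = h * l u + l x.
Hypothesis l_cont : continuous l.

Lemma derivable_id_dir (c y : R) : derivable (id : R -> R) y c /\ 'D_c (id : R -> R) y = c.
Proof.
by split; [exact: derivable_id | exact: derive_id].
Qed.

Lemma pd_cst (c : R) (v : V) : pd v (fun=> c) = fun=> 0.
Proof. by apply/funext => x; rewrite pdE derive_cst. Qed.

Lemma pd_linear_form v : pd v l = fun=> l v.
Proof.
apply/funext => x.
rewrite [LHS](derive_affine (A := l) (L := l) l_lin (id : R -> R) v x) pdE.
exact: (derivable_id_dir _ _).2.
Qed.

Lemma rsmooth_linear_form : rsmooth l.
Proof.
apply: (rsmooth_coind (P := fun f => f = l \/ exists c, f = fun=> c)); last by left.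
move=> _ [->|[c ->]]; split=> [x|x v|v].
- exact: l_cont.
- exact: (derivable_affine (A := l) (L := l) l_lin (f := (id : R -> R))
            (derivable_id_dir _ _).1).
- by right; exists (l v); rewrite pd_linear_form.
- exact: cst_continuous.
- exact: derivable_cst.
- by right; exists 0; rewrite pd_cst.
Qed.

Lemma dirs_linear_form v v' vs : dirs [:: v, v' & vs] l = fun=> 0.
Proof.
have [c e] : exists c, dirs (v' :: vs) l = fun=> c.
  elim: vs v' => [|w vs ih] v'; first by exists (l v'); rewrite /= pd_linear_form.
  by exists 0; have [c e] := ih w; rewrite [LHS]/= -[pd w _]/(dirs (w :: vs) l) e pd_cst.
by rewrite -[LHS]/(pd v (dirs (v' :: vs) l)) e pd_cst.
Qed.

End LinearForms.

Section SineBounds.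
Variable R : realType.
Implicit Types z e y : R.

Lemma one_sub_cos_le z : 0 <= z -> `|1 - cos z| <= z.
Proof.
move=> z0.
have [|c cz] := @MVT_segment R cos (fun s => - sin s) 0 z z0 (fun s _ => is_derive_cos s).
  exact/continuous_subspaceT/continuous_cos.
rewrite cos0 subr0 => e; rewrite distrC e normrM normrN (ger0_norm z0).
by rewrite ler_piMl //; exact: sin_max.
Qed.

Lemma sub_sin_le z : 0 <= z -> `|z - sin z| <= z ^+ 2.
Proof.
move=> z0.
have d (s : R) : is_derive s 1 (fun s : R => s - sin s) (1 - cos s).
  exact: (is_deriveB (is_derive_id s 1) (is_derive_sin s)).
have [|c] := @MVT_segment R _ _ 0 z z0 (fun s _ => d s).
  apply/continuous_subspaceT => s; apply/differentiable_continuous/derivable1_diffP.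
  exact: (@ex_derive _ _ _ _ _ _ _ (d s)).
rewrite in_itv /= => /andP[c0 cz]; rewrite sin0 !subr0 => ->.
rewrite normrM (ger0_norm z0) expr2 ler_wpM2r //.
exact: le_trans (one_sub_cos_le c0) cz.
Qed.

Lemma cos_scaled_bound e y : 0 <= e -> `|1 - cos (e * y)| <= e * `|y|.
Proof.
move=> e0; have [y0|y0] := leP 0 y.
  by rewrite (ger0_norm y0); apply: one_sub_cos_le; rewrite mulr_ge0.
rewrite (ltr0_norm y0) -cosN -mulrN; apply: one_sub_cos_le.
by rewrite mulr_ge0 // oppr_ge0 ltW.
Qed.

Lemma sin_scaled_bound e y : 0 < e -> `|y - e^-1 * sin (e * y)| <= e * y ^+ 2.
Proof.
move=> e0; have key z : 0 <= z -> `|z - e^-1 * sin (e * z)| <= e * z ^+ 2.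
  move=> z0.
  have -> : z - e^-1 * sin (e * z) = e^-1 * (e * z - sin (e * z)).
    by rewrite mulrBr mulKf // gt_eqF.
  rewrite normrM normfV (gtr0_norm e0) ler_pdivrMl //.
  apply: le_trans (sub_sin_le _) _; first by rewrite mulr_ge0 // ltW.
  by rewrite le_eqVlt; apply/orP; left; apply/eqP; ring.
have [y0|y0] := leP 0 y; first exact: key.
have := key (- y); rewrite oppr_ge0 ltW // => /(_ isT).
by rewrite mulrN sinN mulrN -opprD normrN sqrrN.
Qed.

End SineBounds.

Section CoordinateApproximation.
Variables (R : realType) (n : nat).
Local Notation X := 'rV[R]_n.

Lemma coord_lin (j : 'I_n) (h : R) (u x : X) :
  (h *: u + x) 0 j = h * u 0 j + x 0 j.
Proof. by rewrite !mxE. Qed.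

Lemma rsmooth_coord (j : 'I_n) : rsmooth (fun x : X => x 0 j).
Proof.
exact: (rsmooth_linear_form (coord_lin j) (@coord_continuous R 1 n 0 j)).
Qed.

Lemma dot_scaled_basis (e : R) (j : 'I_n) (x : X) : dot (e *: basis_vec R j) x = e * x 0 j.
Proof.
rewrite /dot (bigD1 j) //= big1 ?addr0 => [|i /negPf ij].
  by rewrite !mxE !eqxx mulr1.
by rewrite !mxE ij andbF mulr0 mul0r.
Qed.

(** The approximant is sin (d x_j) / d for a small frequency d. Its error is at most d x_j^2 for the
    values and d |x_j| for first derivatives; derivatives of order r >= 2 of the coordinate vanish
    and those of the approximant carry d^(r - 1) <= d. All three are at most d (1 + L + L^2). *)
Lemma approx_coord L j : 0 <= L -> approx L (fun x : X => x 0 j).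
Proof.
move=> L0 N e e0; pose S := 1 + L + L ^+ 2.
have S0 : 0 < S by rewrite /S -addrA ltr_wpDr // addr_ge0 // exprn_ge0.
pose d := Num.min 1 (e / S).
have d0 : 0 < d by rewrite lt_min ltr01 divr_gt0.
have d1 : d <= 1 by rewrite ge_min lexx.
have dS : d * S <= e by rewrite -ler_pdivlMr // ge_min lexx orbT.
have [dL dL2 de] : [/\ d * L <= e, d * L ^+ 2 <= e & d <= e].
  have := exprn_ge0 2 L0; have := mulr_ge0 (ltW d0) L0.
  have := mulr_ge0 (ltW d0) (exprn_ge0 2 L0).
  move: dS; rewrite /S !mulrDr mulr1 => ? ? ? ?; split; lra.
pose xi := d *: basis_vec R j.
have sc := rsmooth_ridge_cos (dot_lin xi) (@dot_continuous R n xi) (- (pi / 2)).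
exists [:: (d^-1, xi, - (pi / 2))] => w sw x cx.
have -> : tpoly [:: (d^-1, xi, - (pi / 2))] =
    fun x => d^-1 * cos (dot xi x + - (pi / 2)).
  by apply/funext => y; rewrite /tpoly big_seq1.
have dirsE := dirs_ridge_cos (dot_lin xi) (@dot_continuous R n xi).
rewrite (dirsB _ (rsmooth_coord j) (rsmoothZ d^-1 sc)) (dirsZ _ _ sc) dirsE.
have lb i : dot xi (basis_vec R i) = d * (i == j)%:R.
  by rewrite dot_scaled_basis mxE eqxx eq_sym.
case: w sw => [|i [|i' w]] sw.
- rewrite /= big_nil mul1r mul0r addr0 dot_scaled_basis cosBpihalf.
  apply: le_trans (sin_scaled_bound _ d0) _; apply: le_trans dL2.
  rewrite ler_pM2l // -(real_normK (num_real (x 0 j))).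
  by apply: lerXn2r; rewrite ?nnegrE.
- rewrite /= (pd_linear_form (coord_lin j)) /= big_seq1 lb mul1r addNr addr0.
  rewrite dot_scaled_basis mxE eqxx eq_sym /=; case: (i == j) => /=.
    rewrite mulr1 mulrA mulVf ?gt_eqF // mul1r.
    apply: le_trans (cos_scaled_bound _ (ltW d0)) _; apply: le_trans dL.
    by rewrite ler_pM2l.
  by rewrite mulr0 mul0r mulr0 subrr normr0 ltW.
have prodle : `|\prod_(v <- [seq basis_vec R i | i <- w]) dot xi v| <= 1.
  rewrite big_map; elim: w {sw} => [|i0 w ih]; first by rewrite big_nil normr1.
  rewrite big_cons normrM lb mulr_ile1 // normrM (gtr0_norm d0).
  by case: (i0 == j); rewrite ?normr1 ?normr0 ?mulr1 ?mulr0.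
have bl i0 : `|(i0 == j)%:R : R| <= 1 by case: (i0 == j); rewrite ?normr1 ?normr0.
have gen (b1 b2 P C : R) : `|b1| <= 1 -> `|b2| <= 1 -> `|P| <= 1 -> `|C| <= 1 ->
    `|d^-1 * (d * b1 * (d * b2 * P) * C)| <= d.
  move=> h1 h2 h3 h4.
  have -> : d^-1 * (d * b1 * (d * b2 * P) * C) = d * (b1 * (b2 * (P * C))).
    by field; rewrite gt_eqF.
  by rewrite normrM (gtr0_norm d0) ler_piMr ?(ltW d0) // !normrM !mulr_ile1 // !mulr_ge0.
rewrite (dirs_linear_form (coord_lin j)) sub0r normrN !map_cons !big_cons !lb.
apply: le_trans de; apply: gen => //; exact: cos_max.
Qed.

End CoordinateApproximation.

(** * Bernstein operators in one coordinate *)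

Section Bernstein.
Variables (R : realType) (n : nat) (j : 'I_n) (L : R).
Hypothesis L_gt0 : 0 < L.
Local Notation X := 'rV[R]_n.
Local Notation e_ i := (@basis_vec R n i).
Local Notation W w := (dirs (map (@basis_vec R n) w)).
Implicit Types (f g : X -> R) (x y : X) (c h M : R) (k m r : nat).

Definition put c x : X := \row_i (if i == j then c else x 0 i).

Lemma put_affine c h u x : put c (h *: u + x) = h *: put 0 u + put c x.
Proof. by apply/rowP => i; rewrite !mxE; case: eqP => _; rewrite ?mulr0 ?add0r. Qed.

Lemma put_shift c h x : h *: e_ j + put c x = put (h + c) x.
Proof.
apply/rowP => i; rewrite !mxE eqxx /= ; case: eqP => _ /=; first by rewrite mulr1.
by rewrite mulr0 add0r.
Qed.

Lemma put_id x : put (x 0 j) x = x.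
Proof. by apply/rowP => i; rewrite mxE; case: eqP => // ->. Qed.

Lemma put_basis_neq i : i != j -> put 0 (e_ i) = e_ i.
Proof.
move=> ij; apply/rowP => l; rewrite !mxE; case: eqP => // ->.
by rewrite eq_sym (negPf ij) andbF.
Qed.

Lemma put_basis_eq : put 0 (e_ j) = 0.
Proof. by apply/rowP => l; rewrite !mxE; case: eqP => //= /eqP/negPf ->. Qed.

Lemma put_continuous c : continuous (put c).
Proof.
have -> : put c = fun x => (c - x 0 j) *: e_ j + x.
  apply/funext => x; have := put_shift (x 0 j) (c - x 0 j) x.
  by rewrite put_id subrK => ->.
move=> x.
have c1 : {for x, continuous (fun x : X => x 0 j : R)} := @coord_continuous R 1 n 0 j x.
have c2 : {for x, continuous (fun y : X => c - y 0 j : R)}.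
  exact: (@cvgB _ _ _ (nbhs x) _ (fun=> c) (fun y : X => y 0 j : R) c (x 0 j)
    (cvg_cst _) c1).
have c3 : {for x, continuous (fun y : X => (c - y 0 j) *: e_ j : X)}.
  exact: (@cvgZr_tmp R X X (nbhs x) _ (fun y : X => c - y 0 j) (c - x 0 j) (e_ j) c2).
exact: (@cvgD R X X (nbhs x) _ (fun y : X => (c - y 0 j) *: e_ j) id _ x c3 cvg_id).
Qed.

Lemma rsmooth_put c f : rsmooth f -> rsmooth (fun x => f (put c x)).
Proof. exact: (rsmooth_affine (f := f) (put_affine c) (@put_continuous c)). Qed.

Lemma pd_put_neq c f i : i != j ->
  pd (e_ i) (fun x => f (put c x)) = fun x => pd (e_ i) f (put c x).
Proof.
move=> ij; apply/funext => x.
by rewrite [LHS](derive_affine (put_affine c) f) put_basis_neq.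
Qed.

Lemma pd_put_eq c f : pd (e_ j) (fun x => f (put c x)) = fun=> 0.
Proof.
apply/funext => x.
by rewrite [LHS](derive_affine (put_affine c) f) put_basis_eq pdE derive0.
Qed.

(** The affine parameter (x_j + L) / (2 L), with values in [0, 1] on the cube. *)
Definition weight x : R := (2 * L)^-1 * x 0 j + 2^-1.

Lemma rsmooth_weight : rsmooth weight.
Proof. exact: (rsmoothD (rsmoothZ _ (rsmooth_coord j)) (rsmooth_cst _)). Qed.

Lemma pd_weight i : pd (e_ i) weight = fun=> (i == j)%:R / (2 * L).
Proof.
have s1 := rsmoothZ (2 * L)^-1 (@rsmooth_coord R n j).
rewrite [LHS](@dirsD _ _ [:: e_ i] _ _ s1 (rsmooth_cst _)).
rewrite (@dirsZ _ _ [:: e_ i] _ _ (@rsmooth_coord R n j)) /=.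
rewrite (pd_linear_form (coord_lin j)) pd_cst; apply/funext => x.
by rewrite addr0 mxE eqxx /= eq_sym mulrC.
Qed.

Lemma weight_itv x : cube L x -> 0 <= weight x <= 1.
Proof.
move=> /(_ j); rewrite ler_norml => /andP[h1 h2].
have -> : weight x = (x 0 j + L) / (2 * L) by rewrite /weight; field; rewrite gt_eqF.
rewrite divr_ge0 ?mulr_ge0 ?(ltW L_gt0) //=; last by lra.
by rewrite ler_pdivrMr ?mulr_gt0 //; lra.
Qed.

(* de Casteljau's recursion: the Bernstein operator in the j-th variable, with
   nodes -L, -L + h, ..., -L + k h. *)
Fixpoint casteljau h k f : X -> R :=
  if k is k'.+1 then fun x =>
    (1 - weight x) * casteljau h k' f x +
    weight x * casteljau h k' (fun y => f (h *: e_ j + y)) x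
  else fun x => f (put (- L) x).

Lemma rsmooth_blend f g : rsmooth f -> rsmooth g ->
  rsmooth (fun x => (1 - weight x) * f x + weight x * g x).
Proof.
move=> sf sg; have sw := rsmooth_weight.
exact: (rsmoothD (rsmoothM (rsmoothB (rsmooth_cst 1) sw) sf) (rsmoothM sw sg)).
Qed.

Lemma rsmooth_casteljau h k f : rsmooth f -> rsmooth (casteljau h k f).
Proof.
elim: k f => [|k ih] f sf; first exact: rsmooth_put.
apply: rsmooth_blend; first exact: ih.
by apply: ih; exact: rsmooth_translate.
Qed.

Lemma pd_blend i f g : rsmooth f -> rsmooth g ->
  pd (e_ i) (fun x => (1 - weight x) * f x + weight x * g x) =
  fun x => (1 - weight x) * pd (e_ i) f x + weight x * pd (e_ i) g x
           + (i == j)%:R / (2 * L) * (g x - f x).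
Proof.
move=> sf sg; have sw := rsmooth_weight.
have s1 : rsmooth (fun x => 1 - weight x) := rsmoothB (rsmooth_cst _) sw.
rewrite [LHS](@dirsD _ _ [:: e_ i] _ _ (rsmoothM s1 sf) (rsmoothM sw sg)) /=.
rewrite (deriveM_fun _ s1 sf) (deriveM_fun _ sw sg).
rewrite [pd _ (fun x => 1 - weight x)](@dirsB _ _ [:: e_ i] _ _ (rsmooth_cst _) sw) /=.
rewrite pd_cst pd_weight; apply/funext => x; ring.
Qed.

Lemma casteljauB h k f g : casteljau h k (fun y => f y - g y) =
  fun x => casteljau h k f x - casteljau h k g x.
Proof.
elim: k f g => [//|k ih] f g /=; apply/funext => x.
by rewrite ih (ih (fun y => f (_ + y))); ring.
Qed.

Lemma casteljauZ h k c f : casteljau h k (fun y => c * f y) =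
  fun x => c * casteljau h k f x.
Proof.
elim: k f => [//|k ih] f /=; apply/funext => x.
by rewrite ih (ih (fun y => f (_ + y))); ring.
Qed.

Lemma pd_casteljau_neq h k f i : rsmooth f -> i != j ->
  pd (e_ i) (casteljau h k f) = casteljau h k (pd (e_ i) f).
Proof.
elim: k f => [|k ih] f sf ij; first exact: pd_put_neq.
rewrite /= pd_blend; [|exact: rsmooth_casteljau|]; last first.
  by apply: rsmooth_casteljau; exact: rsmooth_translate.
rewrite (ih _ sf ij) (ih _ (rsmooth_translate _ sf) ij) pd_translate.
by apply/funext => x; rewrite (negPf ij) !mul0r addr0.
Qed.

Definition dquot h f : X -> R := fun y => h^-1 * (f (h *: e_ j + y) - f y).

Lemma rsmooth_dquot h f : rsmooth f -> rsmooth (dquot h f).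
Proof. by move=> sf; exact: (rsmoothZ _ (rsmoothB (rsmooth_translate _ sf) sf)). Qed.

(** The classical derivative formula: one degree less, applied to the difference quotient of f. The
    factor is 1 when the nodes span the whole interval of length 2 L; repeated derivatives lower the
    degree with h fixed, so it has to be kept. *)
Lemma pd_casteljau_eq h k f : h != 0 -> rsmooth f ->
  pd (e_ j) (casteljau h k.+1 f) =
  fun x => (k.+1%:R * h / (2 * L)) * casteljau h k (dquot h f) x.
Proof.
move=> h0; have L2 : 2 * L != 0 by rewrite gt_eqF // mulr_gt0.
have dE k' f' : casteljau h k' (dquot h f') = fun x => h^-1 *
    (casteljau h k' (fun y => f' (h *: e_ j + y)) x - casteljau h k' f' x).
  by rewrite /dquot casteljauZ casteljauB.
elim: k f => [|k ih] f sf.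
  have sT := rsmooth_translate (h *: e_ j) sf.
  rewrite [LHS](pd_blend _ (rsmooth_put (- L) sf) (rsmooth_put (- L) sT)).
  rewrite pd_put_eq (pd_put_eq _ (fun y => f (h *: e_ j + y))) dE eqxx.
  by apply/funext => x /=; field; rewrite h0 gt_eqF.
have sT := rsmooth_translate (h *: e_ j) sf.
rewrite [LHS](pd_blend _ (rsmooth_casteljau h k.+1 sf) (rsmooth_casteljau h k.+1 sT)).
rewrite (ih _ sf) (ih _ sT) eqxx; apply/funext => x.
have -> : casteljau h k (dquot h (fun y => f (h *: e_ j + y))) x =
    h^-1 * (casteljau h k (fun y => f (h *: e_ j + (h *: e_ j + y))) x -
            casteljau h k (fun y => f (h *: e_ j + y)) x) by rewrite dE.
have -> : casteljau h k (dquot h f) x =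
    h^-1 * (casteljau h k (fun y => f (h *: e_ j + y)) x - casteljau h k f x).
  by rewrite dE.
have -> : casteljau h k.+1 (dquot h f) x = h^-1 *
    (casteljau h k.+1 (fun y => f (h *: e_ j + y)) x - casteljau h k.+1 f x) by rewrite dE.
have cE f' : casteljau h k.+1 f' x = (1 - weight x) * casteljau h k f' x +
    weight x * casteljau h k (fun y => f' (h *: e_ j + y)) x by [].
rewrite (cE f) (cE (fun y => f (h *: e_ j + y))).
rewrite -[k.+2%:R]natr1.
move: (casteljau h k f x) (casteljau h k _ x) (casteljau h k _ x) => a b d.
move: (weight x) (k.+1%:R : R) => p q.
by rewrite /=; field; rewrite h0 gt_eqF.
Qed.

(** With weights in [0, 1] the recursion forms a convex combination of values of f at nodes between
    -L and -L + k h. *)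
Lemma casteljau_bound h k f x M : 0 <= weight x <= 1 -> 0 <= h ->
  (forall c, - L <= c <= - L + k%:R * h -> `|f (put c x)| <= M) ->
  `|casteljau h k f x| <= M.
Proof.
move=> /andP[p0 p1] h0.
elim: k f => [|k ih] f H /=; first by apply: H; rewrite lexx mul0r addr0 lexx.
have kh : (k.+1)%:R * h = k%:R * h + h by rewrite -natr1 mulrDl mul1r.
have H1 : `|casteljau h k f x| <= M.
  by apply: ih => c /andP[c0 c1]; apply: H; rewrite c0 kh; lra.
have H2 : `|casteljau h k (fun y => f (h *: e_ j + y)) x| <= M.
  apply: ih => c /andP[c0 c1]; rewrite put_shift; apply: H.
  by rewrite kh; apply/andP; split; lra.
apply: (le_trans (ler_normD _ _)); rewrite !normrM.
rewrite (ger0_norm p0) (ger0_norm (_ : 0 <= 1 - weight x)) ?subr_ge0 //.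
move: (ler_wpM2l p0 H2); have q0 : 0 <= 1 - weight x by rewrite subr_ge0.
move: (ler_wpM2l q0 H1); lra.
Qed.

(** Two mean values turn the error of linear interpolation into p (1 - p) h times a difference of
    first derivatives at points at most h apart. *)
Lemma blend_error f y (p h M : R) : rsmooth f -> 0 <= p <= 1 -> 0 <= h ->
  (forall c, 0 <= c <= h -> `|pd (e_ j) (pd (e_ j) f) (c *: e_ j + y)| <= M) ->
  `|(1 - p) * f y + p * f (h *: e_ j + y) - f ((p * h) *: e_ j + y)| <= h ^+ 2 * M.
Proof.
move=> sf /andP[p0 p1] h0 HM; set y' := (p * h) *: e_ j + y.
have q0 : 0 <= 1 - p by rewrite subr_ge0.
have [a /andP[a0 a1] e1] := mean_value (e_ j) y sf (mulr_ge0 p0 h0).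
have [b /andP[b0 b1] e2] := mean_value (e_ j) y' sf (mulr_ge0 q0 h0).
have e3 : ((1 - p) * h) *: e_ j + y' = h *: e_ j + y.
  by rewrite /y' addrA -scalerDl; congr (_ *: _ + _); ring.
rewrite e3 in e2; rewrite -/y' in e1.
have -> : (1 - p) * f y + p * f (h *: e_ j + y) - f y' =
   p * (1 - p) * h * (pd (e_ j) f (b *: e_ j + y') - pd (e_ j) f (a *: e_ j + y)).
  have -> : f (h *: e_ j + y) = f y' + pd (e_ j) f (b *: e_ j + y') * ((1 - p) * h).
    by rewrite -e2; ring.
  have -> : f y' = f y + pd (e_ j) f (a *: e_ j + y) * (p * h) by rewrite -e1; ring.
  ring.
have bp : b + p * h <= h by lra.
have e4 : b *: e_ j + y' = (b + p * h - a) *: e_ j + (a *: e_ j + y).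
  by rewrite /y' !addrA -!scalerDl; congr (_ *: _ + _); ring.
have M0 : 0 <= M by apply: le_trans (HM 0 _); rewrite ?lexx ?h0.
have d0 : 0 <= b + p * h - a by lra.
have H := @increment_bound _ _ (pd (e_ j) f) (e_ j) (a *: e_ j + y) _ M
  (rsmooth_derive (e_ j) sf) d0.
rewrite -e4 in H.
have {}H : `|pd (e_ j) f (b *: e_ j + y') - pd (e_ j) f (a *: e_ j + y)| <= h * M.
  apply: le_trans (H _) _; last by rewrite ler_wpM2r //; lra.
  move=> c /andP[c0 c1]; rewrite addrA -scalerDl; apply: HM.
  by apply/andP; split; lra.
have pq0 : 0 <= p * (1 - p) by rewrite mulr_ge0.
have pq1 : p * (1 - p) <= 1 by rewrite mulr_ile1 //; lra.
rewrite normrM (ger0_norm (mulr_ge0 pq0 h0)).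
apply: le_trans (ler_wpM2l (mulr_ge0 pq0 h0) H) _.
rewrite mulrA -mulrA -mulrA expr2 -mulrA ler_piMl // mulr_ge0 // mulr_ge0 //.
Qed.

(** Each blending level may be replaced by evaluation at the interpolated point, displaced by h
    [weight x], at a cost of h^2 M. After k levels the point is the barycentre of the nodes, and for
    h of order 1 / k the total cost has order 1 / k. *)
Lemma casteljau_close h k f x M : rsmooth f -> 0 <= weight x <= 1 -> 0 <= h ->
  (forall c, - L <= c <= - L + k%:R * h ->
     `|pd (e_ j) (pd (e_ j) f) (put c x)| <= M) ->
  `|casteljau h k f x - f (put (- L + k%:R * h * weight x) x)| <= k%:R * (h ^+ 2 * M).
Proof.
move=> sf pI h0; have /andP[p0 p1] := pI.
have q0 : 0 <= 1 - weight x by rewrite subr_ge0.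
elim: k f sf => [|k ih] f sf H /=.
  by rewrite !mul0r addr0 subrr normr0.
have kh : (k.+1)%:R * h = k%:R * h + h by rewrite -natr1 mulrDl mul1r.
have k0 : 0 <= k%:R * h by rewrite mulr_ge0.
have kp : k%:R * h * weight x <= k%:R * h by rewrite ler_piMr.
have kp0 : 0 <= k%:R * h * weight x by rewrite mulr_ge0.
have H1 : `|casteljau h k f x - f (put (- L + k%:R * h * weight x) x)|
    <= k%:R * (h ^+ 2 * M).
  by apply: ih => // c /andP[c0 c1]; apply: H; rewrite c0 kh; lra.
have H2 : `|casteljau h k (fun y => f (h *: e_ j + y)) x
    - f (h *: e_ j + put (- L + k%:R * h * weight x) x)| <= k%:R * (h ^+ 2 * M).
  apply: (ih (fun y => f (h *: e_ j + y))); first exact: rsmooth_translate.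
  move=> c /andP[c0 c1]; rewrite !pd_translate put_shift; apply: H.
  by rewrite kh; apply/andP; split; lra.
have H3 : `|(1 - weight x) * f (put (- L + k%:R * h * weight x) x) + weight x *
     f (h *: e_ j + put (- L + k%:R * h * weight x) x) -
     f ((weight x * h) *: e_ j + put (- L + k%:R * h * weight x) x)| <= h ^+ 2 * M.
  apply: blend_error => // c /andP[c0 c1]; rewrite put_shift; apply: H.
  by rewrite kh; apply/andP; split; lra.
rewrite (put_shift _ (weight x * h) _) in H3.
have -> : - L + k.+1%:R * h * weight x = weight x * h + (- L + k%:R * h * weight x).
  by rewrite -natr1; ring.
move: p0 q0 (ler_wpM2l q0 H1) (ler_wpM2l p0 H2) H3.
rewrite -[k.+1%:R]natr1 [(k%:R + 1) * _]mulrDl mul1r.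
move: (f (put (weight x * h + (- L + k%:R * h * weight x)) x))
  (f (put (- L + k%:R * h * weight x) x))
  (f (h *: e_ j + put (- L + k%:R * h * weight x) x)) (casteljau h k f x)
  (casteljau h k (fun y => f (h *: e_ j + y)) x) => a b d u v.
move: (weight x) (k%:R * (h ^+ 2 * M)) (h ^+ 2 * M) => p q s.
move=> {}p0 {}q0 h1 h2 h3.
have -> : (1 - p) * u + p * v - a =
  (1 - p) * (u - b) + (p * (v - d) + ((1 - p) * b + p * d - a)) by ring.
apply: (le_trans (ler_normD _ _)).
apply: (le_trans (lerD (lexx _) (ler_normD _ _))).
by rewrite (normrM (1 - p)) (ger0_norm q0) (normrM p) (ger0_norm p0); lra.
Qed.

End Bernstein.

Section BernsteinConvergence.
Variables (R : realType) (n : nat) (j : 'I_n) (L : R).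
Hypothesis L_gt0 : 0 < L.
Local Notation X := 'rV[R]_n.
Local Notation e_ i := (@basis_vec R n i).
Local Notation W w := (dirs (map (@basis_vec R n) w)).
Local Notation cast := (casteljau j L).
Implicit Types (f g : X -> R) (x y : X) (c h M : R) (k m r : nat) (w : seq 'I_n).

Lemma dirs_translate (V : normedModType R) (vs : seq V) (f : V -> R) (a : V) :
  dirs vs (fun p => f (a + p)) = fun p => dirs vs f (a + p).
Proof. by elim: vs => //= v vs ->; rewrite pd_translate. Qed.

Lemma dirs_cst0 (V : normedModType R) (vs : seq V) : dirs vs (fun=> 0) = fun=> 0 :> R.
Proof. by elim: vs => //= v vs ->; rewrite pd_cst. Qed.

Lemma dirs_dquot w h f : rsmooth f -> W w (dquot j h f) = dquot j h (W w f).
Proof.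
move=> sf; have sT := rsmooth_translate (h *: e_ j) sf.
by rewrite /dquot (dirsZ _ _ (rsmoothB sT sf)) (dirsB _ sT sf) dirs_translate.
Qed.

Lemma cube_put x c : `|c| <= L -> cube L x -> cube L (put j c x).
Proof. by move=> cL cx i; rewrite mxE; case: eqP. Qed.

Lemma cube_step (rho h c : R) y : 0 <= c <= h -> cube rho y -> cube (rho + h) (c *: e_ j + y).
Proof.
move=> /andP[c0 ch] cy; apply: cube_le (cube_shift c j cy).
by rewrite lerD2l ger0_norm.
Qed.

Lemma dquot_bound h f y M : rsmooth f -> 0 < h ->
  (forall c, 0 <= c <= h -> `|pd (e_ j) f (c *: e_ j + y)| <= M) ->
  `|dquot j h f y| <= M.
Proof.
move=> sf h0 H; rewrite /dquot normrM normfV (gtr0_norm h0) ler_pdivrMl //.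
exact: increment_bound sf (ltW h0) H.
Qed.

Lemma dquot_error h f y M : rsmooth f -> 0 < h ->
  (forall c, 0 <= c <= h -> `|pd (e_ j) (pd (e_ j) f) (c *: e_ j + y)| <= M) ->
  `|dquot j h f y - pd (e_ j) f y| <= h * M.
Proof.
move=> sf h0 H; have M0 : 0 <= M.
  by apply: le_trans (H 0 _); rewrite // lexx ltW.
have [c /andP[c0 ch] e] := mean_value (e_ j) y sf (ltW h0).
rewrite /dquot e mulrC mulfK ?gt_eqF //.
have H' d : 0 <= d <= c -> `|pd (e_ j) (pd (e_ j) f) (d *: e_ j + y)| <= M.
  by move=> /andP[d0 dc]; apply: H; rewrite d0 (le_trans dc).
apply: le_trans (increment_bound (rsmooth_derive _ sf) c0 H') _.
by rewrite ler_wpM2r.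
Qed.

(** A derivative along j becomes a difference quotient, hence a derivative of f at a point shifted
    by at most h <= 1: each letter enlarges the cube by at most 1. The factor of [pd_casteljau_eq]
    is at most 1 because k h <= 2 L. *)
Lemma casteljau_words_bound w : forall h k f x M, rsmooth f -> cube L x ->
  0 < h <= 1 -> k%:R * h <= 2 * L ->
  (forall w', (size w' <= size w)%N -> forall y, cube (L + (size w)%:R) y ->
     `|W w' f y| <= M) ->
  `|W w (cast h k f) x| <= M.
Proof.
elim: w => [|i w ih] h k f x M sf cx /andP[h0 h1] kh H.
  rewrite /=; apply: (casteljau_bound (weight_itv j L_gt0 cx) (ltW h0)) => c /andP[c0 c1].
  apply: (H [::] isT); rewrite addr0; apply: cube_put => //.
  by rewrite ler_norml c0 /=; lra.
rewrite /= -(dirs_derive _ _ (rsmooth_casteljau j L h k sf)).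
have M0 : 0 <= M.
  apply: le_trans (H [::] isT x _) => //; apply: cube_le cx.
  by rewrite lerDl.
have [ij|ij] := eqVneq i j; last first.
  rewrite pd_casteljau_neq //; apply: ih => //.
  - exact: rsmooth_derive.
  - by rewrite h0.
  move=> w' sw' y cy; rewrite dirs_derive //; apply: (H (i :: w')) => //.
  by apply: cube_le cy; rewrite lerD2l ler_nat.
rewrite {}ij {i} in H *; case: k kh => [|k] kh.
  by rewrite /= pd_put_eq dirs_cst0 normr0.
rewrite (pd_casteljau_eq j L_gt0) ?gt_eqF //.
have sD := rsmooth_dquot j h sf.
rewrite (dirsZ _ _ (rsmooth_casteljau j L h k sD)) normrM.
have L20 : 0 < 2 * L by rewrite mulr_gt0.
have a0 : 0 <= k.+1%:R * h / (2 * L) by rewrite divr_ge0 ?(ltW L20) // mulr_ge0 // ltW.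
have a1 : k.+1%:R * h / (2 * L) <= 1 by rewrite ler_pdivrMr // mul1r.
rewrite (ger0_norm a0) -[leRHS]mul1r ler_pM //.
apply: ih => //; first by rewrite h0.
  by apply: le_trans kh; rewrite ler_wpM2r ?(ltW h0) // ler_nat.
move=> w' sw' y cy; rewrite dirs_dquot //.
apply: (dquot_bound (rsmooth_dirs _ sf) h0) => c cI.
apply: (H (j :: w')) => //=.
apply: cube_le (cube_step cI cy).
by rewrite -[(size w).+1%:R]natr1 addrA lerD2l.
Qed.

(** The degree is m - r while the step stays 2 L / m, since every derivative along j lowers the
    degree alone; r counts those already taken, and the general r makes the induction on words go
    through. The condition r + size w < m keeps the degree positive, and 2 L <= m makes the step at
    most 1. *)
Lemma casteljau_convergence w : forall f r, rsmooth f -> exists2 C : R, 0 <= C &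
  forall m, (r + size w < m)%N -> 2 * L <= m%:R -> forall x, cube L x ->
    `|W w (cast (2 * L / m%:R) (m - r) f) x - W w f x| <= C / m%:R.
Proof.
have L20 : 0 < 2 * L by rewrite mulr_gt0.
have stepE r m : (r < m)%N -> (m - r)%:R * (2 * L / m%:R) = 2 * L - r%:R * (2 * L / m%:R).
  move=> rm; have m0 : m%:R != 0 :> R by rewrite pnatr_eq0 -lt0n (leq_ltn_trans _ rm).
  by rewrite natrB ?(ltnW rm) //; field.
elim: w => [|i w ih] f r sf.
  have [M1 M10 HM1] := bnd_exists L 2 sf.
  exists (2 * L * (2 * L * M1 + r%:R * M1)).
    by rewrite mulr_ge0 ?(ltW L20) // addr_ge0 // mulr_ge0 // ltW.
  move=> m; rewrite addn0 => rm mL x cx; set h := 2 * L / m%:R.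
  have m0 : 0 < m%:R :> R by rewrite ltr0n (leq_ltn_trans _ rm).
  have h0 : 0 < h by rewrite divr_gt0.
  have pI := weight_itv j L_gt0 cx; have /andP[p0 p1] := pI.
  have kh := stepE r m rm; rewrite -/h in kh.
  have rh : 0 <= r%:R * h by rewrite mulr_ge0 // ltW.
  have inL c : - L <= c <= L -> cube L (put j c x).
    by move=> cI; apply: cube_put; rewrite // ler_norml.
  have E1 : `|cast h (m - r) f x - f (put j (- L + (m - r)%:R * h * weight j L x) x)|
      <= (m - r)%:R * (h ^+ 2 * M1).
    apply: casteljau_close => //; first exact: ltW.
    move=> c /andP[c0 c1]; apply: (HM1 [:: j; j]) => //; apply: inL.
    by rewrite c0 /=; lra.
  set c := - L + _ * weight j L x in E1.
  (* The nodes stop at L - r h, so their barycentre c falls short of x_j by r h [weight j L x];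
     moving from c to x_j costs at most r h times a bound on the first derivative. *)
  have xj : x 0 j = r%:R * h * weight j L x + c.
    by rewrite /c kh /weight; field; rewrite gt_eqF.
  have rhp : 0 <= r%:R * h * weight j L x by rewrite mulr_ge0.
  have rhp1 : r%:R * h * weight j L x <= r%:R * h by rewrite ler_piMr.
  have mrh0 : 0 <= (m - r)%:R * h by rewrite mulr_ge0 // ltW.
  have mrhp : 0 <= (m - r)%:R * h * weight j L x by rewrite mulr_ge0.
  have := cx j; rewrite ler_norml => /andP[xj0 xj1].
  have E2 : `|f x - f (put j c x)| <= r%:R * h * M1.
    have -> : f x = f ((r%:R * h * weight j L x) *: e_ j + put j c x).
      by rewrite put_shift -xj put_id.
    apply: le_trans (increment_bound (M := M1) sf rhp _) _; last first.
      by rewrite ler_wpM2r.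
    move=> d /andP[d0 d1]; rewrite put_shift; apply: (HM1 [:: j]) => //; apply: inL.
    by apply/andP; split; rewrite /c in xj *; lra.
  have -> : cast h (m - r) f x - f x =
      (cast h (m - r) f x - f (put j c x)) - (f x - f (put j c x)) by ring.
  apply: le_trans (ler_normB _ _) _; apply: le_trans (lerD E1 E2) _.
  have -> : 2 * L * (2 * L * M1 + r%:R * M1) / m%:R = 2 * L * (h * M1) + r%:R * h * M1.
    by rewrite /h; field; rewrite gt_eqF.
  rewrite lerD2r expr2 -mulrA mulrA ler_wpM2r ?mulr_ge0 ?(ltW h0) //; lra.
have [ij|ij] := eqVneq i j; last first.
  have [C C0 HC] := ih _ r (rsmooth_derive (e_ i) sf); exists C => // m rm mL x cx.
  rewrite /= -(dirs_derive _ _ (rsmooth_casteljau j L _ _ sf)) -(dirs_derive _ _ sf).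
  by rewrite pd_casteljau_neq //; apply: HC => //; move: rm => /=; lia.
rewrite {}ij {i}.
have sdf := rsmooth_derive (e_ j) sf.
have [C C0 HC] := ih _ r.+1 sdf.
have [M2 M20 HM2] := bnd_exists (L + (size w)%:R + 1) (size w).+2 sf.
exists (C + 2 * L * M2 + r%:R * M2).
  by rewrite !addr_ge0 // mulr_ge0 // ltW.
move=> m /= rwm mL x cx; set h := 2 * L / m%:R.
have rm : (r < m)%N by lia.
have m0 : 0 < m%:R :> R by rewrite ltr0n (leq_ltn_trans _ rm).
have h0 : 0 < h by rewrite divr_gt0.
have h1 : h <= 1 by rewrite ler_pdivrMr // mul1r.
rewrite -(dirs_derive _ _ (rsmooth_casteljau j L _ _ sf)) -(dirs_derive _ _ sf).
have mrS : (m - r = (m - r.+1).+1)%N by rewrite subnSK.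
rewrite mrS (pd_casteljau_eq j L_gt0) ?gt_eqF // -mrS.
have sD := rsmooth_dquot j h sf.
have sDB := rsmoothB sD sdf.
rewrite (dirsZ _ _ (rsmooth_casteljau j L h _ sD)).
have HX : `|W w (cast h (m - r.+1) (pd (e_ j) f)) x - W w (pd (e_ j) f) x| <= C / m%:R.
  by apply: HC => //; lia.
have HY : `|W w (cast h (m - r.+1) (fun y => dquot j h f y - pd (e_ j) f y)) x| <= h * M2.
  apply: casteljau_words_bound => //; first by rewrite h0.
    have -> : 2 * L = m%:R * h by rewrite /h; field; rewrite gt_eqF.
    by rewrite ler_wpM2r ?(ltW h0) // ler_nat leq_subr.
  move=> w' sw' y cy; rewrite (dirsB _ sD sdf) dirs_dquot // dirs_derive //.
  apply: (dquot_error (rsmooth_dirs _ sf) h0) => c cI.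
  apply: (HM2 [:: j, j & w']) => //; apply: cube_le (cube_step cI cy).
  by rewrite lerD2l.
have HG : `|W w (pd (e_ j) f) x| <= M2.
  rewrite dirs_derive //; apply: (HM2 (j :: w)) => //; apply: cube_le cx.
  by rewrite -addrA lerDl addr_ge0.
move: HY; rewrite casteljauB (dirsB _ (rsmooth_casteljau j L h _ sD)
  (rsmooth_casteljau j L h _ sdf)) => HY.
have -> : (m - r)%:R * h / (2 * L) = 1 - r%:R / m%:R.
  by rewrite stepE // /h; field; rewrite !gt_eqF.
have a0 : 0 <= r%:R / m%:R :> R by rewrite divr_ge0.
have a1 : r%:R / m%:R <= 1 :> R by rewrite ler_pdivrMr // mul1r ler_nat ltnW.
have hM : h * M2 = 2 * L * M2 / m%:R by rewrite /h; ring.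
have -> : (C + 2 * L * M2 + r%:R * M2) / m%:R = C / m%:R + h * M2 + r%:R / m%:R * M2.
  by rewrite hM; ring.
move: HX HY HG a0 a1.
move: (W w (cast h _ (pd _ f)) x) (W w (cast h _ (dquot _ _ _)) x) (W w (pd _ f) x)
  (r%:R / m%:R) (C / _) (h * M2) => p q g a A B; clear => HX HY HG a0 a1.
(* Three errors of order 1 / m: the induction hypothesis, the replacement of the derivative by a
   difference quotient, and the factor 1 - r / m in place of 1. *)
have -> : (1 - a) * q - g = (1 - a) * (p - g) + ((1 - a) * (q - p) - a * g) by ring.
apply: le_trans (ler_normD _ _) _; apply: le_trans (lerD (lexx _) (ler_normB _ _)) _.
have b0 : 0 <= 1 - a by rewrite subr_ge0.
have b1 : 1 - a <= 1 by rewrite gerBl.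
rewrite !normrM (ger0_norm a0) (ger0_norm b0) -addrA; apply: lerD.
  by apply: le_trans (ler_piMl _ b1) _.
apply: lerD; first by apply: le_trans (ler_piMl _ b1) _.
by rewrite ler_wpM2l.
Qed.

End BernsteinConvergence.

(** * Density, one coordinate at a time *)

Section Density.
Variables (R : realType) (n : nat) (L : R).
Hypothesis L_gt0 : 0 < L.
Local Notation X := 'rV[R]_n.
Implicit Types (f : X -> R) (x y : X) (j : 'I_n).

Lemma approx_weight j : approx L (weight j L : X -> R).
Proof.
have L0 := ltW L_gt0; have sc := @rsmooth_coord R n j.
have s1 : rsmooth (fun=> (2 * L)^-1 : R) := rsmooth_cst (V := X) _.
apply: (approxD (rsmoothM s1 sc) (rsmooth_cst _)); last exact: approx_cst.
by apply: approxM => //; [exact: approx_cst | exact: approx_coord].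
Qed.

Lemma approx_onem_weight j : approx L (fun x : X => 1 - weight j L x).
Proof.
have L0 := ltW L_gt0; have sw := @rsmooth_weight R n j L.
have -> : (fun x : X => 1 - weight j L x) = fun x => 1 + -1 * weight j L x.
  by apply/funext => x; rewrite mulN1r.
apply: (approxD (rsmooth_cst 1) (rsmoothM (rsmooth_cst (-1)) sw)).
  exact: approx_cst.
apply: (approxM L0 (rsmooth_cst (-1)) sw); first exact: approx_cst.
exact: approx_weight.
Qed.

(** Unfolded, the operator is a combination of sections of f at fixed values of x_j, with
    coefficients that are polynomials in [weight]; approximable functions are stable under such
    combinations. *)
Lemma approx_casteljau j h k f : rsmooth f ->
  (forall c, approx L (fun x => f (put j c x))) -> approx L (casteljau j L h k f).
Proof.
have L0 := ltW L_gt0; have sw := @rsmooth_weight R n j L.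
have sw1 : rsmooth (fun x : X => 1 - weight j L x) := rsmoothB (rsmooth_cst 1) sw.
elim: k f => [|k ih] f sf Hf; first exact: Hf.
have sT := rsmooth_translate (h *: basis_vec R j) sf.
have s1 := rsmooth_casteljau j L h k sf; have s2 := rsmooth_casteljau j L h k sT.
apply: (approxD (rsmoothM sw1 s1) (rsmoothM sw s2)).
  by apply: (approxM L0 sw1 s1); [exact: approx_onem_weight | exact: ih].
apply: (approxM L0 sw s2); first exact: approx_weight.
apply: ih => // c.
have -> : (fun x => f (h *: basis_vec R j + put j c x)) = fun x => f (put j (h + c) x).
  by apply/funext => x; rewrite put_shift.
exact: Hf.
Qed.

Lemma approx_of_sections j f : rsmooth f ->
  (forall c, approx L (fun x => f (put j c x))) -> approx L f.
Proof.
move=> sf Hf; apply: approx_lim => // N e e0.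
(* Words of length at most N form a finite type, so the sum of their constants gives one m valid for
   all derivatives. *)
have /fin_all_exists[C HC] : forall w : N.-bseq 'I_n, exists C : R, 0 <= C /\
    forall m, (0 + size w < m)%N -> 2 * L <= m%:R -> forall x, cube L x ->
    `|dirs (map (@basis_vec R n) w) (casteljau j L (2 * L / m%:R) (m - 0) f) x
      - dirs (map (@basis_vec R n) w) f x| <= C / m%:R.
  by move=> w; have [C C0 H] := casteljau_convergence j L_gt0 w 0 sf; exists C.
pose S := \sum_w C w.
have S0 : 0 <= S by rewrite sumr_ge0 // => w _; have [] := HC w.
have Se : 0 <= S / e by rewrite divr_ge0 // ltW.
pose m := (N.+1 + Num.bound (2 * L) + Num.bound (S / e))%N.
have mL : 2 * L <= m%:R.
  have L2 : 0 <= 2 * L by rewrite mulr_ge0 // ltW.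
  by apply: le_trans (ltW (archi_boundP L2)) _; rewrite ler_nat /m; lia.
have mS : S / m%:R <= e.
  have m0 : 0 < m%:R :> R by rewrite ltr0n.
  rewrite ler_pdivrMr // mulrC -ler_pdivrMr //.
  by apply: le_trans (ltW (archi_boundP Se)) _; rewrite ler_nat /m; lia.
have sc := rsmooth_casteljau j L (2 * L / m%:R) m sf.
exists (casteljau j L (2 * L / m%:R) m f); split=> //.
  exact: approx_casteljau.
move=> w sw x cx; rewrite (dirsB _ sf sc) distrC.
have [Cw0] := HC (Bseq sw); move=> /(_ m); rewrite subn0 => H.
apply: le_trans (H _ mL x cx) _; first by rewrite /m /=; lia.
apply: le_trans mS; rewrite ler_wpM2r ?invr_ge0 // /S (bigD1 (Bseq sw)) //= lerDl.
by rewrite sumr_ge0 // => w' _; have [] := HC w'.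
Qed.

(* Each step makes a function of k + 1 coordinates a limit of combinations of its
   sections, which depend on k coordinates only. *)
Lemma approx_of_dependence k f : (k <= n)%N -> rsmooth f ->
  (forall x y, (forall i : 'I_n, (i < k)%N -> x 0 i = y 0 i) -> f x = f y) ->
  approx L f.
Proof.
elim: k f => [|k ih] f kn sf Hf.
  have -> : f = fun=> f 0 by apply/funext => x; apply: Hf.
  exact: approx_cst.
apply: (@approx_of_sections (Ordinal kn)) => // c.
apply: ih; [exact: ltnW | exact: rsmooth_put |].
move=> x y xy; apply: Hf => i ik; rewrite !mxE; case: eqP => // ij.
apply: xy; rewrite ltn_neqAle -ltnS ik andbT.
by apply/negP => /eqP e; apply: ij; exact/val_inj.
Qed.

Lemma approx_pos f : rsmooth f -> approx L f.
Proof.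
move=> sf; apply: (@approx_of_dependence n) => // x y xy; congr f.
by apply/rowP => i; exact: xy.
Qed.

End Density.

Lemma trig_density (R : realType) (n : nat) (L : R) (f : 'rV[R]_n -> R) :
  rsmooth f -> approx L f.
Proof.
move=> sf N e e0; have L0 : 0 < `|L| + 1 by rewrite ltr_wpDl.
have [p Hp] := approx_pos L0 sf N e0; exists p => w sw x cx.
by apply: Hp => //; apply: cube_le cx; rewrite (le_trans (ler_norm L)) // lerDl.
Qed.

(** * The cosine propagator *)

Section PlaneWaves.
Variables (R : realType) (n : nat).
Local Notation X := 'rV[R]_n.
Local Notation V := ('rV[R]_n * R)%type.
Implicit Types (v w : V -> R) (xi x : X) (p : seq (R * X * R)).

Definition phase xi (s : R) (z : V) : R := dot xi z.1 + s * z.2.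

Lemma phase_lin xi s (h : R) (u z : V) :
  phase xi s (h *: u + z) = h * phase xi s u + phase xi s z.
Proof.
have -> : phase xi s (h *: u + z) = dot xi (h *: u.1 + z.1) + s * (h * u.2 + z.2) by [].
by rewrite dot_lin /phase; ring.
Qed.

Lemma phase_continuous xi s : continuous (phase xi s).
Proof.
move=> z.
have c1 : {for z, continuous (fun z : V => dot xi z.1)}.
  by apply: continuous_comp; [exact: cvg_fst | exact: dot_continuous].
have c2 : {for z, continuous (fun z : V => s * z.2)}.
  exact: (@cvgM R _ (nbhs z) _ (fun=> s) (fun z : V => z.2) s z.2 (cvg_cst _) cvg_snd).
exact: (@cvgD R _ _ (nbhs z) _ (fun z : V => dot xi z.1) (fun z : V => s * z.2) _ _ c1 c2).
Qed.

Definition ridge xi s th (z : V) : R := cos (phase xi s z + th).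

Lemma rsmooth_ridge xi s th : rsmooth (ridge xi s th).
Proof. exact: (rsmooth_ridge_cos (phase_lin xi s) (@phase_continuous xi s)). Qed.

Lemma pd2_ridge xi s th u z :
  pd u (pd u (ridge xi s th)) z = - phase xi s u ^+ 2 * ridge xi s th z.
Proof.
have := dirs_ridge_cos (phase_lin xi s) (@phase_continuous xi s) [:: u; u] th.
move=> /(congr1 (fun f => f z)); rewrite /= => ->.
rewrite !big_cons big_nil mulr1 /ridge expr2.
have -> : phase xi s z + (th + 2%:R * (pi / 2)) = phase xi s z + th + pi by field.
by rewrite cosDpi; ring.
Qed.

Lemma sum_coord_sq xi : \sum_i xi 0 i ^+ 2 = eucl_norm xi ^+ 2.
Proof.
have d0 : 0 <= dot xi xi by rewrite sumr_ge0 // => i _; rewrite -expr2 sqr_ge0.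
by rewrite /eucl_norm sqr_sqrtr //; apply: eq_bigr => i _; rewrite expr2.
Qed.

Lemma dot_basis xi i : dot xi (basis_vec R i) = xi 0 i.
Proof.
rewrite /dot (bigD1 i) //= big1 ?addr0 => [|k /negPf ki].
  by rewrite mxE !eqxx mulr1.
by rewrite mxE ki andbF mulr0.
Qed.

Lemma dot0r xi : dot xi 0 = 0.
Proof. by rewrite /dot big1 // => i _; rewrite mxE mulr0. Qed.

Lemma ridge_wave_eq xi s th : s ^+ 2 = eucl_norm xi ^+ 2 -> wave_eq (ridge xi s th).
Proof.
move=> hs z; rewrite pd2_ridge; under eq_bigr do rewrite pd2_ridge.
rewrite -mulr_suml; congr (_ * _).
rewrite sumrN /phase /= dot0r add0r mulr1 hs -sum_coord_sq; congr (- _).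
by apply: eq_bigr => i _; rewrite mulr0 addr0 dot_basis.
Qed.

Lemma wave_eqD v w : rsmooth v -> rsmooth w -> wave_eq v -> wave_eq w ->
  wave_eq (fun z => v z + w z).
Proof.
move=> sv sw wv ww z.
have E u : pd u (pd u (fun z => v z + w z)) z = pd u (pd u v) z + pd u (pd u w) z.
  exact: (congr1 (fun f : V -> R => f z) (dirsD [:: u; u] sv sw)).
by rewrite E; under eq_bigr do rewrite E; rewrite big_split wv ww.
Qed.

Lemma wave_eqZ c v : rsmooth v -> wave_eq v -> wave_eq (fun z => c * v z).
Proof.
move=> sv wv z.
have E u : pd u (pd u (fun z => c * v z)) z = c * pd u (pd u v) z.
  exact: (congr1 (fun f : V -> R => f z) (dirsZ [:: u; u] c sv)).
by rewrite E; under eq_bigr do rewrite E; rewrite -mulr_sumr wv.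
Qed.

Lemma even_waveD v w : even_wave v -> even_wave w -> even_wave (fun z => v z + w z).
Proof.
move=> [sv wv ev] [sw ww ew]; split; first exact: rsmoothD.
  exact: wave_eqD.
by move=> x t; rewrite ev ew.
Qed.

Lemma even_waveZ c v : even_wave v -> even_wave (fun z => c * v z).
Proof.
move=> [sv wv ev]; split; first exact: rsmoothZ.
  exact: wave_eqZ.
by move=> x t; rewrite ev.
Qed.

Lemma even_waveB v w : even_wave v -> even_wave w -> even_wave (fun z => v z - w z).
Proof.
move=> ev ew; have := even_waveD ev (even_waveZ (-1) ew).
by congr even_wave; apply/funext => z; rewrite mulN1r.
Qed.

(** This is cos (t |xi|) cos (xi . x + th), written as the mean of two travelling ridges so that
    smoothness and the wave equation come from [ridge]; exchanging the two is time reversal. *)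
Definition standing xi th (z : V) : R :=
  2^-1 * (ridge xi (eucl_norm xi) th z + ridge xi (- eucl_norm xi) th z).

Lemma standing_even_wave xi th : even_wave (standing xi th).
Proof.
have s1 := rsmooth_ridge xi (eucl_norm xi) th.
have s2 := rsmooth_ridge xi (- eucl_norm xi) th.
have sD := rsmoothD s1 s2.
split; first exact: rsmoothZ.
  apply: wave_eqZ => //; apply: wave_eqD => //; apply: ridge_wave_eq => //.
  by rewrite sqrrN.
by move=> x t; rewrite /standing /ridge /phase /= !mulNr !mulrN opprK addrC.
Qed.

Lemma standingE xi th x t :
  standing xi th (x, t) = cos (t * eucl_norm xi) * cos (dot xi x + th).
Proof.
rewrite /standing /ridge /phase /=.
have -> : dot xi x + eucl_norm xi * t + th = (dot xi x + th) + t * eucl_norm xi by ring.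
have -> : dot xi x + - eucl_norm xi * t + th = (dot xi x + th) - t * eucl_norm xi by ring.
by rewrite cosD cosB; field.
Qed.

Fixpoint twave p : V -> R :=
  if p is q :: p' then fun z => q.1.1 * standing q.1.2 q.2 z + twave p' z else fun=> 0.

Lemma twave_even_wave p : even_wave (twave p).
Proof.
elim: p => [|q p ih].
  by have := even_waveZ 0 (standing_even_wave 0 0);
    congr even_wave; apply/funext => z; rewrite mul0r.
exact: (even_waveD (even_waveZ _ (standing_even_wave _ _)) ih).
Qed.

Lemma twave_slice p x : twave p (x, 0) = tpoly p x.
Proof.
elim: p => [|q p ih]; first by rewrite /tpoly big_nil.
by rewrite /= ih standingE mul0r cos0 mul1r /tpoly big_cons.
Qed.

End PlaneWaves.

(** * Extension by density *)

Section Propagator.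
Variables (R : realType) (n : nat).
Hypothesis n_gt0 : (0 < n)%N.
Local Notation X := 'rV[R]_n.
Local Notation V := ('rV[R]_n * R)%type.

(** All properties of T follow from [Tclose]: linearity by approximating both arguments, the bound
    from the empty polynomial, and the value on an even wave v from a polynomial close to v (., 0),
    whose even extension stays close to v at (0, t) by the a priori estimate. *)
Lemma propagator_exists (t : R) : exists T : (X -> R) -> R, exists C L : R,
  [/\ 0 <= C, 0 <= L,
      forall c f g, rsmooth f -> rsmooth g ->
        T (fun x => c * f x + g x) = c * T f + T g,
      forall f M, rsmooth f -> 0 <= M -> bnd L n f M -> `|T f| <= C * M &
      forall v : V -> R, even_wave v -> T (fun x => v (x, 0)) = v (0, t)].
Proof.
have [C [L [C0 L0 apri]]] := @a_priori R n n_gt0 t.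
pose close (f : X -> R) p (M : R) := 0 <= M /\ bnd L n (fun x => f x - tpoly p x) M.
(* A polynomial within M of f confines the value at f to an interval of radius C M. By [cross], no
   lower end exceeds an upper end, so the supremum of the lower ends lies in all these intervals. *)
pose S f := [set r | exists p M, close f p M /\ r = twave p (0, t) - C * M].
pose T f := sup (S f).
have cross f p q M N : rsmooth f -> close f p M -> close f q N ->
    twave p (0, t) - C * M <= twave q (0, t) + C * N.
  move=> sf [M0 HM] [N0 HN].
  have ev := even_waveB (twave_even_wave p) (twave_even_wave q).
  have sp := rsmoothB sf (rsmooth_tpoly p); have sq := rsmoothB sf (rsmooth_tpoly q).
  have := apri _ ev (M + N) (addr_ge0 M0 N0).
  have -> : (fun x => twave p (x, 0) - twave q (x, 0)) =
      fun x => -1 * (f x - tpoly p x) + (f x - tpoly q x).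
    by apply/funext => x; rewrite !twave_slice; ring.
  have HMN := bndD (rsmoothZ (-1) sp) sq (bndZ (-1) sp HM) HN.
  rewrite normrN normr1 mul1r in HMN; move=> /(_ HMN).
  by rewrite ler_norml => /andP[_]; rewrite mulrDr; lra.
have Tclose f p M : rsmooth f -> close f p M -> `|T f - twave p (0, t)| <= C * M.
  move=> sf cl.
  have inS : S f (twave p (0, t) - C * M) by exists p, M.
  have ub : ubound (S f) (twave p (0, t) + C * M).
    by move=> _ [q [N [cq ->]]]; exact: (cross f).
  have h1 : twave p (0, t) - C * M <= T f.
    by apply: ub_le_sup inS; exists (twave p (0, t) + C * M).
  have h2 : T f <= twave p (0, t) + C * M.
    by apply: ge_sup => //; exists (twave p (0, t) - C * M).
  by rewrite ler_distl; apply/andP; split; lra.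
have small (a b D : R) : 0 <= D -> (forall e, 0 < e -> `|a - b| <= D * e) -> a = b.
  move=> D0 H; apply/eqP; rewrite -subr_eq0 -normr_eq0; apply/eqP/le_anti.
  rewrite normr_ge0 andbT; apply/ler_addgt0Pl => e e0; rewrite addr0.
  have D1 : 0 < D + 1 by rewrite ltr_wpDl.
  apply: le_trans (H (e / (D + 1)) _) _; first by rewrite divr_gt0.
  by rewrite mulrA ler_pdivrMr // mulrC ler_pM2l //; lra.
exists T, C, L; split=> //.
- move=> c f g sf sg; have sZ := rsmoothZ c sf; have sh := rsmoothD sZ sg.
  apply: (small _ _ (2 * C * (`|c| + 1))).
    by rewrite !mulr_ge0 // addr_ge0.
  move=> e e0; have [p Hp] := trig_density L sf n e0; have [q Hq] := trig_density L sg n e0.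
  have {}Hp : close f p e by split; [exact: ltW | exact: Hp].
  have {}Hq : close g q e by split; [exact: ltW | exact: Hq].
  pose r := [seq (c * y.1.1, y.1.2, y.2) | y <- p] ++ q.
  have rE z : twave r z = c * twave p z + twave q z.
    rewrite /r; elim: (p) => [|y p' ih] /=; first by rewrite mulr0 add0r.
    by rewrite ih; ring.
  have Hr : close (fun x => c * f x + g x) r (`|c| * e + e).
    split; first by rewrite addr_ge0 ?mulr_ge0 // ltW.
    have sp := rsmoothB sf (rsmooth_tpoly p); have sq := rsmoothB sg (rsmooth_tpoly q).
    have := bndD (rsmoothZ c sp) sq (bndZ c sp Hp.2) Hq.2.
    by congr (bnd _ _ _ _); apply/funext => x; rewrite /r tpoly_cat tpoly_scale; ring.
  have := Tclose _ _ _ sf Hp; have := Tclose _ _ _ sg Hq.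
  have := Tclose _ _ _ sh Hr; rewrite rE.
  move: (T _) (T f) (T g) (twave p _) (twave q _) => a1 a2 a3 b1 b2 h1 h2 h3.
  have -> : a1 - (c * a2 + a3) =
     (a1 - (c * b1 + b2)) - (c * (a2 - b1) + (a3 - b2)) by ring.
  apply: le_trans (ler_normB _ _) _; apply: le_trans (lerD h1 (ler_normD _ _)) _.
  have := ler_wpM2l (normr_ge0 c) h3; rewrite -normrM; lra.
- move=> f M sf M0 HM.
  have := Tclose f [::] M sf; rewrite /= subr0; apply; split=> //.
  have -> // : (fun x => f x - tpoly [::] x) = f.
  by apply/funext => x; rewrite /tpoly big_nil subr0.
- move=> v ev; have [sv _ _] := ev; have sv0 := rsmooth_slice 0 sv.
  apply: (small _ _ (2 * C)); first by rewrite mulr_ge0.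
  move=> e e0; have [p Hp] := trig_density L sv0 n e0.
  have h1 := Tclose _ p e sv0 (conj (ltW e0) Hp).
  have h2 : `|v (0, t) - twave p (0, t)| <= C * e.
    apply: (apri _ (even_waveB ev (twave_even_wave p)) e (ltW e0)).
    move: Hp; congr (bnd _ _ _ _); apply/funext => x; by rewrite twave_slice.
  move: (T _) (v _) (twave p _) h1 h2 => a b d h1 h2.
  by apply: le_trans (ler_distD d a b) _; rewrite (distrC d); lra.
Qed.

End Propagator.

Local Open Scope complex_scope.

(** * Compactly supported distributions *)

Section ComplexSmooth.
Variables (R : realType) (V : normedModType R).
Implicit Types (phi psi : V -> R[i]) (f : V -> R).

Lemma Re_Dirs vs phi x :
  complex.Re (Dirs vs phi x) = dirs vs (fun y => complex.Re (phi y)) x.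
Proof.
elim: vs x => [//|v vs ih] x; rewrite /= pdE.
by congr ('D_v _ x); apply/funext => y; exact: ih.
Qed.

Lemma Im_Dirs vs phi x :
  complex.Im (Dirs vs phi x) = dirs vs (fun y => complex.Im (phi y)) x.
Proof.
elim: vs x => [//|v vs ih] x; rewrite /= pdE.
by congr ('D_v _ x); apply/funext => y; exact: ih.
Qed.

Lemma smoothP phi : smooth phi <->
  rsmooth (fun x => complex.Re (phi x)) /\ rsmooth (fun x => complex.Im (phi x)).
Proof.
have eR vs : (fun x => complex.Re (Dirs vs phi x)) = dirs vs (fun x => complex.Re (phi x)).
  by apply/funext => x; exact: Re_Dirs.
have eI vs : (fun x => complex.Im (Dirs vs phi x)) = dirs vs (fun x => complex.Im (phi x)).
  by apply/funext => x; exact: Im_Dirs.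
split=> [H|[HR HI] vs /=].
  split=> vs; have := H vs; rewrite /= eR eI => -[c1 c2 h1 h2].
    exact: (conj c1 h1).
  exact: (conj c2 h2).
rewrite eR eI; have [c1 h1] := HR vs; have [c2 h2] := HI vs.
exact: And4 c1 c2 h1 h2.
Qed.

Lemma smooth_real f : rsmooth f -> smooth (fun x => (f x)%:C).
Proof. by move=> sf; apply/smoothP; exact: (conj sf (rsmooth_cst (0 : R))). Qed.

Lemma smooth_lin c phi psi : smooth phi -> smooth psi ->
  smooth (fun x => c * phi x + psi x).
Proof.
move=> /smoothP[s1 s2] /smoothP[s3 s4]; apply/smoothP; case: c => a b; split.
  have -> : (fun x => complex.Re ((a +i* b) * phi x + psi x)) = fun x =>
     (a * complex.Re (phi x) - b * complex.Im (phi x)) + complex.Re (psi x).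
    by apply/funext => x; case: (phi x) (psi x) => u v [u' v'].
  exact: (rsmoothD (rsmoothB (rsmoothZ a s1) (rsmoothZ b s2)) s3).
have -> : (fun x => complex.Im ((a +i* b) * phi x + psi x)) = fun x =>
   (a * complex.Im (phi x) + b * complex.Re (phi x)) + complex.Im (psi x).
  by apply/funext => x; case: (phi x) (psi x) => u v [u' v'].
exact: (rsmoothD (rsmoothD (rsmoothZ a s2) (rsmoothZ b s1)) s4).
Qed.

End ComplexSmooth.

Section NormcBounds.
Variable R : realType.
Local Notation normc := ComplexField.Normc.normc.
Implicit Types z : R[i].

Lemma normc_le_sum z : normc z <= `|complex.Re z| + `|complex.Im z|.
Proof.
case: z => a b /=; rewrite -[leRHS]ger0_norm ?addr_ge0 // -sqrtr_sqr ler_wsqrtr //.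
rewrite sqrrD !real_normK ?num_real //.
have : 0 <= `|a| * `|b| *+ 2 by rewrite mulrn_wge0 // mulr_ge0.
by lra.
Qed.

Lemma Re_le_normc z : `|complex.Re z| <= normc z.
Proof.
by case: z => a b /=; rewrite -sqrtr_sqr ler_wsqrtr // lerDl sqr_ge0.
Qed.

Lemma Im_le_normc z : `|complex.Im z| <= normc z.
Proof.
by case: z => a b /=; rewrite -sqrtr_sqr ler_wsqrtr // lerDr sqr_ge0.
Qed.

Lemma normc_ge0 z : 0 <= normc z.
Proof. exact: le_trans (normr_ge0 _) (Re_le_normc z). Qed.

End NormcBounds.

Section RealDistributions.
Variables (R : realType) (n : nat).
Local Notation X := 'rV[R]_n.
Local Notation normc := ComplexField.Normc.normc.
Implicit Types (T : (X -> R) -> R) (phi : X -> R[i]) (K : set X).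

Definition real_distribution T : Prop :=
  (forall c f g, rsmooth f -> rsmooth g ->
     T (fun x => c * f x + g x) = c * T f + T g) /\
  exists C L : R, exists N : nat, [/\ 0 <= C, 0 <= L &
    forall f M, rsmooth f -> 0 <= M -> bnd L N f M -> `|T f| <= C * M].

Definition complexify T : functional R n := fun phi =>
  T (fun x => complex.Re (phi x)) +i* T (fun x => complex.Im (phi x)).

Lemma seminorm_ub K N phi (w : seq 'I_n) x : smooth phi -> compact K ->
  (size w <= N)%N -> K x ->
  normc (Dirs [seq basis_vec R i | i <- w] phi x) <= seminorm K N phi.
Proof.
move=> /smoothP[sr si] cK sw Kx; apply: ub_le_sup; last by exists w, x.
have [A A0 HA] := words_bounded (@basis_vec R n) N cK sr.
have [B B0 HB] := words_bounded (@basis_vec R n) N cK si.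
exists (A + B) => _ [w' [y [sw' Ky ->]]].
apply: le_trans (normc_le_sum _) _; rewrite Re_Dirs Im_Dirs.
by apply: lerD; [exact: HA | exact: HB].
Qed.

Lemma seminorm_le K N phi B : 0 <= B ->
  (forall (w : seq 'I_n) x, (size w <= N)%N -> K x ->
     normc (Dirs [seq basis_vec R i | i <- w] phi x) <= B) ->
  seminorm K N phi <= B.
Proof.
move=> B0 H; rewrite /seminorm; set S := (X in sup X).
(* For empty K the supremum is 0 by default, and 0 <= B takes care of it. *)
have [->|/set0P[r Sr]] := eqVneq S set0; first by rewrite sup0.
apply: ge_sup; first by exists r.
by move=> _ [w [x [sw Kx ->]]]; exact: H.
Qed.

Lemma complexify_distribution T : real_distribution T ->
  compactly_supported_distribution (complexify T).
Proof.
move=> [lin [C [L [N [C0 L0 bd]]]]]; split.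
  case=> a b phi psi /smoothP[s1 s2] /smoothP[s3 s4]; rewrite /complexify.
  have -> : (fun x => complex.Re ((a +i* b) * phi x + psi x)) = fun x =>
     a * complex.Re (phi x) + (- b * complex.Im (phi x) + complex.Re (psi x)).
    by apply/funext => x; case: (phi x) (psi x) => u v [u' v'] /=; ring.
  have -> : (fun x => complex.Im ((a +i* b) * phi x + psi x)) = fun x =>
     a * complex.Im (phi x) + (b * complex.Re (phi x) + complex.Im (psi x)).
    by apply/funext => x; case: (phi x) (psi x) => u v [u' v'] /=; ring.
  rewrite (lin a _ _ s1 (rsmoothD (rsmoothZ (- b) s2) s3)) (lin (- b) _ _ s2 s3).
  rewrite (lin a _ _ s2 (rsmoothD (rsmoothZ b s1) s4)) (lin b _ _ s1 s4).
  by apply/eqP; rewrite eq_complex /=; apply/andP; split; apply/eqP; ring.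
exists (cube L), N, (2 * C); split; first exact: cube_compact.
move=> phi sphi; have /smoothP[sr si] := sphi.
set M := seminorm _ _ _.
have ub w x (sw : (size w <= N)%N) (cx : cube L x) := seminorm_ub sphi (@cube_compact R n L) sw cx.
have M0 : 0 <= M.
  apply: le_trans (normc_ge0 _) (ub [::] 0 isT _).
  by move=> i; rewrite mxE normr0.
have br : bnd L N (fun x => complex.Re (phi x)) M.
  move=> w sw x cx; rewrite -Re_Dirs; exact: le_trans (Re_le_normc _) (ub w x sw cx).
have bi : bnd L N (fun x => complex.Im (phi x)) M.
  move=> w sw x cx; rewrite -Im_Dirs; exact: le_trans (Im_le_normc _) (ub w x sw cx).
apply: le_trans (normc_le_sum _) _ => /=.
by have := bd _ _ sr M0 br; have := bd _ _ si M0 bi; lra.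
Qed.

Lemma bnd_antimono L L' N N' (f : X -> R) B : L <= L' -> (N <= N')%N ->
  bnd L' N' f B -> bnd L N f B.
Proof.
move=> LL NN H w sw x cx; apply: H; first exact: leq_trans NN.
exact: cube_le cx.
Qed.

Lemma real_distribution0 : real_distribution (fun=> 0).
Proof.
split; first by move=> c f g _ _; rewrite mulr0 addr0.
by exists 0, 0, 0%N; split=> // f M _ _ _; rewrite normr0 mul0r.
Qed.

Lemma real_distributionD T1 T2 : real_distribution T1 -> real_distribution T2 ->
  real_distribution (fun f => T1 f + T2 f).
Proof.
move=> [l1 [C1 [L1 [N1 [C10 L10 b1]]]]] [l2 [C2 [L2 [N2 [C20 L20 b2]]]]]; split.
  by move=> c f g sf sg; rewrite l1 // l2 //; ring.
exists (C1 + C2), (L1 + L2), (N1 + N2)%N; split; rewrite ?addr_ge0 //.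
move=> f M sf M0 H; apply: le_trans (ler_normD _ _) _; rewrite mulrDl.
apply: lerD; [apply: b1 | apply: b2] => //; apply: bnd_antimono H;
  by rewrite ?lerDl ?lerDr ?leq_addr ?leq_addl.
Qed.

Lemma real_distributionN T : real_distribution T -> real_distribution (fun f => - T f).
Proof.
move=> [l [C [L [N [C0 L0 b]]]]]; split.
  by move=> c f g sf sg; rewrite l //; ring.
by exists C, L, N; split=> // f M sf M0 H; rewrite normrN; exact: b.
Qed.

Lemma real_distribution_sum (I : Type) (r : seq I) (T : I -> (X -> R) -> R) :
  (forall i, real_distribution (T i)) ->
  real_distribution (fun f => \sum_(i <- r) T i f).
Proof.
move=> H; elim: r => [|i r ih].
  have -> : (fun f => \sum_(i <- [::]) T i f) = fun=> 0.
    by apply/funext => f; rewrite big_nil.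
  exact: real_distribution0.
have -> : (fun f => \sum_(k <- i :: r) T k f) = fun f => T i f + \sum_(k <- r) T k f.
  by apply/funext => f; rewrite big_cons.
exact: real_distributionD.
Qed.

End RealDistributions.

(** * The Fourier transform determines the distribution *)

Section FourierUniqueness.
Variables (R : realType) (n : nat).
Local Notation X := 'rV[R]_n.
Local Notation normc := ComplexField.Normc.normc.
Implicit Types (T : functional R n).

Lemma smooth_expi (xi : X) : smooth (fun x => expi (- dot xi x)).
Proof.
apply/smoothP; split=> /=.
  have -> : (fun x => cos (- dot xi x)) = fun x => cos (dot xi x + 0).
    by apply/funext => x; rewrite cosN addr0.
  exact: (rsmooth_ridge_cos (dot_lin xi) (@dot_continuous R n xi)).
have -> : (fun x => sin (- dot xi x)) = fun x => cos (dot xi x + pi / 2).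
  by apply/funext => x; rewrite sinN cosDpihalf.
exact: (rsmooth_ridge_cos (dot_lin xi) (@dot_continuous R n xi)).
Qed.

(** Replaces the compact set by a cube containing it, and C, of unknown sign, by [|C|], so that the
    density of trigonometric polynomials on cubes applies. *)
Lemma distribution_bound T : compactly_supported_distribution T ->
  exists C L : R, exists N : nat, 0 <= C /\
    forall (f : X -> R) M, rsmooth f -> 0 <= M -> bnd L N f M ->
      normc (T (fun x => (f x)%:C)) <= C * M.
Proof.
move=> [_ [K [N [C [cK bd]]]]].
have /fin_all_exists[B HB] : forall i : 'I_n, exists B : R, 0 <= B /\
    forall x : X, K x -> `|x 0 i| <= B.
  move=> i; have [B B0 HB] := compact_bound (@coord_continuous R 1 n 0 i) cK.
  by exists B.
exists `|C|, (\sum_i B i), N; split=> // f M sf M0 H.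
have cKB : K `<=` cube (\sum_i B i).
  move=> x Kx i; have [_ Hi] := HB i; apply: le_trans (Hi x Kx) _.
  rewrite (bigD1 i) //= lerDl sumr_ge0 // => k _; by have [] := HB k.
have eD (w : seq 'I_n) x : normc (Dirs [seq basis_vec R i | i <- w] (fun x => (f x)%:C) x)
    = `|dirs [seq basis_vec R i | i <- w] f x|.
  have := Re_Dirs [seq basis_vec R i | i <- w] (fun x => (f x)%:C) x.
  have := Im_Dirs [seq basis_vec R i | i <- w] (fun x => (f x)%:C) x.
  have -> : dirs [seq basis_vec R i | i <- w] (fun y => complex.Im (f y)%:C) x = 0.
    by rewrite -[RHS](congr1 (fun g => g x) (dirs_cst0 [seq basis_vec R i | i <- w])).
  case: (Dirs _ _ _) => a b /= -> ->.
  by rewrite expr0n addr0 sqrtr_sqr.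
apply: le_trans (bd _ (smooth_real sf)) _.
have sM : seminorm K N (fun x => (f x)%:C) <= M.
  by apply: seminorm_le => // w x sw Kx; rewrite eD; apply: H => //; exact: cKB.
have s0 : 0 <= seminorm K N (fun x => (f x)%:C).
  have [->|/set0P[x Kx]] := eqVneq K set0.
    rewrite /seminorm (_ : [set r | _] = set0) ?sup0 //.
    by apply/seteqP; split=> // r [w [x []]].
  by apply: le_trans (normc_ge0 _) (seminorm_ub (w := [::]) (smooth_real sf) cK isT Kx).
apply: le_trans (ler_wpM2r s0 (ler_norm C)) _.
by rewrite ler_wpM2l.
Qed.

(** Euler's formula. The final [+ 0] gives both terms the shape c phi + psi in which linearity of a
    distribution is stated. *)
Lemma cos_expi (xi : X) th x : (cos (dot xi x + th))%:C =
  (2^-1)%:C * expi th * expi (- dot (- xi) x) +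
  ((2^-1)%:C * expi (- th) * expi (- dot xi x) + 0).
Proof.
rewrite dotNl opprK addr0; apply/eqP; rewrite eq_complex /= cosD !cosN !sinN.
by apply/andP; split; apply/eqP; field.
Qed.

Lemma smooth0 : smooth (fun _ : X => 0 : R[i]).
Proof. by apply/smoothP; split; exact: rsmooth_cst. Qed.

Section TwoDistributions.
Variables T1 T2 : functional R n.
Hypotheses (d1 : compactly_supported_distribution T1)
           (d2 : compactly_supported_distribution T2).
Hypothesis eqF : forall xi, fourier T1 xi = fourier T2 xi.

Lemma eq_zero_fun : T1 (fun=> 0) = T2 (fun=> 0).
Proof.
have z T : compactly_supported_distribution T -> T (fun=> 0) = 0.
  move=> [lin _]; have := lin 1 _ _ smooth0 smooth0.
  rewrite (_ : (fun _ => _) = fun=> 0); last by apply/funext => x; rewrite mulr0 addr0.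
  by rewrite mul1r => /eqP; rewrite -subr_eq0 opprD addrA subrr sub0r oppr_eq0 => /eqP.
by rewrite !z.
Qed.

Lemma eq_on_ridge xi th : T1 (fun x => (cos (dot xi x + th))%:C) =
  T2 (fun x => (cos (dot xi x + th))%:C).
Proof.
have [l1 _] := d1; have [l2 _] := d2.
have -> : (fun x => (cos (dot xi x + th))%:C) = fun x =>
    (2^-1)%:C * expi th * expi (- dot (- xi) x) +
    ((2^-1)%:C * expi (- th) * expi (- dot xi x) + 0).
  by apply/funext => x; exact: cos_expi.
set a := _ * expi th; set b := _ * expi (- th).
have sb : smooth (fun x : X => b * expi (- dot xi x) + 0).
  by apply: (smooth_lin b (smooth_expi xi) smooth0).
rewrite (l1 a _ _ (smooth_expi (- xi)) sb) (l2 a _ _ (smooth_expi (- xi)) sb).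
rewrite (l1 b _ _ (smooth_expi xi) smooth0) (l2 b _ _ (smooth_expi xi) smooth0).
by rewrite eq_zero_fun; congr (_ * _ + (_ * _ + _)); exact: eqF.
Qed.

Lemma eq_on_tpoly p : T1 (fun x => (tpoly p x)%:C) = T2 (fun x => (tpoly p x)%:C).
Proof.
have [l1 _] := d1; have [l2 _] := d2.
elim: p => [|[[c xi] th] p ih].
  have -> : (fun x : X => (tpoly [::] x)%:C) = fun=> 0 :> R[i].
    by apply/funext => x; rewrite /tpoly big_nil.
  exact: eq_zero_fun.
have -> : (fun x => (tpoly ((c, xi, th) :: p) x)%:C) =
    fun x => c%:C * (cos (dot xi x + th))%:C + (tpoly p x)%:C.
  by apply/funext => x; rewrite /tpoly big_cons /= rmorphD rmorphM.
have s1 := smooth_real (rsmooth_ridge_cos (dot_lin xi) (@dot_continuous R n xi) th).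
have s2 := smooth_real (rsmooth_tpoly p).
by rewrite (l1 _ _ _ s1 s2) (l2 _ _ _ s1 s2) ih eq_on_ridge.
Qed.

Lemma normc_addD (z w : R[i]) : normc (z + w) <= normc z + normc w.
Proof. exact: le_normcD. Qed.

Lemma eq_on_real (f : X -> R) : rsmooth f ->
  T1 (fun x => (f x)%:C) = T2 (fun x => (f x)%:C).
Proof.
move=> sf; have [l1 _] := d1; have [l2 _] := d2.
have [C1 [L1 [N1 [C10 b1]]]] := distribution_bound d1.
have [C2 [L2 [N2 [C20 b2]]]] := distribution_bound d2.
set z1 := T1 _; set z2 := T2 _.
suff H e : 0 < e -> normc (z1 - z2) <= (C1 + C2) * e.
  have H0 : normc (z1 - z2) <= 0.
    apply/ler_addgt0Pl => e e0; rewrite addr0.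
    have D1 : 0 < C1 + C2 + 1 by rewrite ltr_wpDl // addr_ge0.
    apply: le_trans (H (e / (C1 + C2 + 1)) _) _; first by rewrite divr_gt0.
    by rewrite mulrA ler_pdivrMr // mulrC ler_pM2l //; lra.
  apply/eqP; rewrite -subr_eq0; apply/eqP.
  by apply: ComplexField.Normc.eq0_normc; apply/le_anti; rewrite H0 normc_ge0.
(* This radius is at least L1 and at least L2, whatever their signs. *)
move=> e0; have [p Hp] := trig_density (L1 + `|L2| + `|L1|) sf (N1 + N2) e0.
have sp := rsmooth_tpoly p; have sB := rsmoothB sf sp.
have split_f T : (forall (c : R[i]) phi psi, smooth phi -> smooth psi ->
     T (fun x => c * phi x + psi x) = c * T phi + T psi) ->
    T (fun x => (f x)%:C) = T (fun x => (f x - tpoly p x)%:C) + T (fun x => (tpoly p x)%:C).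
  move=> lin; rewrite -[T (fun x => (f x - _)%:C)]mul1r.
  rewrite -(lin 1 _ _ (smooth_real sB) (smooth_real sp)); congr T.
  by apply/funext => x; rewrite mul1r -rmorphD subrK.
rewrite /z1 /z2 (split_f T1 l1) (split_f T2 l2) eq_on_tpoly opprD addrACA subrr addr0.
have h1 := b1 _ e sB (ltW e0); have h2 := b2 _ e sB (ltW e0).
apply: le_trans (normc_addD _ _) _; rewrite mulrDl; apply: lerD.
  apply: h1; apply: bnd_antimono Hp; last exact: leq_addr.
  by rewrite -addrA lerDl addr_ge0.
rewrite normcN; apply: h2; apply: bnd_antimono Hp; last exact: leq_addl.
rewrite addrAC; apply: le_trans (ler_norm L2) _; rewrite lerDr.
by rewrite -lerBlDr sub0r; exact: lerNnormlW.
Qed.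

Lemma distribution_unique phi : smooth phi -> T1 phi = T2 phi.
Proof.
move=> /smoothP[sr si]; have [l1 _] := d1; have [l2 _] := d2.
have -> : phi = fun x => 'i * (complex.Im (phi x))%:C + (complex.Re (phi x))%:C.
  apply/funext => x; case: (phi x) => a b /=.
  by apply/eqP; rewrite eq_complex /=; apply/andP; split; apply/eqP; ring.
rewrite (l1 _ _ _ (smooth_real si) (smooth_real sr)).
rewrite (l2 _ _ _ (smooth_real si) (smooth_real sr)).
by rewrite (eq_on_real sr) (eq_on_real si).
Qed.

End TwoDistributions.

End FourierUniqueness.

(** * Chebyshev polynomials and the wave identity *)

Section ChebyshevSums.
Variable R : realType.
Implicit Types (th : R) (k : nat).
Local Notation U k := (chebyshevU_nat R k).

Lemma chebyshevU_rec k (c : R) : (U k.+2).[c] = 2 * c * (U k.+1).[c] - (U k).[c].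
Proof. by rewrite -[U k.+2]/(2%:R *: 'X * U k.+1 - U k) !hornerE. Qed.

Lemma chebyshevU_sin k th : (U k).[cos th] * sin th = sin (k.+1%:R * th).
Proof.
suff H l : (U l).[cos th] * sin th = sin (l.+1%:R * th) /\
    (U l.+1).[cos th] * sin th = sin (l.+2%:R * th) by have [] := H k.
elim: l => [|l [ih1 ih2]].
  split; first by rewrite /= hornerE !mul1r.
  rewrite -[U 1]/(2%:R *: 'X) !hornerE.
  have -> : 2%:R * th = th + th by ring.
  by rewrite sinD; ring.
split=> //; rewrite chebyshevU_rec mulrBl -(mulrA (2 * cos th)) ih1 ih2.
have -> : l.+3%:R * th = l.+2%:R * th + th by rewrite -(natr1 l.+2); ring.
have -> : l.+1%:R * th = l.+2%:R * th - th by rewrite -(natr1 l.+1); ring.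
by rewrite sinB sinD; ring.
Qed.

(** The frequencies are k, k - 2, ..., -k. Multiplication by 2 cos th shifts the frequencies of
    degree l + 1 by 1 up and down; the lower shift is the sum of degree l plus the frequency -(l +
    2), exactly the one that the upper shift lacks for degree l + 2. *)
Lemma chebyshevU_cos_sum k th :
  (U k).[cos th] = \sum_(i < k.+1) cos ((k.+1%:R - 1 - 2 * i%:R) * th).
Proof.
pose S l := \sum_(i < l.+1) cos ((l.+1%:R - 1 - 2 * i%:R) * th).
suff H l : (U l).[cos th] = S l /\ (U l.+1).[cos th] = S l.+1 by have [] := H k.
elim: l => [|l [ih1 ih2]].
  split; first by rewrite /S big_ord1 subrr mulr0 subr0 mul0r cos0 /= hornerE.
  rewrite -[U 1]/(2%:R *: 'X) !hornerE /S !big_ord_recl big_ord0 /=.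
  have -> : (2%:R - 1 - 2 * 0%:R) * th = th by ring.
  have -> : (2%:R - 1 - 2 * (bump 0 0)%:R) * th = - th by rewrite /bump /=; ring.
  by rewrite cosN; ring.
split=> //; rewrite chebyshevU_rec ih1 ih2 /S.
have -> : 2 * cos th * (\sum_(i < l.+2) cos ((l.+2%:R - 1 - 2 * i%:R) * th)) =
    \sum_(i < l.+2) cos ((l.+3%:R - 1 - 2 * i%:R) * th) +
    \sum_(i < l.+2) cos ((l.+1%:R - 1 - 2 * i%:R) * th).
  rewrite mulr_sumr -big_split; apply: eq_bigr => i _ /=.
  set A := (l.+2%:R - 1 - 2 * i%:R) * th.
  have -> : (l.+3%:R - 1 - 2 * i%:R) * th = A + th.
    by rewrite /A -(natr1 l.+2); ring.
  have -> : (l.+1%:R - 1 - 2 * i%:R) * th = A - th.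
    by rewrite /A -(natr1 l.+1); ring.
  by rewrite cosD cosB; ring.
have -> : \sum_(i < l.+2) cos ((l.+1%:R - 1 - 2 * i%:R) * th) =
    \sum_(i < l.+1) cos ((l.+1%:R - 1 - 2 * i%:R) * th) +
    cos ((l.+1%:R - 1 - 2 * l.+1%:R) * th) by rewrite big_ord_recr.
rewrite [RHS]big_ord_recr /=.
have -> : (l.+3%:R - 1 - 2 * l.+2%:R) * th = (l.+1%:R - 1 - 2 * l.+1%:R) * th.
  by rewrite -(natr1 l.+2) -(natr1 l.+1); ring.
by rewrite addrA addrAC addrK.
Qed.

Lemma chebyshevU_pred0 : chebyshevU R (Posz 0 - 1) = 0.
Proof. by []. Qed.

Lemma chebyshevU_predS k : chebyshevU R (Posz k.+1 - 1) = U k.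
Proof. by have -> : Posz k.+1 - 1 = Posz k by lia. Qed.

Lemma chebyshevU_predN k : chebyshevU R (Negz k - 1) = - U k.
Proof. by have -> : Negz k - 1 = Negz k.+1 by lia. Qed.

Lemma chebyshevU_int_sin (m : int) th :
  (chebyshevU R (m - 1)).[cos th] * sin th = sin (m%:~R * th).
Proof.
case: m => [[|k]|k].
- by rewrite chebyshevU_pred0 horner0 !mul0r sin0.
- by rewrite chebyshevU_predS chebyshevU_sin.
- by rewrite chebyshevU_predN hornerN mulNr chebyshevU_sin NegzE mulrNz mulNr sinN.
Qed.

End ChebyshevSums.

Section SineQuotientLimit.
Variables (R : realType) (n : nat).
Local Notation X := 'rV[R]_n.

Lemma eucl_norm_continuous : continuous (@eucl_norm R n).
Proof.
move=> x.
have ci i : continuous (fun x : X => x 0 i * x 0 i).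
  move=> y.
  have c2 : {for y, continuous (fun x : X => x 0 i : R)} := @coord_continuous R 1 n 0 i y.
  exact: (@cvgM R _ (nbhs y) _ _ _ _ _ c2 c2).
have cd : continuous (fun x : X => dot x x).
  exact: (continuous_sumr (r := index_enum 'I_n) ci).
exact: (continuous_comp (cd x) (@sqrt_continuous R _)).
Qed.

(** The extension by continuity of the quotient: where the sine does not vanish, the quotient equals
    a polynomial in cos (s |eta|), which is continuous everywhere. *)
Lemma cvg_sine_quotient (m : int) (s : R) (xi : X) :
  sine_quotient m s eta
    @[eta --> within [set eta | sin (s * eucl_norm eta) != 0] (nbhs xi)]
    --> (chebyshevU R (m - 1)).[cos (s * eucl_norm xi)].
Proof.
pose g (eta : X) := (chebyshevU R (m - 1)).[cos (s * eucl_norm eta)].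
have cg : g eta @[eta --> xi] --> g xi.
  have c1 : {for xi, continuous (fun eta : X => s * eucl_norm eta)}.
    exact: (@cvgM R _ (nbhs xi) _ (fun=> s) (@eucl_norm R n) s _ (cvg_cst _)
      (@eucl_norm_continuous xi)).
  have c2 := continuous_comp c1 (@continuous_cos R _).
  exact: (continuous_comp c2 (@continuous_horner R (chebyshevU R (m - 1)) _)).
apply: cvg_trans cg; apply: (@cvg_trans _ (g @ within
    [set eta | sin (s * eucl_norm eta) != 0] (nbhs xi))); last first.
  by apply: cvg_app; exact: cvg_within.
apply: near_eq_cvg.
have H : nbhs xi [set eta | sin (s * eucl_norm eta) != 0 ->
    g eta = sine_quotient m s eta].
  apply: filterE => eta h.
  by rewrite /g /sine_quotient -mulrA -chebyshevU_int_sin mulfK.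
exact: H.
Qed.

End SineQuotientLimit.

(** * Action on the snapshots of a wave *)

Section ReflectedWaves.
Variables (R : realType) (n : nat).
Local Notation X := 'rV[R]_n.
Local Notation V := ('rV[R]_n * R)%type.
Variables (g : V -> R) (x : X) (tau e : R).
Hypotheses (sg : rsmooth g) (wg : wave_eq g).

(** The reflection in space is that of a convolution; e = 1 and e = -1 are the two directions of
    time, and averaging over them gives an even wave. *)
Definition refl_map (z : V) : V := (x - z.1, tau + e * z.2).
Definition refl_lin (z : V) : V := (- z.1, e * z.2).

Lemma refl_affine (h : R) (u z : V) :
  refl_map (h *: u + z) = h *: refl_lin u + refl_map z.
Proof.
congr pair; rewrite /=; first by rewrite scalerN opprD addrCA addrA.
by rewrite /GRing.scale /=; ring.
Qed.

Lemma refl_continuous : continuous refl_map.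
Proof.
move=> z.
have c1 : {for z, continuous (fun z : V => x - z.1)}.
  exact: (@cvgB R X _ (nbhs z) _ (fun=> x) (fun z : V => z.1) x z.1 (cvg_cst _) cvg_fst).
have c2 : {for z, continuous (fun z : V => e * z.2)}.
  exact: (@cvgM R _ (nbhs z) _ (fun=> e) (fun z : V => z.2) e z.2 (cvg_cst _) cvg_snd).
have c3 : {for z, continuous (fun z : V => tau + e * z.2)}.
  exact: (@cvgD R R _ (nbhs z) _ (fun=> tau) (fun z : V => e * z.2) _ _ (cvg_cst _) c2).
have := @cvg_pair _ _ _ (nbhs z) (nbhs (x - z.1)) (nbhs (tau + e * z.2)) _ _ _
  (fun z : V => x - z.1) (fun z : V => tau + e * z.2).
by apply; [exact: c1 | exact: c3].
Qed.

Lemma rsmooth_refl : rsmooth (fun z => g (refl_map z)).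
Proof. exact: (rsmooth_affine (f := g) refl_affine refl_continuous). Qed.

Lemma wave_eq_refl : e = 1 \/ e = -1 -> wave_eq (fun z => g (refl_map z)).
Proof.
move=> he z.
have E u : pd u (pd u (fun z => g (refl_map z))) z =
    pd (refl_lin u) (pd (refl_lin u) g) (refl_map z).
  exact: (congr1 (fun f : V -> R => f z) (dirs_affine refl_affine [:: u; u] g)).
rewrite E; under eq_bigr do rewrite E.
have Ls i : refl_lin (space_dir R i) = - space_dir R i.
  by congr pair; rewrite /= mulr0 oppr0.
have Lt : refl_lin (time_dir R n) = time_dir R n \/
          refl_lin (time_dir R n) = - time_dir R n.
  case: he => he; [left|right]; rewrite /refl_lin he.
    by congr pair; rewrite /= ?oppr0 ?mul1r.
  by congr pair; rewrite /= mulN1r.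
under eq_bigr do rewrite Ls (deriveNdir2 _ sg).
rewrite wg; case: Lt => -> //.
by rewrite (deriveNdir2 _ sg).
Qed.

End ReflectedWaves.

Section Psi.
Variables (R : realType) (n : nat).
Local Notation X := 'rV[R]_n.
Local Notation V := ('rV[R]_n * R)%type.
Variable T : R -> (X -> R) -> R.
Hypothesis distT : forall t, real_distribution (T t).
Hypothesis propT : forall t (v : V -> R), even_wave v -> T t (fun x => v (x, 0)) = v (0, t).
Variable s : R.

Definition psi_nat (k : nat) (f : X -> R) : R :=
  \sum_(i < k) T ((k%:R - 1 - 2 * i%:R) * s) f.

Definition psi_real (m : int) (f : X -> R) : R :=
  match m with Posz k => psi_nat k f | Negz k => - psi_nat k.+1 f end.

Definition Psi (m : int) : functional R n := complexify (psi_real m).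

Lemma psi_real_distribution m : real_distribution (psi_real m).
Proof.
have H k : real_distribution (psi_nat k).
  by apply: real_distribution_sum => i; exact: distT.
by case: m => k; [exact: H | exact: real_distributionN].
Qed.

Lemma T_ridge t (xi : X) th :
  T t (fun x => cos (dot xi x + th)) = cos (t * eucl_norm xi) * cos th.
Proof.
have := propT t (standing_even_wave xi th).
rewrite standingE dot0r add0r => <-; congr (T t _); apply/funext => x.
by rewrite standingE mul0r cos0 mul1r.
Qed.

Lemma psi_real_ridge m (xi : X) th : psi_real m (fun x => cos (dot xi x + th)) =
  (chebyshevU R (m - 1)).[cos (s * eucl_norm xi)] * cos th.
Proof.
have E k : psi_nat k.+1 (fun x => cos (dot xi x + th)) =
    (chebyshevU_nat R k).[cos (s * eucl_norm xi)] * cos th.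
  rewrite chebyshevU_cos_sum mulr_suml; apply: eq_bigr => i _.
  by rewrite T_ridge mulrA.
case: m => [[|k]|k]; rewrite /psi_real.
- by rewrite chebyshevU_pred0 horner0 mul0r /psi_nat big_ord0.
- by rewrite chebyshevU_predS E.
- by rewrite chebyshevU_predN hornerN mulNr E.
Qed.

Lemma fourier_Psi m (xi : X) :
  fourier (Psi m) xi = ((chebyshevU R (m - 1)).[cos (s * eucl_norm xi)])%:C.
Proof.
rewrite /fourier /Psi /complexify /=.
have -> : (fun x => cos (- dot xi x)) = fun x => cos (dot xi x + 0).
  by apply/funext => x; rewrite cosN addr0.
have -> : (fun x => sin (- dot xi x)) = fun x => cos (dot xi x + pi / 2).
  by apply/funext => x; rewrite sinN cosDpihalf.
by rewrite !psi_real_ridge cos0 cos_pihalf mulr1 mulr0.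
Qed.

Section WaveIdentity.
Variables (g : V -> R) (x : X).
Hypotheses (sg : rsmooth g) (wg : wave_eq g).

(** The argument of [T t] is the slice at time 0 of the average v of the two reflected waves, and
    the right-hand side is v (0, t). *)
Lemma T_wave t tau : T t (fun y => g (x - y, tau)) =
  2^-1 * (g (x, tau + t) + g (x, tau - t)).
Proof.
pose v (z : V) := 2^-1 * (g (refl_map x tau 1 z) + g (refl_map x tau (-1) z)).
have s1 := rsmooth_refl x tau 1 sg; have s2 := rsmooth_refl x tau (-1) sg.
have ev : even_wave v.
  split; first exact: (rsmoothZ _ (rsmoothD s1 s2)).
    apply: (wave_eqZ _ (rsmoothD s1 s2)); apply: (wave_eqD s1 s2).
      by apply: wave_eq_refl => //; left.
    by apply: wave_eq_refl => //; right.
  by move=> y r; rewrite /v /refl_map /= !mul1r !mulN1r opprK addrC.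
have <- : v (0, t) = 2^-1 * (g (x, tau + t) + g (x, tau - t)).
  by rewrite /v /refl_map /= subr0 mul1r mulN1r.
rewrite -(propT t ev); congr (T t _); apply/funext => y.
by rewrite /v /refl_map /= !mulr0 addr0; field.
Qed.

Lemma psi_nat_wave k tau : psi_nat k (fun y => g (x - y, tau)) =
  \sum_(i < k) g (x, tau + (k%:R - 1 - 2 * i%:R) * s).
Proof.
rewrite /psi_nat; under eq_bigr do rewrite T_wave.
rewrite -mulr_sumr big_split /=.
have -> : \sum_(i < k) g (x, tau - (k%:R - 1 - 2 * i%:R) * s) =
          \sum_(i < k) g (x, tau + (k%:R - 1 - 2 * i%:R) * s).
  (* The offsets (k - 1 - 2 i) s are symmetric under i |-> k - 1 - i, so both halves of [T_wave]
     give the same sum. *)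
  rewrite (reindex_inj rev_ord_inj) /=; apply: eq_bigr => i _.
  congr (g (x, tau + _)); rewrite -mulNr; congr (_ * s).
  by rewrite natrB // -(natr1 i); ring.
by field.
Qed.

(** Both sums run over times spaced by 2 s and overlap except at one end. For m > 0 the first sum
    has the extra time a + m s at the top; for m < 0 both signs are reversed and the second sum has
    it at the bottom; for m = 0 only the term of Psi_(-1) = - Psi_1 remains. *)
Lemma psi_real_wave m a : g (x, a + m%:~R * s) =
  psi_real m (fun y => g (x - y, a + s)) - psi_real (m - 1) (fun y => g (x - y, a)).
Proof.
case: m => [[|k]|k].
- have -> : Posz 0 - 1 = Negz 0 by [].
  rewrite /= !psi_nat_wave big_ord0 big_ord1 sub0r opprK.
  by congr (g (x, a + _)); rewrite /= mulr0 subrr subr0 !mul0r.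
- have -> : Posz k.+1 - 1 = Posz k by lia.
  rewrite /= !psi_nat_wave big_ord_recl /=.
  rewrite [X in X + _ - _](_ : _ = g (x, a + k.+1%:R * s)); last first.
    by congr (g (x, _)); ring.
  rewrite [X in _ + X - _](_ : _ = \sum_(i < k) g (x, a + (k%:R - 1 - 2 * i%:R) * s)).
    by rewrite addrK.
  apply: eq_bigr => i _; congr (g (x, _)).
  by rewrite /bump /= add1n -(natr1 i) -(natr1 k); ring.
have -> : Negz k - 1 = Negz k.+1 by lia.
rewrite /= !psi_nat_wave opprK NegzE mulrNz [X in _ = _ + X]big_ord_recr /= addrA.
rewrite [X in _ = _ + X](_ : _ = g (x, a + - k.+1%:R * s)); last first.
  by congr (g (x, _)); rewrite -(natr1 k.+1); ring.
rewrite [X in _ = _ + X + _](_ : _ = \sum_(i < k.+1) g (x, a + s + (k.+1%:R - 1 - 2 * i%:R) * s)).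
  by rewrite addNr add0r.
apply: eq_bigr => i _; congr (g (x, _)).
by rewrite -(natr1 k.+1); ring.
Qed.

End WaveIdentity.

Lemma Re_sum (I : Type) (r : seq I) (F : I -> R[i]) :
  complex.Re (\sum_(i <- r) F i) = \sum_(i <- r) complex.Re (F i).
Proof. by apply: (big_morph (@complex.Re R)) => // -[? ?] [? ?]. Qed.

Lemma Im_sum (I : Type) (r : seq I) (F : I -> R[i]) :
  complex.Im (\sum_(i <- r) F i) = \sum_(i <- r) complex.Im (F i).
Proof. by apply: (big_morph (@complex.Im R)) => // -[? ?] [? ?]. Qed.

Lemma wave_components (u : V -> R[i]) : wave u ->
  [/\ rsmooth (fun z => complex.Re (u z)), rsmooth (fun z => complex.Im (u z)),
      wave_eq (fun z => complex.Re (u z)) & wave_eq (fun z => complex.Im (u z))].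
Proof.
move=> [/smoothP[sr si] we].
have HR : wave_eq (fun z => complex.Re (u z)).
  move=> z; have E w : complex.Re (Dirs [:: w; w] u z) =
    pd w (pd w (fun z => complex.Re (u z))) z := Re_Dirs [:: w; w] u z.
  apply: etrans (etrans _ (congr1 (@complex.Re R) (we z))) (E (time_dir R n)).
  by rewrite Re_sum; apply: eq_bigr => i _; exact: esym (E (space_dir R i)).
have HI : wave_eq (fun z => complex.Im (u z)).
  move=> z; have E w : complex.Im (Dirs [:: w; w] u z) =
    pd w (pd w (fun z => complex.Im (u z))) z := Im_Dirs [:: w; w] u z.
  apply: etrans (etrans _ (congr1 (@complex.Im R) (we z))) (E (time_dir R n)).
  by rewrite Im_sum; apply: eq_bigr => i _; exact: esym (E (space_dir R i)).
exact: And4 sr si HR HI.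
Qed.

Lemma snapshot_convolution (u : V -> R[i]) a m x : wave u ->
  snapshot u (a + m%:~R * s) x =
    convolution (snapshot u (a + s)) (Psi m) x - convolution (snapshot u a) (Psi (m - 1)) x.
Proof.
move=> /wave_components[sr si wr wi].
have er := psi_real_wave x sr wr m a; have ei := psi_real_wave x si wi m a.
apply/eqP; rewrite eq_complex; apply/andP; split; apply/eqP; [exact: er | exact: ei].
Qed.

End Psi.

Theorem theorem2p7 (R : realType) (n : nat) (hn : (0 < n)%N)
    (a b : R) (hab : a < b) :
  let s := b - a in
  (forall (m : int) (xi : 'rV[R]_n),
     sine_quotient m s eta
       @[eta --> within [set eta | sin (s * eucl_norm eta) != 0] (nbhs xi)]
       --> (chebyshevU R (m - 1)).[cos (s * eucl_norm xi)]) /\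
  (exists Psi : int -> functional R n,
     (forall m : int,
        [/\ compactly_supported_distribution (Psi m),
            forall xi : 'rV[R]_n, fourier (Psi m) xi =
              ((chebyshevU R (m - 1)).[cos (s * eucl_norm xi)])%:C &
            forall T : functional R n, compactly_supported_distribution T ->
              (forall xi : 'rV[R]_n, fourier T xi =
                 ((chebyshevU R (m - 1)).[cos (s * eucl_norm xi)])%:C) ->
              forall phi : 'rV[R]_n -> R[i], smooth phi -> T phi = Psi m phi]) /\
     (forall u : 'rV[R]_n * R -> R[i], wave u ->
        forall (m : int) (x : 'rV[R]_n),
          snapshot u (a + m%:~R * (b - a)) x =
            convolution (snapshot u b) (Psi m) x
            - convolution (snapshot u a) (Psi (m - 1)) x)) /\
  (forall u v : 'rV[R]_n * R -> R[i], wave u -> wave v ->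
     snapshot u a = snapshot v a -> snapshot u b = snapshot v b ->
     forall m : int,
       snapshot u (a + m%:~R * (b - a)) = snapshot v (a + m%:~R * (b - a))).
Proof.
move=> s.
have H t : exists T : ('rV[R]_n -> R) -> R, real_distribution T /\
    forall v : 'rV[R]_n * R -> R, even_wave v -> T (fun x => v (x, 0)) = v (0, t).
  have [T [C [L [C0 L0 lin bd prop]]]] := propagator_exists hn t.
  by exists T; split=> //; split=> //; exists C, L, n.
(* One propagator is chosen for each time t, since [Psi] combines several of them. *)
have [T HT] := boolp.choice H.
have distT t := (HT t).1; have propT t := (HT t).2.
have snap (u : 'rV[R]_n * R -> R[i]) : wave u -> forall (m : int) (x : 'rV[R]_n),
    snapshot u (a + m%:~R * (b - a)) x = convolution (snapshot u b) (Psi T s m) x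
      - convolution (snapshot u a) (Psi T s (m - 1)) x.
  move=> wu m x; have := snapshot_convolution propT s a m x wu.
  by rewrite /s [a + (b - a)]addrC subrK.
split; first by move=> m xi; exact: cvg_sine_quotient.
split; last first.
  (* The formula involves a wave only through its snapshots at a and b, with the same distributions
     for all waves. *)
  move=> u v wu wv ea eb m; apply/funext => x.
  by rewrite (snap u wu) (snap v wv) ea eb.
exists (Psi T s); split; last exact: snap.
move=> m; have dm := complexify_distribution (psi_real_distribution distT s m).
split=> //; first by move=> xi; exact: fourier_Psi.
move=> T' dT' hT' phi sphi; apply: (distribution_unique dT' dm) => // xi.
by rewrite hT'; apply/esym; exact: fourier_Psi.
Qed.
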